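(* Let $h\in C(\Omega)$ satisfy $0<\frac{\alpha}{d(x)^{2s}}\le h(x)\le\frac{\beta}{d(x)^{2s}}$ in $\Omega$ for some $0<\alpha\le\beta$, and let the set-valued map $x\mapsto\Omega(x)\subset\Omega$ and the open set $\Sigma\subset\mathbb{R}^N$ satisfy: (i) for all $x\in\Omega$, $\lim_{y\to x}|\Omega(y)\triangle\Omega(x)|=0$; (ii) there is $\zeta\in(0,1/2)$ such that for all $x\in\Omega$ and all $r\le\zeta d(x)$, $\tilde\Omega(x)\cap B_r(0)=\Sigma\cap B_r(0)$; (iii) $\Sigma=-\Sigma$ and there is $q\in(0,1)$ such that $|\Sigma\cap(B_{2r}(0)\setminus B_r(0))|\ge q|B_{2r}(0)\setminus B_r(0)|$ for every $r>0$. Let $f\in C(\Omega)$ be such that there exist $\eta_f\in(0,2s)$ and $C_f>0$ with $|f(x)|d(x)^{2s-\eta_f}\le C_f$ for all $x\in\Omega$. Then the problem $$h(x)u(x)+\mathcal{L}_s(\Omega(x),u(x))=f(x)\ \text{ in }\Omega,\qquad u=0\ \text{ on }\partial\Omega,$$ admits a unique viscosity solution $u$. Moreover there exist $\eta>0$ and $C>0$ such that $|u(x)|\le C d(x)^{\eta}$ for all $x\in\Omega$.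
   Context: $\Omega\subset\mathbb{R}^N$ is a bounded open set, $s\in(0,1)$, $d(x)=\mathrm{dist}(x,\partial\Omega)$, $|\cdot|$ is Lebesgue measure on sets, $\triangle$ is symmetric difference, $B_r(x)$ is the open ball. For each $x\in\Omega$, $\Omega(x)\subset\Omega$ is a measurable set and $\tilde\Omega(x)=\{z\in\mathbb{R}^N: x-z\in\Omega(x)\}$. The operator is $$\mathcal{L}_s(\Omega(x),\varphi(x))=\mathrm{p.v.}\int_{\Omega(x)}\frac{\varphi(x)-\varphi(y)}{|x-y|^{N+2s}}\,dy=\lim_{\rho\to0}\int_{\Omega(x)\setminus B_\rho(x)}\frac{\varphi(x)-\varphi(y)}{|x-y|^{N+2s}}\,dy .$$ $\mathrm{USC}_b(\Omega)$ and $\mathrm{LSC}_b(\Omega)$ denote the bounded upper, respectively lower, semicontinuous functions on $\Omega$. Viscosity solutions: $u\in\mathrm{USC}_b(\Omega)$ is a viscosity subsolution of $h u+\mathcal{L}_s(\Omega(x),u)=f$ if, whenever $x\in\Omega$ and $\varphi\in C^2(\Omega)$ satisfy $u(x)=\varphi(x)$ and $u\le\varphi$ in $\Omega$, one has $h(x)\varphi(x)+\mathcal{L}_s(\Omega(x),\varphi(x))\le f(x)$. $u\in\mathrm{LSC}_b(\Omega)$ is a viscosity supersolution if, whenever $u(x)=\varphi(x)$ and $u\ge\varphi$ in $\Omega$, one has $h(x)\varphi(x)+\mathcal{L}_s(\Omega(x),\varphi(x))\ge f(x)$. A viscosity solution of the boundary value problem is $u\in C(\overline\Omega)$ that is both a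 sub- and a supersolution and satisfies $u=0$ on $\partial\Omega$ pointwise. *)

(* Defs.v *)
From HB Require Import structures.
From mathcomp Require Import all_boot all_order all_algebra.
From mathcomp Require Import all_classical all_reals all_analysis.

Set Implicit Arguments.
Unset Strict Implicit.
Unset Printing Implicit Defensive.

Import Order.TTheory GRing.Theory Num.Theory.
Import numFieldNormedType.Exports.

Local Open Scope classical_set_scope.
Local Open Scope ring_scope.

(* The space R^N is ['rV[R]_n.+1], with N = n.+1. Its library topology is the
   usual one, but its library norm and balls are those of the sup norm: hence
   the Euclidean norm, balls and distance below. *)

Section euclidean.
Context {R : realType} {n : nat}.
Implicit Types (x y : 'rV[R]_n.+1) (A : set 'rV[R]_n.+1).

Definition enorm x : R := Num.sqrt (\sum_(i < n.+1) x ord0 i ^+ 2).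

Definition eball x (r : R) : set 'rV[R]_n.+1 := [set y | enorm (y - x) < r].

Definition bdry A : set 'rV[R]_n.+1 := closure A `\` interior A.

Definition dist_bdry A x : R := inf [set enorm (x - y) | y in bdry A].

End euclidean.

(* Lebesgue outer measure on R^N: infimum of the total volume of the countable
   covers by half-open boxes. The measurable sets are those of Caratheodory,
   i.e. the Lebesgue (not only the Borel) measurable sets. *)

Section lebesgue_rV.
Context {R : realType} {n : nat}.
Implicit Types (A : set 'rV[R]_n.+1) (B : 'rV[R]_n.+1 * 'rV[R]_n.+1).
Local Open Scope ereal_scope.

Definition box B : set 'rV[R]_n.+1 :=
  [set x | forall i, (B.1 ord0 i < x ord0 i <= B.2 ord0 i)%R].

Definition box_vol B : R :=
  (\prod_(i < n.+1) Num.max 0 (B.2 ord0 i - B.1 ord0 i))%R.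

Definition box_cover A : set (nat -> 'rV[R]_n.+1 * 'rV[R]_n.+1) :=
  [set F | A `<=` \bigcup_k box (F k)].

Definition leb_outer A : \bar R :=
  ereal_inf [set \sum_(k <oo) (box_vol (F k))%:E | F in box_cover A].

Lemma box_vol_ge0 B : 0 <= (box_vol B)%:E.
Proof. by rewrite lee_fin; apply: prodr_ge0 => i _; rewrite le_max lexx. Qed.

Lemma leb_outer_ge0 A : 0 <= leb_outer A.
Proof.
apply: le_ereal_inf_tmp => _ [F _ <-].
by apply: nneseries_ge0 => k _ _; exact: box_vol_ge0.
Qed.

#[local] Hint Resolve leb_outer_ge0 : core.

Lemma leb_outer0 : leb_outer set0 = 0.
Proof.
apply/eqP; rewrite eq_le leb_outer_ge0 andbT.
apply: ereal_inf_lbound; exists (fun=> (0, 0)%R); first exact: sub0set.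
by apply: eseries0 => k _ _; rewrite /box_vol big_ord_recl /= subrr maxxx mul0r.
Qed.

Lemma le_leb_outer : {homo leb_outer : A B / A `<=` B >-> A <= B}.
Proof.
move=> A B AB; apply/ereal_inf_le_tmp => _ [F BF <-].
by exists F => //; exact: subset_trans AB BF.
Qed.

Lemma leb_outer_sigma_subadditive : sigma_subadditive leb_outer.
Proof.
move=> A; have [[i ioo]|] := pselect (exists i, leb_outer (A i) = +oo).
  rewrite (eseries_pinfty _ _ ioo) ?leey// => k _.
  by rewrite -ltNye (lt_le_trans _ (leb_outer_ge0 _)).
rewrite -forallNE => Aoo.
suff add2e (e : {posnum R}) : leb_outer (\bigcup_n A n) <=
    \sum_(i <oo) leb_outer (A i) + e%:num%:E.
  by apply/lee_addgt0Pr => _/posnumP[].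
rewrite (le_trans _ (epsilon_trick _ _ _))//.
pose P k F := box_cover (A k) F /\ \sum_(j <oo) (box_vol (F j))%:E <=
  leb_outer (A k) + (e%:num / (2 ^ k.+1)%:R)%:E.
have [G PG] : {G & forall k, P k (G k)}.
  apply: (@choice _ _ P) => k; rewrite /P /leb_outer.
  set S := (X in ereal_inf X); move infS : (ereal_inf S) => iS.
  case: iS infS => [r Sr|Soo|Soo].
  - have en1 : (0 < e%:num / (2 ^ k.+1)%:R)%R by [].
    have /(lb_ereal_inf_adherent en1) : ereal_inf S \is a fin_num by rewrite Sr.
    move=> [x [F AF Fx] xS].
    by exists F; split => //; rewrite Fx -Sr; exact/ltW.
  - by have := Aoo k; rewrite /leb_outer Soo.
  - by have := leb_outer_ge0 (A k); rewrite /leb_outer Soo.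
pose v := fun p : nat * nat => (box_vol (G p.1 p.2))%:E.
have v_ge0 p : 0 <= v p by exact: box_vol_ge0.
apply: (@le_trans _ _ (\esum_(i in setT) v i)).
  apply: ereal_inf_lbound => /=.
  have /card_esym/ppcard_eqP[f] := card_nat2.
  exists (fun k => G (f k).1 (f k).2).
    move=> t [i _ /(PG i).1[j _ Gijt]].
    by exists (f^-1%FUN (i, j)) => //=; rewrite invK ?inE.
  by rewrite -(esum_pred_image v f xpredT) ?[fun=> _]set_true// image_eq.
rewrite (_ : esum _ _ = \sum_(i <oo) \sum_(j <oo) v (i, j)); last first.
  pose J : nat -> set (nat * nat) := fun i => [set (i, j) | j in setT].
  rewrite (_ : setT = \bigcup_k J k); last first.
    by rewrite predeqE => -[a b]; split => // _; exists a => //; exists b.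
  rewrite esum_bigcupT //=; last first.
    apply/trivIsetP => i j _ _ ij.
    rewrite predeqE => -[k m] /=; split => //= -[] [_] _ [<-{k} _].
    by move=> [m' _] [] /esym/eqP; rewrite (negbTE ij).
  rewrite -(image_id [set: nat]) -fun_true esum_pred_image//; last first.
    by move=> k _; exact: esum_ge0.
  apply: eq_eseriesr => /= j _.
  rewrite -(esum_pred_image v (pair j) predT)//=; last first.
    by move=> ? ? _ _; exact: (@can_inj _ _ _ snd).
  by congr esum; rewrite predeqE => -[a b]; split; move=> [i _ <-]; exists i.
apply: lee_lim.
- by apply: is_cvg_nneseries => k *; apply: nneseries_ge0.
- by apply: is_cvg_nneseries => k *; apply: adde_ge0.
- by near=> k; apply: lee_sum => i _; exact: (PG i).2.
Unshelve. all: by end_near. Qed.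

HB.instance Definition _ := isOuterMeasure.Build R 'rV[R]_n.+1 leb_outer
  leb_outer0 leb_outer_ge0 le_leb_outer leb_outer_sigma_subadditive.

Definition leb_om : {outer_measure set 'rV[R]_n.+1 -> \bar R} := leb_outer.

Definition leb : {measure set (caratheodory_type leb_om) -> \bar R} :=
  (leb_om : set (caratheodory_type leb_om) -> \bar R).

Definition leb_measurable A : Prop := leb_om.-cara.-measurable A.

End lebesgue_rV.

Arguments leb : clear implicits.

Section function_classes.
Context {R : realType} {n : nat}.
Implicit Types (Omega : set 'rV[R]_n.+1) (u phi : 'rV[R]_n.+1 -> R).

Definition partial (i : 'I_n.+1) phi : 'rV[R]_n.+1 -> R :=
  'D_(delta_mx ord0 i) phi.

Definition C1_on Omega phi : Prop :=
  {within Omega, continuous phi} /\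
  forall i, (forall x, Omega x -> derivable phi x (delta_mx ord0 i)) /\
            {within Omega, continuous (partial i phi)}.

Definition C2_on Omega phi : Prop :=
  C1_on Omega phi /\ forall i, C1_on Omega (partial i phi).

(* Semicontinuity on [Omega] is semicontinuity for the topology of
   [subspace Omega], in which the points outside [Omega] are isolated. *)
Definition LSCb Omega u : Prop :=
  lower_semicontinuous (fun x : subspace Omega => (u x)%:E) /\
  exists M : R, forall x, Omega x -> `|u x| <= M.

Definition USCb Omega u : Prop := LSCb Omega (fun x => - u x).

End function_classes.

Section viscosity.
Context {R : realType} {n : nat}.
Implicit Types (Omega : set 'rV[R]_n.+1) (Om : 'rV[R]_n.+1 -> set 'rV[R]_n.+1).
Implicit Types (h f u phi : 'rV[R]_n.+1 -> R).

(* The value is extended real: a test function that is C^2 on [Omega] need not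
   be integrable near the boundary of [Omega]. As a test function from above
   (below) is bounded below (above), the integrals below are then
   unambiguously -oo (+oo). *)
Definition Ls (s : R) (A : set 'rV[R]_n.+1) phi (x : 'rV[R]_n.+1) : \bar R :=
  lim ((\int[leb R n]_(y in A `\` eball x rho)
          ((phi x - phi y) / (enorm (x - y) `^ (n.+1%:R + 2 * s)))%:E)%E
       @[rho --> 0^'+]).

Definition visc_subsolution s Omega Om h f u : Prop :=
  USCb Omega u /\
  forall x phi, Omega x -> C2_on Omega phi -> u x = phi x ->
    (forall y, Omega y -> u y <= phi y) ->
    ((h x * phi x)%:E + Ls s (Om x) phi x <= (f x)%:E)%E.

Definition visc_supersolution s Omega Om h f u : Prop :=
  LSCb Omega u /\
  forall x phi, Omega x -> C2_on Omega phi -> u x = phi x ->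
    (forall y, Omega y -> phi y <= u y) ->
    ((f x)%:E <= (h x * phi x)%:E + Ls s (Om x) phi x)%E.

(* Only the values of [u] on [closure Omega] matter. *)
Definition visc_solution s Omega Om h f u : Prop :=
  [/\ {within closure Omega, continuous u},
      visc_subsolution s Omega Om h f u,
      visc_supersolution s Omega Om h f u &
      forall x, bdry Omega x -> u x = 0].

End viscosity.

(* Main.v *)
From HB Require Import structures.
Require Import Defs.
From mathcomp Require Import all_boot all_order all_algebra finmap.
From mathcomp Require Import all_classical all_reals all_analysis.
From mathcomp Require Import measurable_realfun ring lra.
Import Order.TTheory GRing.Theory Num.Theory.
Import numFieldNormedType.Exports.
Local Open Scope classical_set_scope.
Local Open Scope ring_scope.

Set Implicit Arguments.
Unset Strict Implicit.
Unset Printing Implicit Defensive.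

(** Replace the kernel |z|^-(N+2s) by the capped kernel k_r(z) = max(|z|,r)^-(N+2s), which is
    bounded and Lipschitz, and write L_r for the operator that it defines. Existence goes through
    the equations h u + L_r u = f, uniqueness through a comparison principle that holds for
    their solutions and for viscosity solutions alike.

    Capped equations. Solving h u + L_r u = f for the value u x gives a fixed point equation
    u = (f + K_r u) / (h + mass), where K_r is the integral of u against the kernel: a monotone
    map. For small eta the function d^eta satisfies L_r (d^eta) >= - C eta d^(eta-2s)
    ([nonlocal_dist_pow]): near x because of the symmetry of Sigma and because d^eta is touched
    from above by a power of the distance to the nearest boundary point, far from x because it
    grows slowly. The term h d^eta >= alpha d^(eta-2s) wins, and K d^eta dominates f for some
    eta and K that do not depend on r ([barrier]). Iterating the monotone map from K d^eta
    gives a continuous solution with |u| <= K d^eta ([approx_solution]).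

    Comparison. The notion of subsolution behind everything is [quadratic_sub]: whenever u is
    touched from above at x by a paraboloid of opening c, then
    h u + L_r u <= g + c C0 r^(2-2s) at x, the operator acting on u itself. In the ball of
    radius zeta d(x) the domain of integration is the reflection of Sigma = -Sigma, so
    only second differences count there and the change of the cap inside that ball costs
    c C0 r^(2-2s). If u is such a subsolution for f and v such a supersolution, doubling of
    variables maximises u(x) - v(y) - c |x-y|^2; near x and y the domains are translates of the
    same set, so that the near integrals compare pointwise; the far integrals are continuous in the
    point because the kernel is capped and the symmetric difference of Om y and Om x is small.
    Since c is fixed before r, the error is small and u - v <= kap for all small r
    ([comparison]).

    Conclusion. The capped solutions are therefore uniformly Cauchy; let u be their limit.
    It is a viscosity solution ([limit_visc_sub]): at a point where a C2 function phi touches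
    u from above, phi + |.-x|^2 touches the capped solutions at nearby points, and L_r u and the
    truncated integrals of phi are compared through second differences of phi. Conversely a
    viscosity solution v satisfies [quadratic_sub] at every scale ([visc_quadratic_sub]): a
    touching paraboloid is replaced, away from the contact point, by a C2 function
    uniformly close to v, so that the operator on the test function is close to that on v.
    Hence v is within kap of the capped solutions, for every kap, and v = u. Supersolutions
    are reduced to subsolutions by a change of sign. *)

(** * Euclidean norm and balls *)

Section euclid.
Context {R : realType} {n : nat}.
Implicit Types (x y z : 'rV[R]_n.+1) (A : set 'rV[R]_n.+1).

Lemma enorm_ge0 x : 0 <= enorm x.
Proof. exact: sqrtr_ge0. Qed.

Lemma sqr_enorm x : enorm x ^+ 2 = \sum_(i < n.+1) x ord0 i ^+ 2.
Proof. by rewrite sqr_sqrtr// sumr_ge0// => i _; rewrite sqr_ge0. Qed.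

Lemma enorm0 : enorm (0 : 'rV[R]_n.+1) = 0.
Proof.
apply/eqP; rewrite -sqrf_eq0 sqr_enorm big1// => i _.
by rewrite mxE expr0n.
Qed.

Lemma enormN x : enorm (- x) = enorm x.
Proof. by congr Num.sqrt; apply: eq_bigr => i _; rewrite mxE sqrrN. Qed.

Lemma enormB x y : enorm (x - y) = enorm (y - x).
Proof. by rewrite -enormN opprB. Qed.

Lemma coord_le_enorm x i : `|x ord0 i| <= enorm x.
Proof.
rewrite -(@ler_pXn2r _ 2)// ?nnegrE// ?enorm_ge0//.
by rewrite sqr_enorm real_normK ?num_real// (bigD1 i)//= lerDl sumr_ge0// => j _; rewrite sqr_ge0.
Qed.

Lemma enorm_eq0 x : enorm x = 0 -> x = 0.
Proof.
move=> x0; apply/rowP => i; rewrite mxE; apply/eqP; rewrite -normr_le0.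
by rewrite -x0 coord_le_enorm.
Qed.

Lemma enorm_gt0 x : x != 0 -> 0 < enorm x.
Proof.
move=> x0; rewrite lt_neqAle enorm_ge0 andbT eq_sym.
by apply: contra_neq x0; exact: enorm_eq0.
Qed.

Lemma enorm_le_sum x : enorm x <= \sum_(i < n.+1) `|x ord0 i|.
Proof.
rewrite -(@ler_pXn2r _ 2)// ?nnegrE// ?enorm_ge0// ?sumr_ge0//.
rewrite sqr_enorm expr2 mulr_suml; apply: ler_sum => i _.
rewrite -real_normK ?num_real// expr2 ler_wpM2l// (bigD1 i)//= lerDl.
by rewrite sumr_ge0.
Qed.

Lemma enormD x y : enorm (x + y) <= enorm x + enorm y.
Proof.
have [->|x0] := eqVneq x 0; first by rewrite add0r lerDr enorm_ge0.
have [->|y0] := eqVneq y 0; first by rewrite addr0 lerDl enorm_ge0.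
have {}x0 := enorm_gt0 x0; have {}y0 := enorm_gt0 y0.
rewrite -(@ler_pXn2r _ 2)// ?nnegrE// ?enorm_ge0// ?addr_ge0 ?enorm_ge0//.
rewrite sqr_enorm; set a := enorm x in x0 *; set b := enorm y in y0 *.
have -> : (a + b) ^+ 2 = (1 + b / a) * a ^+ 2 + (1 + a / b) * b ^+ 2.
  by field; rewrite !gt_eqF.
rewrite !sqr_enorm !mulr_sumr -big_split/=; apply: ler_sum => i _.
rewrite mxE; set p := x ord0 i; set q := y ord0 i.
rewrite -subr_ge0 [leRHS](_ : _ = (b * p - a * q) ^+ 2 / (a * b)).
  by rewrite divr_ge0 ?sqr_ge0// mulr_ge0 ?enorm_ge0.
by field; rewrite !gt_eqF.
Qed.

Lemma enorm_distD z x y : enorm (x - y) <= enorm (x - z) + enorm (z - y).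
Proof. by rewrite (le_trans _ (enormD _ _))// addrA subrK. Qed.

Lemma enorm_parallelogram x z :
  enorm (x - z) ^+ 2 + enorm (x + z) ^+ 2 = 2 * enorm x ^+ 2 + 2 * enorm z ^+ 2.
Proof.
rewrite !sqr_enorm !mulr_sumr -!big_split/=; apply: eq_bigr => i _.
by rewrite !mxE; ring.
Qed.

Lemma mx_norm_le_enorm x : `|x| <= enorm x.
Proof.
rewrite [leLHS]/Num.norm/= mx_normrE; apply/bigmax_leP; split => [|[i j] _ /=].
  exact: enorm_ge0.
by rewrite ord1 coord_le_enorm.
Qed.

Lemma enorm_le_mx_norm x : enorm x <= n.+1%:R * `|x|.
Proof.
apply: (le_trans (enorm_le_sum _)).
rewrite mulr_natl -[X in _ *+ X]card_ord -sumr_const; apply: ler_sum => i _.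
rewrite [leRHS]/Num.norm/= mx_normrE; apply/bigmax_geP; right => /=.
by exists (ord0, i).
Qed.

Lemma nbhs_eball x (U : set 'rV[R]_n.+1) :
  nbhs x U <-> exists2 r : R, 0 < r & eball x r `<=` U.
Proof.
split => [/nbhs_ballP[r /= r0 xrU]|[r r0 xrU]].
  exists r => // y xy; apply: xrU; rewrite -ball_normE/= distrC.
  exact: le_lt_trans (mx_norm_le_enorm _) xy.
apply/nbhs_ballP; exists (r / n.+1%:R); first by rewrite /= divr_gt0.
move=> y; rewrite -ball_normE/= distrC => xy; apply: xrU; rewrite /eball/=.
by rewrite (le_lt_trans (enorm_le_mx_norm _))// mulrC -ltr_pdivlMr.
Qed.

Lemma open_eball x r : open (eball x r).
Proof.
rewrite openE => y; rewrite /eball/= => yx; apply/nbhs_eball.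
exists (r - enorm (y - x)); first by rewrite subr_gt0.
by move=> z; rewrite /eball/= ltrBrDr; apply: le_lt_trans; exact: enorm_distD.
Qed.

Lemma eball_sub x r z : eball x r (x - z) = (enorm z < r) :> Prop.
Proof. by rewrite /eball/= addrAC subrr sub0r enormN. Qed.

Lemma eball0E r z : eball 0 r z = (enorm z < r) :> Prop.
Proof. by rewrite /eball/= subr0. Qed.

Lemma enorm_dist_dist x y : `|enorm x - enorm y| <= enorm (x - y).
Proof.
have hx : enorm x <= enorm (x - y) + enorm y.
  by rewrite (le_trans _ (enormD _ _))// subrK.
have hy : enorm y <= enorm (x - y) + enorm x.
  by rewrite enormB (le_trans _ (enormD _ _))// subrK.
by rewrite ler_norml; apply/andP; split; lra.
Qed.

Lemma continuousP_enorm (f : 'rV[R]_n.+1 -> R) x :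
  {for x, continuous f} <-> forall e : R, 0 < e -> exists2 r : R, 0 < r &
    forall y, enorm (y - x) < r -> `|f y - f x| < e.
Proof.
split => [/cvgrPdist_lt fx e e0|fx].
  have /nbhs_eball[r r0 xr] := fx e e0.
  by exists r => // y yx; rewrite distrC; exact: xr.
apply/(@cvgrPdist_lt _ _ _ (nbhs x)) => e e0; apply/nbhs_eball; have [r r0 xr] := fx e e0.
by exists r => // y yx /=; rewrite distrC; exact: xr.
Qed.

Lemma continuous_enorm : continuous (@enorm R n).
Proof.
move=> x; apply/continuousP_enorm => e e0; exists e => // y.
by apply: le_lt_trans; exact: enorm_dist_dist.
Qed.

Lemma continuous_enormB x : continuous (fun w : 'rV[R]_n.+1 => enorm (x - w)).
Proof.
move=> w; apply/continuousP_enorm => e e0; exists e => // y yw.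
apply: (le_lt_trans (enorm_dist_dist _ _)).
have -> : x - y - (x - w) = w - y by rewrite opprB addrCA addrAC subrr add0r.
by rewrite enormB.
Qed.

Lemma bounded_setP_enorm A :
  bounded_set A -> exists2 D : R, 0 < D & forall x, A x -> enorm x <= D.
Proof.
move=> [M [_ /(_ (`|M| + 1))]]; have MM : M < `|M| + 1.
  by rewrite (le_lt_trans (ler_norm M))// ltrDl.
move=> /(_ MM) AM; exists (n.+1%:R * (`|M| + 1)); first by rewrite mulr_gt0// ltr_wpDl.
move=> x Ax; rewrite (le_trans (enorm_le_mx_norm _))// ler_wpM2l//; exact: AM.
Qed.

End euclid.

(** * Lebesgue measure: open sets, balls and point reflections *)

Section lebesgue.
Context {R : realType} {n : nat}.
Notation V := 'rV[R]_n.+1.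
Implicit Types (x y z : V) (A B : set V).

Local Open Scope ereal_scope.

Lemma leb_outer_box (B : V * V) : leb_outer (box B) <= (box_vol B)%:E.
Proof.
pose F k := if k is 0%N then B else ((0%R, 0%R) : V * V).
have F0 k : (0 < k)%N -> (box_vol (F k))%:E = 0.
  by case: k => // k _; rewrite /F/= /box_vol big_ord_recl /= subrr maxxx mul0r.
apply: (@le_trans _ _ (\sum_(k <oo) (box_vol (F k))%:E)).
  by apply: ereal_inf_lbound; exists F => // x Bx; exists 0%N.
rewrite (@nneseries_split _ _ 0%N 1%N)//; last by move=> k _; exact: box_vol_ge0.
by rewrite big_nat1 eseries0 ?adde0// => k k0 _; rewrite F0.
Qed.

Definition halfspace (i : 'I_n.+1) (a : R) : set V := [set x | (x ord0 i <= a)%R].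

(** Cutting every box of a cover along the hyperplane gives covers of the two pieces with
    the same total volume: this is the criterion of Caratheodory. *)
Lemma measurable_halfspace i a : leb_measurable (halfspace i a).
Proof.
apply: le_caratheodory_measurable => X; apply: le_ereal_inf_tmp => _ [F XF <-].
pose L (B : V * V) : V * V :=
  (B.1, \row_j if j == i then Num.min (B.2 ord0 j) a else B.2 ord0 j).
pose U (B : V * V) : V * V :=
  (\row_j (if j == i then Num.max (B.1 ord0 j) a else B.1 ord0 j), B.2).
have volE (B : V * V) : (box_vol B = box_vol (L B) + box_vol (U B))%R.
  have D1 (C : V * V) : box_vol C = (Num.max 0 (C.2 ord0 i - C.1 ord0 i) *
      \prod_(j < n.+1 | j != i) Num.max 0 (C.2 ord0 j - C.1 ord0 j))%R.
    by rewrite /box_vol (bigD1 i).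
  rewrite !D1 /= !mxE eqxx {D1}.
  set P := (\prod_(j < _ | _) _)%R; set P1 := (\prod_(j < _ | _) _)%R.
  set P2 := (\prod_(j < _ | _) _)%R.
  have -> : P1 = P by apply: eq_bigr => j /negbTE ji; rewrite !mxE ji.
  have -> : P2 = P by apply: eq_bigr => j /negbTE ji; rewrite !mxE ji.
  rewrite -mulrDl; congr (_ * _)%R.
  set p := B.1 _ _; set q := B.2 _ _; clear.
  have [qa|aq] := leP q a.
    by rewrite [(Num.max 0 (q - Num.max _ _))%R]max_l ?addr0// subr_le0 le_max qa orbT.
  have [pa|ap] := leP p a; last by rewrite [(Num.max 0 (a - _))%R]max_l ?add0r// subr_le0 ltW.
  by rewrite !max_r ?subr_ge0// ?(le_trans pa)// ?ltW//; lra.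
apply: (@le_trans _ _ (\sum_(k <oo) (box_vol (L (F k)))%:E +
    \sum_(k <oo) (box_vol (U (F k)))%:E)); last first.
  rewrite -nneseriesD; try by move=> k _ _; exact: box_vol_ge0.
  by apply: lee_nneseries => k _ => [_|]; rewrite -?EFinD -?volE//; exact: box_vol_ge0.
apply: leeD; apply: ereal_inf_lbound.
- exists (L \o F) => // x [/XF[k _ Fkx] xa]; exists k => // j /=.
  rewrite mxE; have := Fkx j; case: eqP => // -> /andP[-> /=].
  by rewrite le_min => ->.
- exists (U \o F) => // x [/XF[k _ Fkx] xa]; exists k => // j /=.
  rewrite mxE; have := Fkx j; case: eqP => // -> /andP[/= p ->].
  by rewrite andbT gt_max p/=; move/negP : xa; rewrite -ltNge.
Qed.

Lemma measurable_box (B : V * V) : leb_measurable (box B).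
Proof.
rewrite /leb_measurable.
have -> : box B = \bigcap_(i in [set: 'I_n.+1])
    (halfspace i (B.2 ord0 i) `&` ~` halfspace i (B.1 ord0 i)).
  apply/seteqP; split => [x Bx i _|x Bx i].
    by have /andP[? ?] := Bx i; split => //; apply/negP; rewrite -ltNge.
  by have [? /negP] := Bx i I; rewrite -ltNge => ->.
apply: fin_bigcap_measurable => // i _.
by apply: measurableI; [|apply: measurableC]; exact: measurable_halfspace.
Qed.

(** An open set is the union of the countably many boxes with rational corners that it
    contains. *)
Lemma open_leb_measurable A : open A -> leb_measurable A.
Proof.
move=> oA; rewrite /leb_measurable.
pose q2r (q : 'rV[rat]_n.+1 * 'rV[rat]_n.+1) : V * V :=
  (map_mx ratr q.1, map_mx ratr q.2).
pose F q := if pselect (box (q2r q) `<=` A) then box (q2r q) else set0.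
have -> : A = \bigcup_q F q.
  apply/seteqP; split => [x Ax|x [q _]]; last first.
    by rewrite /F; case: pselect => // qA; exact: qA.
  have /nbhs_ballP[r /= r0 xrA] : nbhs x A by exact: open_nbhs_nbhs.
  have lt1 i : (x ord0 i - r < x ord0 i)%R by rewrite ltrBlDr ltrDl.
  have lt2 i : (x ord0 i < x ord0 i + r)%R by rewrite ltrDl.
  pose q1 := \row_i sval (cid (rat_in_itvoo (lt1 i))).
  pose q2 := \row_i sval (cid (rat_in_itvoo (lt2 i))).
  have q1P i : (x ord0 i - r < ratr (q1 ord0 i) < x ord0 i)%R.
    by rewrite mxE; case: cid => q /=; rewrite in_itv/=.
  have q2P i : (x ord0 i < ratr (q2 ord0 i) < x ord0 i + r)%R.
    by rewrite mxE; case: cid => q /=; rewrite in_itv/=.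
  have mapE (q : 'rV[rat]_n.+1) i : map_mx ratr q ord0 i = ratr (q ord0 i) :> R.
    by rewrite mxE.
  exists (q1, q2) => //; rewrite /F; case: pselect => [_ i|]/=.
    by rewrite !mapE; have /andP[_ ->] := q1P i; have /andP[/ltW -> _] := q2P i.
  case; move=> y qy; apply: xrA; split => // i j; rewrite ord1 /ball/=.
  have /= := qy j; rewrite !mapE => /andP[y1 y2].
  have /andP[h1 _] := q1P j; have /andP[_ h2] := q2P j.
  by rewrite ltr_distlC; apply/andP; split; lra.
apply: countable_bigcupT_measurable => [|q]; first exact: countableP.
by rewrite /F; case: (pselect _) => ? /=; [exact: measurable_box|exact: measurable0].
Qed.

Lemma leb_eball x (r : R) : (0 <= r)%R -> leb R n (eball x r) <= ((2 * r) ^+ n.+1)%:E.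
Proof.
move=> r0; pose B : V * V := (x - const_mx r, x + const_mx r)%R.
apply: (@le_trans _ _ (leb_outer (box B))).
  apply: le_leb_outer => y; rewrite /eball/= => yx i /=.
  have := le_lt_trans (coord_le_enorm (y - x) i) yx.
  by rewrite !mxE ltr_norml => /andP[? ?]; apply/andP; split; lra.
apply: (le_trans (leb_outer_box _)); rewrite lee_fin /box_vol.
under eq_bigr => i _ do rewrite !mxE.
rewrite (eq_bigr (fun=> (2 * r)%R)) ?prodr_const ?card_ord// => i _.
by rewrite (_ : _ - _ = 2 * r)%R; [rewrite max_r// mulr_ge0|ring].
Qed.

End lebesgue.

Section reflection.
Context {R : realType} {n : nat}.
Notation V := 'rV[R]_n.+1.
Implicit Types (x y z : V) (A B : set V).

Definition refl x : V -> V := fun z => x - z.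

Lemma reflK x : involutive (refl x).
Proof. by move=> z; rewrite /refl subKr. Qed.

Lemma refl_preimageK x A : refl x @^-1` (refl x @^-1` A) = A.
Proof. by apply/seteqP; split => z /=; rewrite reflK. Qed.

Lemma cvg_prod_shift (m : 'I_n.+1 -> R) (l : seq 'I_n.+1) :
  (\prod_(i <- l) (m i + d)) @[d --> (0 : R)] --> \prod_(i <- l) m i.
Proof.
elim: l => [|i l IH].
  by rewrite big_nil; under eq_fun do rewrite big_nil; exact: cvg_cst.
rewrite big_cons; under eq_fun do rewrite big_cons; apply: cvgM => //.
by rewrite -[X in _ --> X]addr0; apply: cvgD; [exact: cvg_cst|exact: cvg_id].
Qed.

(** A reflected box is half-open on the wrong side. The reflected boxes are therefore
    slightly enlarged, the k-th one at a cost of at most e / 2^(k+1). *)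
Lemma leb_outer_refl_le x A : (leb_outer (refl x @^-1` A) <= leb_outer A)%E.
Proof.
apply: le_ereal_inf_tmp => _ [F AF <-]; apply/lee_addgt0Pr => e e0.
pose m (B : V * V) i := Num.max 0 (B.2 ord0 i - B.1 ord0 i).
have ek0 k : 0 < e / (2 ^ k.+1)%:R by rewrite divr_gt0// ltr0n expn_gt0.
have /choice[d dP] k : exists d : R, 0 < d /\
    \prod_(i < n.+1) (m (F k) i + d) <= box_vol (F k) + e / (2 ^ k.+1)%:R.
  have /cvgrPdist_lt/(_ _ (ek0 k)) := @cvg_prod_shift (m (F k)) (index_enum 'I_n.+1).
  move=> /nbhs_ballP[r /= r0 /(_ (r / 2))]; rewrite /ball/= sub0r normrN.
  rewrite gtr0_norm ?divr_gt0// ltr_pdivrMr// => /(_ _)/ltW H.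
  exists (r / 2); rewrite divr_gt0//; split => //.
  by have := H (ltac:(lra)); rewrite ler_distlC => /andP[_].
(* The left corner is moved by d k, since the reflected box is closed on the left. *)
pose G k : V * V := (x - (F k).2 - const_mx (d k), x - (F k).1).
apply: (@le_trans _ _ (\sum_(k <oo) (box_vol (G k))%:E)%E).
  apply: ereal_inf_lbound; exists G => // z /= /AF[k _ Fkz]; exists k => // i.
  have := Fkz i; rewrite /refl !mxE => /andP[h1 h2].
  by have [d0 _] := dP k; apply/andP; split; lra.
apply: le_trans (epsilon_trick xpredT (fun k => box_vol_ge0 (F k)) (ltW e0)).
apply: lee_nneseries => [k _ _|k _]; first exact: box_vol_ge0.
have [d0 dle] := dP k; rewrite -EFinD lee_fin (le_trans _ dle)//.
apply: ler_prod => i _; rewrite le_max lexx/= !mxE ge_max.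
have m0 : 0 <= m (F k) i by rewrite le_max lexx.
have mF : (F k).2 ord0 i - (F k).1 ord0 i <= m (F k) i by rewrite le_max lexx orbT.
by apply/andP; split; lra.
Qed.

Lemma leb_outer_refl x A : leb_outer (refl x @^-1` A) = leb_outer A.
Proof.
apply/eqP; rewrite eq_le leb_outer_refl_le/=.
by rewrite -{1}(refl_preimageK x A) leb_outer_refl_le.
Qed.

Lemma measurable_refl_preimage x A :
  leb_measurable A -> leb_measurable (refl x @^-1` A).
Proof.
move=> mA; suff : (@leb_om R n).-caratheodory (refl x @^-1` A) by [].
have {}mA : (@leb_om R n).-caratheodory A := mA.
have E B : leb_om B = leb_om (refl x @^-1` B) := esym (leb_outer_refl x B).
move=> X; have := mA (refl x @^-1` X).
rewrite (E (refl x @^-1` X)) (E (refl x @^-1` X `&` A)).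
rewrite (E (refl x @^-1` X `&` ~` A)).
by rewrite !preimage_setI preimage_setC !refl_preimageK.
Qed.

Local Notation T := (caratheodory_type (@leb_om R n)).

Lemma measurable_refl x : measurable_fun [set: T] (refl x : T -> T).
Proof. by move=> _ A mA; rewrite setTI; exact: measurable_refl_preimage. Qed.

(** A point reflection preserves the measure, so the integral is that of a push-forward. *)
Lemma integral_refl x (A : set T) (g : T -> \bar R) :
  leb_measurable A -> measurable_fun A g ->
  (\int[leb R n]_(z in refl x @^-1` A) g (refl x z) = \int[leb R n]_(w in A) g w)%E.
Proof.
move=> mA mg.
have E (f : T -> \bar R) : measurable_fun A f -> {in A, forall y, 0 <= f y}%E ->
    (\int[leb R n]_(z in refl x @^-1` A) f (refl x z) = \int[leb R n]_(w in A) f w)%E.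
  move=> mf f0; rewrite -(ge0_integral_pushforward (measurable_refl x))//.
  apply: eq_measure_integral => [|mx B _ _]; first exact: measurable_refl.
  exact: leb_outer_refl.
rewrite integralE [RHS]integralE; congr (_ - _)%E.
  have := E _ (measurable_funepos mg) (fun y _ => funepos_ge0 g y).
  by move=> <-; apply: eq_integral => y _; rewrite ?funeposE ?funenegE.
have := E _ (measurable_funeneg mg) (fun y _ => funeneg_ge0 g y).
by move=> <-; apply: eq_integral => y _; rewrite ?funeposE ?funenegE.
Qed.

Lemma continuous_leb_measurable_fun (U : set V) (f : V -> R) :
  open U -> {in U, continuous f} -> measurable_fun (U : set T) (f : T -> R).
Proof.
move=> oU cf; apply: (measurability (@RGenOInfty.G R)).
  exact: RGenOInfty.measurableE.
move=> _ [_ [a ->] <-]; apply: open_leb_measurable.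
rewrite openE => x [Ux /=]; rewrite in_itv/= andbT => ax.
apply: filterI; first exact: open_nbhs_nbhs.
have := cf x (mem_set Ux) => /cvgr_gt/(_ _ ax); apply: filterS => y /=.
by rewrite in_itv/= andbT.
Qed.

End reflection.

(** * Integration of bounded functions over sets of finite measure *)

(** Real-valued integral. It is linear and monotone only where the integrand is integrable;
    below it is applied to bounded functions on sets of finite measure. *)
HB.lock Definition lint {R : realType} {n : nat} (A : set 'rV[R]_n.+1)
  (g : 'rV[R]_n.+1 -> R) : R := Rintegral (leb R n) A g.

Section bounded_measurable.
Context {R : realType} {n : nat}.
Notation V := 'rV[R]_n.+1.
Notation T := (caratheodory_type (@leb_om R n)).
Notation mu := (leb R n).
Implicit Types (x y z : V) (A B : set V) (g : V -> R).

Definition finmeas A := leb_measurable A /\ (mu A < +oo)%E.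

(** The class of integrands used throughout: capped kernels are bounded, so multiplying
    by them stays in the class and integrability on sets of finite measure is automatic. *)
Definition bmfun A g := measurable_fun (A : set T) (g : T -> R) /\
  exists M : R, forall x, A x -> `|g x| <= M.

Definition vol A : R := fine (mu A).

Lemma vol_ge0 A : 0 <= vol A.
Proof. exact: fine_ge0. Qed.

Lemma finmeas_fin_num A : finmeas A -> mu A \is a fin_num.
Proof. by move=> [_ ?]; rewrite ge0_fin_numE. Qed.

Lemma sub_finmeas A B : leb_measurable A -> A `<=` B -> finmeas B -> finmeas A.
Proof.
move=> mA AB [mB fB]; split => //; apply: le_lt_trans fB.
by apply: le_measure => //; rewrite inE.
Qed.

Lemma finmeasI A B : finmeas A -> leb_measurable B -> finmeas (A `&` B).
Proof.
by move=> fA mB; apply: (sub_finmeas _ _ fA) => //; apply: measurableI => //; case: fA.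
Qed.

Lemma finmeasD A B : finmeas A -> leb_measurable B -> finmeas (A `\` B).
Proof.
by move=> fA mB; apply: (sub_finmeas _ _ fA) => //; apply: measurableD => //; case: fA.
Qed.

Lemma le_vol A B : leb_measurable A -> finmeas B -> A `<=` B -> vol A <= vol B.
Proof.
move=> mA fB AB; have fA := sub_finmeas mA AB fB.
rewrite fine_le ?finmeas_fin_num//; case: fB => mB _.
by apply: le_measure => //; rewrite inE.
Qed.

Lemma leb_measurable_eball x (r : R) : leb_measurable (eball x r).
Proof. exact/open_leb_measurable/open_eball. Qed.

Lemma finmeas_eball x (r : R) : finmeas (eball x r).
Proof.
split; first exact: leb_measurable_eball.
apply: (@le_lt_trans _ _ (mu (eball x `|r|))).
  apply: le_leb_outer => y; rewrite /eball/= => h.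
  by rewrite (lt_le_trans h)// ler_norm.
by apply: (le_lt_trans (leb_eball _ (normr_ge0 _))); rewrite ltry.
Qed.

Lemma vol_eball x (r : R) : 0 <= r -> vol (eball x r) <= (2 * r) ^+ n.+1.
Proof.
move=> r0; rewrite -lee_fin fineK; first exact: leb_eball.
exact/finmeas_fin_num/finmeas_eball.
Qed.

Lemma bmfun_integrable A g : finmeas A -> bmfun A g ->
  mu.-integrable A (EFin \o g).
Proof.
move=> [mA fA] [mg [M gM]]; apply: measurable_bounded_integrable => //.
exists M; split; first exact: num_real.
by move=> K MK x Ax; apply: (le_trans (gM x Ax)); exact: ltW.
Qed.

Lemma bmfunS A B g : leb_measurable B -> A `<=` B -> bmfun B g -> bmfun A g.
Proof.
move=> mB AB [mg [M gM]]; split; first exact: measurable_funS mg.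
by exists M => x /AB; exact: gM.
Qed.

Lemma bmfun_cst A (c : R) : bmfun A (fun=> c).
Proof. by split; [exact: measurable_cst|exists `|c|]. Qed.

Lemma bmfunD A f g : bmfun A f -> bmfun A g -> bmfun A (fun x => f x + g x).
Proof.
move=> [mf [M fM]] [mg [K gK]]; split; first exact: measurable_funD.
by exists (M + K) => x Ax; rewrite (le_trans (ler_normD _ _))// lerD ?fM ?gK.
Qed.

Lemma bmfunB A f g : bmfun A f -> bmfun A g -> bmfun A (fun x => f x - g x).
Proof.
move=> [mf [M fM]] [mg [K gK]]; split; first exact: measurable_funB.
by exists (M + K) => x Ax; rewrite (le_trans (ler_normB _ _))// lerD ?fM ?gK.
Qed.

Lemma bmfunM A f g : bmfun A f -> bmfun A g -> bmfun A (fun x => f x * g x).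
Proof.
move=> [mf [M fM]] [mg [K gK]]; split; first exact: measurable_funM.
by exists (M * K) => x Ax; rewrite normrM ler_pM ?fM ?gK.
Qed.

Lemma eq_lint A f g : (forall x, A x -> f x = g x) -> lint A f = lint A g.
Proof. by move=> fg; rewrite unlock; apply: eq_Rintegral => x; rewrite inE; exact: fg. Qed.

Lemma lintD A f g : finmeas A -> bmfun A f -> bmfun A g ->
  lint A (fun x => f x + g x) = lint A f + lint A g.
Proof.
by move=> fA bf bg; rewrite unlock; apply: RintegralD; [case: fA|exact: bmfun_integrable..].
Qed.

Lemma lintB A f g : finmeas A -> bmfun A f -> bmfun A g ->
  lint A (fun x => f x - g x) = lint A f - lint A g.
Proof.
by move=> fA bf bg; rewrite unlock; apply: RintegralB; [case: fA|exact: bmfun_integrable..].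
Qed.

Lemma lintZ A (c : R) g : finmeas A -> bmfun A g ->
  lint A (fun x => c * g x) = c * lint A g.
Proof.
by move=> fA bg; rewrite unlock; apply: RintegralZl; [case: fA|exact: bmfun_integrable].
Qed.

Lemma lint_cst A (c : R) : finmeas A -> lint A (fun=> c) = c * vol A.
Proof. by move=> [mA _]; rewrite unlock; exact: Rintegral_cst. Qed.

Lemma le_lint A f g : finmeas A -> bmfun A f -> bmfun A g ->
  (forall x, A x -> f x <= g x) -> lint A f <= lint A g.
Proof.
by move=> fA bf bg fg; rewrite unlock; apply: le_Rintegral => //; [case: fA|exact: bmfun_integrable..].
Qed.

Lemma lint_ge0 A g : (forall x, A x -> 0 <= g x) -> 0 <= lint A g.
Proof. by move=> g0; rewrite unlock; apply: Rintegral_ge0 => x; exact: g0. Qed.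

Lemma norm_lint_le A f g : finmeas A -> bmfun A f -> bmfun A g ->
  (forall x, A x -> `|f x| <= g x) -> `|lint A f| <= lint A g.
Proof.
move=> fA bf bg fg; rewrite ler_norml -[- lint A g]mulN1r -lintZ//.
have bNg : bmfun A (fun x => -1 * g x) by apply: bmfunM => //; exact: bmfun_cst.
apply/andP; split; apply: le_lint => // x /fg; rewrite ler_norml => /andP[//].
by rewrite mulN1r.
Qed.

Lemma norm_lint_le_cst A g (M : R) : finmeas A -> bmfun A g ->
  (forall x, A x -> `|g x| <= M) -> `|lint A g| <= M * vol A.
Proof.
move=> fA bg gM; rewrite -lint_cst//; apply: norm_lint_le => //.
exact: bmfun_cst.
Qed.

Lemma lint_split A B g : finmeas A -> leb_measurable B -> bmfun A g ->
  lint A g = lint (A `&` B) g + lint (A `\` B) g.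
Proof.
move=> fA mB bg; rewrite -{1}(setUIDK A B) unlock Rintegral_setU//.
- by case: (finmeasI fA mB).
- by case: (finmeasD fA mB).
- by rewrite setUIDK; exact: bmfun_integrable.
- by apply/disj_setPS => x [[_ ?] []].
Qed.

Lemma lint_support A B g : finmeas A -> leb_measurable B -> bmfun A g ->
  (forall x, A x -> ~ B x -> g x = 0) -> lint A g = lint (A `&` B) g.
Proof.
move=> fA mB bg g0; rewrite (lint_split fA mB bg).
rewrite [X in _ + X](@eq_lint _ _ (fun=> 0)); last by move=> x [? ?]; exact: g0.
by rewrite lint_cst ?mul0r ?addr0//; exact: finmeasD.
Qed.

Lemma subset_lint A B g : leb_measurable A -> finmeas B -> A `<=` B -> bmfun B g ->
  (forall x, B x -> 0 <= g x) -> lint A g <= lint B g.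
Proof.
move=> mA fB AB bg g0; rewrite (lint_split fB mA bg) (setIidr AB) lerDl.
by apply: lint_ge0 => x [? _]; exact: g0.
Qed.

(** How the continuity of the domains of integration enters the estimates. *)
Lemma lint_setY A B g (M : R) : finmeas A -> finmeas B ->
  bmfun (A `|` B) g -> (forall x, (A `|` B) x -> `|g x| <= M) ->
  `|lint A g - lint B g| <= M * vol (A `+` B).
Proof.
move=> fA fB bg gM; have [mA _] := fA; have [mB _] := fB.
have mAB : leb_measurable (A `|` B) by exact: measurableU.
have bA : bmfun A g by apply: bmfunS bg => //; exact: subsetUl.
have bB : bmfun B g by apply: bmfunS bg => //; exact: subsetUr.
have fAB : finmeas (A `\` B) := finmeasD fA mB.
have fBA : finmeas (B `\` A) := finmeasD fB mA.
rewrite (lint_split fA mB bA) (lint_split fB mA bB) setIC opprD addrACA subrr add0r.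
apply: (le_trans (ler_normB _ _)).
have -> : vol (A `+` B) = vol (A `\` B) + vol (B `\` A).
  rewrite /vol setY_def measureU ?fineD ?finmeas_fin_num//; try by case: fAB; case: fBA.
  by apply/seteqP; split => // x [[? ?] []].
rewrite mulrDr lerD// norm_lint_le_cst//.
- by apply: bmfunS bA => //; exact: subDsetl.
- by move=> x [? _]; apply: gM; left.
- by apply: bmfunS bB => //; exact: subDsetl.
- by move=> x [? _]; apply: gM; right.
Qed.

Lemma bmfun_refl x A g : leb_measurable A -> bmfun A g ->
  bmfun (refl x @^-1` A) (fun z => g (refl x z)).
Proof.
move=> mA [mg [M gM]]; split; last by exists M => z /gM.
apply: (measurable_comp mA) => //; first by move=> _ [z ? <-].
by apply: measurable_funTS; exact: measurable_refl.
Qed.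

Lemma lint_refl x A g : leb_measurable A -> bmfun A g ->
  lint (refl x @^-1` A) (fun z => g (refl x z)) = lint A g.
Proof.
move=> mA [mg _]; rewrite unlock; congr fine.
apply: (@integral_refl _ _ x A (EFin \o g)) => //.
exact/measurable_EFinP.
Qed.

End bounded_measurable.

(** * Powers and the capped kernel *)

Section powers.
Context {R : realType}.
Implicit Types t a b p : R.

(** Concavity of the power function; it is the inequality of Young for the exponents 1/a
    and 1/(1-a). *)
Lemma powR_le_tangent t a : 0 <= t -> 0 < a < 1 -> t `^ a <= 1 + a * (t - 1).
Proof.
move=> t0 /andP[a0 a1].
have b0 : 0 < 1 - a by rewrite subr_gt0.
have := @conjugate_powR R (t `^ a) 1 a^-1 (1 - a)^-1 (powR_ge0 _ _) ler01.
rewrite !invr_gt0 !invrK a0 b0 subrKC => /(_ isT isT erefl).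
by rewrite mulr1 -powRrM divff ?gt_eqF// powRr1// powR1 mul1r; lra.
Qed.

Lemma powRN_ge_tangent t p : 0 < t -> 0 < p -> 1 - p * (t - 1) <= t `^ (- p).
Proof.
move=> t0 p0; rewrite /powR gt_eqF//; apply: le_trans (expR_ge1Dx _).
have := @le_ln1Dx R (t - 1); rewrite subrKC => /(_ ltac:(lra)) h.
by rewrite mulNr lerD2l lerN2 ler_wpM2l// ltW.
Qed.

Lemma le_powRN a b p : 0 <= p -> 0 < a -> a <= b -> b `^ (- p) <= a `^ (- p).
Proof.
move=> p0 a0 ab; rewrite !powRN lef_pV2 ?posrE ?powR_gt0//; last exact: lt_le_trans ab.
by apply: ge0_ler_powR => //; rewrite nnegrE; lra.
Qed.

Lemma powRN_lipschitz a b r p : 0 < p -> 0 < r -> r <= a -> r <= b ->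
  `|a `^ (- p) - b `^ (- p)| <= p * r `^ (- p) / r * `|a - b|.
Proof.
move=> p0 r0; wlog ab : a b / a <= b => [H ra rb|ra rb].
  by have [/H->//|/ltW/H] := leP a b; rewrite distrC [X in _ <= _ * X]distrC; apply.
have a0 : 0 < a by exact: lt_le_trans ra.
have b0 : 0 < b by exact: lt_le_trans rb.
rewrite ger0_norm ?subr_ge0 ?le_powRN ?(ltW p0)// distrC ger0_norm ?subr_ge0//.
have h := @powRN_ge_tangent (b / a) p (divr_gt0 b0 a0) p0.
have e : b `^ (- p) = a `^ (- p) * (b / a) `^ (- p).
  by rewrite -powRM ?divr_ge0 ?ltW// mulrC divfK// gt_eqF.
have h1 : a `^ (- p) - b `^ (- p) <= a `^ (- p) * (p * (b / a - 1)).
  by rewrite e -[X in X - _]mulr1 -mulrBr ler_wpM2l ?powR_ge0//; lra.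
apply: (le_trans h1).
have -> : a `^ (- p) * (p * (b / a - 1)) = p * a `^ (- p) / a * (b - a).
  by field; rewrite gt_eqF.
rewrite ler_wpM2r ?subr_ge0// -!mulrA ler_wpM2l ?(ltW p0)//.
by rewrite ler_pM ?powR_ge0 ?invr_ge0 ?(ltW a0)// ?le_powRN ?(ltW p0)// lef_pV2.
Qed.

End powers.

Section kernel.
Context {R : realType} {n : nat}.
Notation V := 'rV[R]_n.+1.
Variable p : R.
Hypothesis p0 : 0 < p.
Implicit Types (x y z w : V) (A : set V) (r : R).

(** The kernel |z|^-p with the singularity cut off at distance r. It decreases with r, so
    that differences of two such kernels are nonnegative. *)
Definition ker r z : R := Num.max (enorm z) r `^ (- p).

Lemma ker_ge0 r z : 0 <= ker r z. Proof. exact: powR_ge0. Qed.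

Lemma ker_le r z : 0 < r -> ker r z <= r `^ (- p).
Proof. by move=> r0; rewrite le_powRN ?(ltW p0)// le_max lexx orbT. Qed.

Lemma ker_norm_le r z : 0 < r -> `|ker r z| <= r `^ (- p).
Proof. by move=> r0; rewrite ger0_norm ?ker_ge0// ker_le. Qed.

Lemma ker_anti r r' z : 0 < r -> r <= r' -> ker r' z <= ker r z.
Proof.
move=> r0 rr'; rewrite le_powRN ?(ltW p0)// ?lt_max ?r0 ?orbT//.
by rewrite ge_max !le_max lexx rr' orbT.
Qed.

Lemma ker_far r z : r <= enorm z -> ker r z = enorm z `^ (- p).
Proof. by move=> h; rewrite /ker max_l. Qed.

Lemma kerN r z : ker r (- z) = ker r z.
Proof. by rewrite /ker enormN. Qed.

Lemma ker_le_enorm r z : 0 < enorm z -> ker r z <= enorm z `^ (- p).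
Proof. by move=> z0; rewrite le_powRN ?(ltW p0)// le_max lexx. Qed.

Lemma ker_lipschitz r z w : 0 < r ->
  `|ker r z - ker r w| <= p * r `^ (- p) / r * enorm (z - w).
Proof.
move=> r0; apply: (le_trans (powRN_lipschitz p0 r0 _ _)).
- by rewrite le_max lexx orbT.
- by rewrite le_max lexx orbT.
rewrite ler_wpM2l ?divr_ge0 ?mulr_ge0 ?powR_ge0 ?(ltW p0) ?(ltW r0)//.
apply: le_trans (enorm_dist_dist z w).
rewrite /Num.max; case: ltP => h1; case: ltP => h2.
- by rewrite subrr normr0.
- rewrite distrC [leRHS]distrC !ger0_norm; lra.
- rewrite !ger0_norm; lra.
- by [].
Qed.

Lemma continuous_ker r x : 0 < r -> continuous (fun w => ker r (x - w)).
Proof.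
move=> r0 w; apply/continuousP_enorm => e e0.
pose L := p * r `^ (- p) / r.
have L0 : 0 < L by rewrite divr_gt0// mulr_gt0// powR_gt0.
exists (e / L); first by rewrite divr_gt0.
move=> y yw; apply: (le_lt_trans (ker_lipschitz _ _ r0)); rewrite -/L.
have -> : x - y - (x - w) = w - y by rewrite opprB addrCA addrAC subrr add0r.
by rewrite enormB mulrC -ltr_pdivlMr.
Qed.

Lemma continuous_bmfun A g (M : R) : leb_measurable A -> continuous g ->
  (forall x, A x -> `|g x| <= M) -> bmfun A g.
Proof.
move=> mA cg gM; split; last by exists M.
apply: (@measurable_funS _ _ _ _ setT) => //.
by apply: continuous_leb_measurable_fun => //; exact: openT.
Qed.

Lemma bmfun_ker r x A : 0 < r -> leb_measurable A ->
  bmfun A (fun w => ker r (x - w)).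
Proof.
move=> r0 mA; apply: (@continuous_bmfun _ _ (r `^ (- p))) => //.
  exact: continuous_ker.
by move=> w _; exact: ker_norm_le.
Qed.

End kernel.

(** * Moments of the capped kernel *)

Section moments.
Context {R : realType} {n : nat}.
Notation V := 'rV[R]_n.+1.
Variable s : R.
Hypothesis hs : 0 < s < 1.
Implicit Types (x y z w : V) (A : set V) (r rho : R).

Let s0 : 0 < s. Proof. by case/andP: hs. Qed.
Let s1 : s < 1. Proof. by case/andP: hs. Qed.

(** The exponent N + 2 s, with N = n.+1. *)
Definition kexp : R := n.+1%:R + 2 * s.

Lemma kexp_gt0 : 0 < kexp.
Proof. by rewrite /kexp addr_gt0 ?ltr0n// mulr_gt0. Qed.

Local Notation k := (ker kexp).

Lemma powR_exp_kexp r (a : R) : 0 < r -> r `^ (a - kexp) * r ^+ n.+1 = r `^ (a - 2 * s).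
Proof.
move=> r0; rewrite -powR_mulrn ?ltW// -powRD; last by rewrite (gt_eqF r0) implybT.
by congr powR; rewrite /kexp; ring.
Qed.

Lemma bmfun_enorm_pow_ker rho x r (a : R) A : 0 < rho -> 0 <= a -> leb_measurable A ->
  A `<=` eball x r -> bmfun A (fun w => enorm (x - w) `^ a * k rho (x - w)).
Proof.
move=> rho0 a0 mA Ar; apply: bmfunM; last exact: bmfun_ker kexp_gt0 _ _ _ _ _.
split; last first.
  exists (r `^ a) => w Aw; rewrite ger0_norm ?powR_ge0//.
  have h : enorm (x - w) < r by rewrite enormB; exact: Ar Aw.
  by apply: ge0_ler_powR => //; rewrite ?nnegrE ?enorm_ge0 ?ltW// (le_lt_trans _ h)// enorm_ge0.
apply: (@measurable_funS _ _ _ _ setT _ _ measurableT (@subsetT _ _)).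
apply: (measurableT_comp (measurable_powR a)).
apply: continuous_leb_measurable_fun; first exact: openT.
by move=> w _; exact: continuous_enormB.
Qed.

(** On a dyadic shell the integrand is comparable to a constant, and the volume of the
    shell is at most that of the circumscribed cube. *)
Lemma shell_moment rho x r (a : R) : 0 < rho -> 0 < r -> 0 <= a ->
  lint (eball x (2 * r) `\` eball x r) (fun w => enorm (x - w) `^ a * k rho (x - w))
    <= 4 ^+ n.+1 * 2 `^ a * r `^ (a - 2 * s).
Proof.
move=> rho0 r0 a0; set A := eball _ _ `\` _.
have fA : finmeas A by apply: finmeasD; [exact: finmeas_eball|exact: leb_measurable_eball].
have r20 : 0 <= 2 * r by rewrite mulr_ge0// ltW.
apply: (@le_trans _ _ (2 `^ a * r `^ (a - kexp) * vol A)).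
  apply: (le_trans (ler_norm _)); apply: (norm_lint_le_cst fA).
    by apply: (bmfun_enorm_pow_ker rho0 a0 _ (@subDsetl _ _ _)); case: fA.
  move=> w [h1 /negP]; rewrite -leNgt => h2; rewrite ger0_norm ?mulr_ge0 ?powR_ge0//.
  rewrite /eball/= enormB in h1; rewrite enormB in h2.
  rewrite powRD ?(gt_eqF r0) ?implybT// mulrA -powRM//; last exact: ltW.
  apply: ler_pM; rewrite ?powR_ge0//.
    by apply: ge0_ler_powR => //; rewrite ?nnegrE ?enorm_ge0// ltW.
  apply: (le_trans (ker_le_enorm kexp_gt0 _ _)); first exact: lt_le_trans h2.
  by rewrite le_powRN ?(ltW kexp_gt0).
have vA : vol A <= 4 ^+ n.+1 * r ^+ n.+1.
  rewrite -exprMn; apply: (@le_trans _ _ (vol (eball x (2 * r)))).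
    by apply: le_vol; [case: fA|exact: finmeas_eball|exact: subDsetl].
  by apply: (le_trans (vol_eball _ r20)); rewrite mulrA -natrM.
rewrite -powR_exp_kexp//; apply: (le_trans (ler_wpM2l _ vA)).
  by rewrite mulr_ge0 ?powR_ge0.
by rewrite le_eqVlt; apply/orP; left; apply/eqP; ring.
Qed.

(** The dyadic shells r / 2^m contribute a geometric series of ratio 2^-(2-2s). The ball that
    remains after m steps contributes little since the kernel is capped at rho; that bound
    depends on rho, but it vanishes as m grows, so that C can be independent of rho. *)
Lemma near_moment : exists2 C : R, 0 < C & forall rho x r, 0 < rho -> 0 < r ->
  lint (eball x r) (fun w => enorm (x - w) `^ 2 * k rho (x - w)) <= C * r `^ (2 - 2 * s).
Proof.
pose q := 2 - 2 * s; have q0 : 0 < q by rewrite /q; have := s1; lra.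
pose c : R := 4 ^+ n.+1 * 2 `^ 2; have c0 : 0 < c by rewrite mulr_gt0 ?exprn_gt0 ?powR_gt0.
have d0 : 0 < 2 `^ q - 1 :> R.
  by rewrite subr_gt0 -[X in X < _](powRr0 2) /powR pnatr_eq0/= ltr_expR ltr_pM2r// ln_gt0// ltr1n.
pose C := c / (2 `^ q - 1); have C0 : 0 < C by rewrite divr_gt0.
exists C => // rho x r rho0 r0; set g := fun w => _.
pose I (t : R) := lint (eball x t) g.
have bg t : bmfun (eball x t) g.
  by apply: (@bmfun_enorm_pow_ker _ _ t) => //; exact: leb_measurable_eball.
have half (t : R) : 0 < t -> I (2 * t) <= I t + c * t `^ q.
  move=> t0; rewrite /I (lint_split (finmeas_eball x _) (leb_measurable_eball x t) (bg _)).
  rewrite setIidr; last by move=> w; rewrite /eball/= => h; rewrite (lt_trans h)// ltr_pMl// ltr1n.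
  by rewrite lerD2l; exact: shell_moment.
pose t m := r / 2 ^+ m.
have t0 m : 0 < t m by rewrite divr_gt0// exprn_gt0.
have tS m : t m = 2 * t m.+1.
  by rewrite /t exprS; field; rewrite expf_eq0 pnatr_eq0 andbF.
have iter m : I r <= I (t m) + C * (r `^ q - t m `^ q).
  elim: m => [|m IH]; first by rewrite /t expr0 divr1 subrr mulr0 addr0.
  apply: (le_trans IH); rewrite {1}tS; apply: (le_trans (lerD (half _ (t0 _)) (lexx _))).
  rewrite -addrA lerD2l (tS m) powRM ?(ltW (t0 _))//.
  have -> : c = C * (2 `^ q - 1) by rewrite /C divfK// gt_eqF.
  by rewrite le_eqVlt; apply/orP; left; apply/eqP; ring.
(* The crude bound on the innermost ball; dividing its radius by 2^m divides this by 2^m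
   at least. *)
pose K := (r `^ 2 * rho `^ (- kexp)) * (2 * r) ^+ n.
have small m : I (t m) <= K * (2 * r) / 2 ^+ m.
  have tr : t m <= r.
    by rewrite ler_pdivrMr ?exprn_gt0// ler_pMr// exprn_ege1// ler1n.
  apply: (@le_trans _ _ (r `^ 2 * rho `^ (- kexp) * vol (eball x (t m)))).
    apply: (le_trans (ler_norm _)); apply: (norm_lint_le_cst (finmeas_eball _ _) (bg _)).
    move=> w; rewrite /eball/= enormB => h; rewrite ger0_norm ?mulr_ge0 ?powR_ge0//.
    apply: ler_pM; rewrite ?powR_ge0//; last exact: ker_le kexp_gt0 _ _ _.
    by apply: ge0_ler_powR => //; rewrite ?nnegrE ?enorm_ge0 ?(ltW r0)// (le_trans (ltW h)).
  rewrite /K -!mulrA ler_wpM2l ?powR_ge0// ler_wpM2l ?powR_ge0//.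
  apply: (le_trans (vol_eball _ (ltW (t0 m)))); rewrite exprSr.
  have -> : 2 * (r / 2 ^+ m) = 2 * t m by [].
  have t20 : 0 <= 2 * t m by exact: mulr_ge0 (ltW (t0 m)).
  have r20 : 0 <= 2 * r by exact: mulr_ge0 (ltW r0).
  by apply: (ler_wpM2r t20); apply: lerXn2r; rewrite ?nnegrE// ler_wpM2l.
apply/ler_addgt0Pl => e e0.
have K0 : 0 <= K * (2 * r) by rewrite !mulr_ge0 ?powR_ge0 ?exprn_ge0 ?mulr_ge0 ?ltW.
have [m Km] : exists m : nat, K * (2 * r) / 2 ^+ m <= e.
  exists (Num.truncn (e^-1 * (K * (2 * r)))).+1.
  rewrite ler_pdivrMr ?exprn_gt0// -ler_pdivrMl//.
  apply/ltW/(lt_trans (truncnS_gt _)); rewrite -[X in _ < X](natrX R 2) ltr_nat.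
  exact: ltn_expl.
apply: (le_trans (iter m)); apply: lerD; first exact: le_trans (small m) Km.
by rewrite ler_wpM2l ?(ltW C0)// gerBl powR_ge0.
Qed.

(** The exponent s is below 2 s, so that the dyadic shells going outwards contribute a
    geometric series, of ratio 2^-s; the bound does not depend on the size of A. *)
Lemma far_moment : exists2 C : R, 0 < C & forall rho x r A D, 0 < rho -> 0 < r ->
  leb_measurable A -> A `<=` eball x D ->
  lint (A `\` eball x r) (fun w => enorm (x - w) `^ s * k rho (x - w)) <= C * r `^ (- s).
Proof.
pose c : R := 4 ^+ n.+1 * 2 `^ s; have c0 : 0 < c by rewrite mulr_gt0 ?exprn_gt0 ?powR_gt0.
have d0 : 0 < 1 - 2 `^ (- s) :> R.
  rewrite subr_gt0 -[X in _ < X](powRr0 2) /powR pnatr_eq0/= ltr_expR ltr_pM2r ?oppr_lt0//.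
  by rewrite ln_gt0// ltr1n.
pose C := c / (1 - 2 `^ (- s)); have C0 : 0 < C by rewrite divr_gt0.
exists C => // rho x r A D rho0 r0 mA AD; set g := fun w => _.
pose I m := lint (eball x (2 ^+ m * r) `\` eball x r) g.
have bg t : bmfun (eball x t) g.
  by apply: (@bmfun_enorm_pow_ker _ _ t) => //; [exact: ltW|exact: leb_measurable_eball].
have mD t : leb_measurable (eball x t `\` eball x r).
  by apply: measurableD; exact: leb_measurable_eball.
have fD t : finmeas (eball x t `\` eball x r).
  by apply: finmeasD; [exact: finmeas_eball|exact: leb_measurable_eball].
have bD t : bmfun (eball x t `\` eball x r) g.
  by apply: bmfunS (bg t); [exact: leb_measurable_eball|exact: subDsetl].
have iter m : I m <= C * (r `^ (- s) - (2 ^+ m * r) `^ (- s)).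
  elim: m => [|m IH].
    by rewrite /I expr0 mul1r setDv subrr mulr0 unlock Rintegral_set0.
  have tm0 : 0 < 2 ^+ m * r by rewrite mulr_gt0// exprn_gt0.
  rewrite /I (lint_split (fD _) (leb_measurable_eball x (2 ^+ m * r)) (bD _)).
  have le2 : 2 ^+ m * r <= 2 ^+ m.+1 * r.
    by rewrite ler_wpM2r ?(ltW r0)// ler_eXn2l// ltr1n.
  have -> : (eball x (2 ^+ m.+1 * r) `\` eball x r) `&` eball x (2 ^+ m * r) =
      eball x (2 ^+ m * r) `\` eball x r.
    apply/seteqP; split => [w [[_ ?] ?]//|w [h ?]]; split => //; split => //.
    by move: h; rewrite /eball/= => h; rewrite (lt_le_trans h).
  have -> : (eball x (2 ^+ m.+1 * r) `\` eball x r) `\` eball x (2 ^+ m * r) =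
      eball x (2 * (2 ^+ m * r)) `\` eball x (2 ^+ m * r).
    rewrite mulrA -exprS; apply/seteqP; split => [w [[? _] ?]//|w [? h]]; split => //; split => //.
    move=> h'; apply: h; rewrite /eball/= (lt_le_trans h')//.
    by rewrite ler_peMl ?(ltW r0)// exprn_ege1// ler1n.
  have sh := @shell_moment rho x (2 ^+ m * r) s rho0 tm0 (ltW s0).
  apply: (le_trans (lerD IH sh)); rewrite -/c (_ : s - 2 * s = - s); last by ring.
  rewrite exprS -mulrA [(2 * _) `^ _]powRM ?(ltW tm0)//.
  have -> : c = C * (1 - 2 `^ (- s)) by rewrite /C divfK// gt_eqF.
  by rewrite le_eqVlt; apply/orP; left; apply/eqP; ring.
have [m Dm] : exists m : nat, D <= 2 ^+ m * r.
  exists (Num.truncn (D / r)).+1; rewrite -ler_pdivrMr//.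
  apply/ltW/(lt_trans (truncnS_gt _)); rewrite -[X in _ < X](natrX R 2) ltr_nat.
  exact: ltn_expl.
apply: (@le_trans _ _ (I m)); last first.
  by apply: (le_trans (iter m)); rewrite ler_wpM2l ?(ltW C0)// gerBl powR_ge0.
apply: subset_lint => //.
- by apply: measurableD => //; exact: leb_measurable_eball.
- by move=> w [/AD + ?]; rewrite /eball/= => h; split => //; rewrite /eball/= (lt_le_trans h).
- by move=> w _; rewrite mulr_ge0// powR_ge0.
Qed.

End moments.

(** * The distance to the boundary *)

Section distance.
Context {R : realType} {n : nat}.
Notation V := 'rV[R]_n.+1.
Variable Omega : set V.
Implicit Types (x y z w : V) (A : set V) (r : R).
Local Notation d := (dist_bdry Omega).

Lemma dist_has_inf x : bdry Omega !=set0 ->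
  has_inf [set enorm (x - y) | y in bdry Omega].
Proof.
move=> [p bp]; split; first by exists (enorm (x - p)); exists p.
by exists 0 => _ [y _ <-]; exact: enorm_ge0.
Qed.

Lemma dist_ge0 x : 0 <= d x.
Proof.
rewrite /dist_bdry; have [b0|/set0P b0] := eqVneq (bdry Omega) set0.
  by rewrite b0 image_set0 inf0.
apply: lb_le_inf; first by case: (dist_has_inf x b0).
by move=> _ [y _ <-]; exact: enorm_ge0.
Qed.

Lemma dist_le x p : bdry Omega p -> d x <= enorm (x - p).
Proof.
move=> bp; apply: ge_inf; last by exists p.
by exists 0 => _ [y _ <-]; exact: enorm_ge0.
Qed.

Lemma dist_bdry0 x : bdry Omega x -> d x = 0.
Proof.
move=> /dist_le => /(_ x); rewrite subrr enorm0 => dx.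
by apply/eqP; rewrite eq_le dx dist_ge0.
Qed.

Lemma dist_lipschitz x y : bdry Omega !=set0 -> d x <= d y + enorm (x - y).
Proof.
move=> b0; rewrite -lerBlDr; apply: lb_le_inf; first by case: (dist_has_inf y b0).
move=> _ [p bp <-]; rewrite lerBlDr; apply: (le_trans (dist_le x bp)).
by rewrite [leRHS]addrC; exact: enorm_distD.
Qed.

Lemma dist_gt0_bdry_nonempty x : 0 < d x -> bdry Omega !=set0.
Proof.
move=> d0; apply/set0P; apply: contraTneq d0 => b0.
by rewrite /dist_bdry b0 image_set0 inf0 ltxx.
Qed.

Lemma continuous_dist : bdry Omega !=set0 -> continuous d.
Proof.
move=> b0 x; apply/continuousP_enorm => e e0; exists e => // y yx.
have h1 := dist_lipschitz x y b0; have h2 := dist_lipschitz y x b0.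
by rewrite ltr_distl; rewrite enormB in h1; apply/andP; split; lra.
Qed.

Hypothesis Omega_open : open Omega.
Hypothesis Omega_bounded : bounded_set Omega.

Lemma closureE_bdry x : closure Omega x <-> Omega x \/ bdry Omega x.
Proof.
rewrite /bdry (interior_id _).1//; split=> [cx|[|[]//]]; last exact: subset_closure.
by have [?|?] := pselect (Omega x); [left|right].
Qed.

Lemma not_bdry x : Omega x -> ~ bdry Omega x.
Proof. by move=> Ox []; rewrite (interior_id _).1. Qed.

Lemma closure_bounded : bounded_set (closure Omega).
Proof.
have [M [Mr HM]] := Omega_bounded; exists M; split => // K MK x cx.
have : closure [set y : V | `|y| <= K] x.
  by apply: closure_subset cx => y Oy; exact: HM.
have -> : closure [set y : V | `|y| <= K] = [set y : V | `|y| <= K]; last by [].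
apply/esym/closure_id; apply: (@preimage_closed _ _ (fun y : V => `|y|) [set r | r <= K]).
  by move=> y _; exact: norm_continuous.
exact: closed_le.
Qed.

Lemma compact_closure : compact (closure Omega).
Proof. by apply: bounded_closed_compact; [exact: closure_bounded|exact: closed_closure]. Qed.

Lemma compact_bdry : compact (bdry Omega).
Proof.
apply: (subclosed_compact _ compact_closure); last by move=> x [].
rewrite /bdry setDE; apply: closedI; first exact: closed_closure.
by apply: open_closedC; exact: open_interior.
Qed.

Lemma dist_nearest x : bdry Omega !=set0 -> exists2 p, bdry Omega p & d x = enorm (x - p).
Proof.
move=> b0.
have [p bp pmin] : exists2 c, c \in bdry Omega &
    forall t, t \in bdry Omega -> enorm (x - c) <= enorm (x - t).
  apply: EVT_min_rV => //; first exact: compact_bdry.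
  exact/continuous_subspaceT/continuous_enormB.
rewrite inE in bp; exists p => //; apply/eqP; rewrite eq_le dist_le//=.
apply: lb_le_inf; first by case: (dist_has_inf x b0).
by move=> _ [y by_ <-]; apply: pmin; rewrite inE.
Qed.

(** Closed in the compact closure: the points that could be lost are on the boundary,
    where the distance vanishes. *)
Lemma compact_inner (r : R) : 0 < r -> bdry Omega !=set0 ->
  compact [set x | Omega x /\ r <= d x].
Proof.
move=> r0 b0.
have -> : [set x | Omega x /\ r <= d x] = closure Omega `&` [set x | r <= d x].
  apply/seteqP; split => x [Ox rx]; split => //; first exact: subset_closure.
  move/closureE_bdry : Ox => [//|/dist_bdry0 dx0].
  by move: rx; rewrite /= dx0 leNgt r0.
apply: compact_closedI; first exact: compact_closure.
apply: (@preimage_closed _ _ d [set t | r <= t]); last exact: closed_ge.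
by move=> y _; exact: continuous_dist.
Qed.

Lemma Omega_finmeas : finmeas Omega.
Proof.
have [D D0 HD] := bounded_setP_enorm Omega_bounded.
apply: (@sub_finmeas _ _ Omega (eball 0 (D + 1))); last exact: finmeas_eball.
  exact: open_leb_measurable.
by move=> x Ox; rewrite /eball/= subr0 (le_lt_trans (HD x Ox))// ltrDl.
Qed.

Lemma diameter_bound : exists2 D : R, 0 < D &
  (forall x y, Omega x -> Omega y -> enorm (x - y) < D) /\
  (bdry Omega !=set0 -> forall x, Omega x -> d x <= D).
Proof.
have [D D0 HD] := bounded_setP_enorm (closure_bounded).
exists (2 * D + 1); first by rewrite addr_gt0// mulr_gt0.
have H x y : closure Omega x -> closure Omega y -> enorm (x - y) < 2 * D + 1.
  move=> cx cy; apply: (le_lt_trans (enormD _ _)); rewrite enormN.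
  by have := HD _ cx; have := HD _ cy; lra.
split; first by move=> x y Ox Oy; apply: H; exact: subset_closure.
move=> [p bp] x Ox; apply: (le_trans (dist_le x bp)); apply/ltW/H.
  exact: subset_closure.
by case: bp.
Qed.

End distance.

(** * The capped operators *)

(** The data of the problem, in the form in which the estimates use them: the lower bound of
    h is a product of powers, and continuity is continuity at the points of the open set. *)
Record setting {R : realType} {n : nat} (s : R) (Omega Sigma : set 'rV[R]_n.+1)
    (Om : 'rV[R]_n.+1 -> set 'rV[R]_n.+1) (h f : 'rV[R]_n.+1 -> R)
    (alpha zeta etaf Cf : R) : Prop := Setting {
  st_s : 0 < s < 1;
  st_open : open Omega;
  st_bounded : bounded_set Omega;
  st_sub : forall x, Omega x -> Om x `<=` Omega;
  st_meas : forall x, Omega x -> leb_measurable (Om x);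
  st_Sopen : open Sigma;
  st_h : {in Omega, continuous h};
  st_alpha : 0 < alpha;
  st_dist : forall x, Omega x -> 0 < dist_bdry Omega x;
  st_hlb : forall x, Omega x -> alpha * dist_bdry Omega x `^ (- (2 * s)) <= h x;
  st_Om : forall x, Omega x ->
    leb R n (Om y `+` Om x) @[y --> within Omega (nbhs x)] --> 0%E;
  st_zeta : 0 < zeta;
  st_local : forall x, Omega x -> forall r : R, r <= zeta * dist_bdry Omega x ->
    [set z | Om x (x - z)] `&` eball 0 r = Sigma `&` eball 0 r;
  st_sym : forall z, Sigma z -> Sigma (- z);
  st_f : {in Omega, continuous f};
  st_etaf : 0 < etaf;
  st_Cf : 0 < Cf;
  st_growth : forall x, Omega x ->
    `|f x| * dist_bdry Omega x `^ (2 * s - etaf) <= Cf }.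

Section operator.
Context {R : realType} {n : nat}.
Notation V := 'rV[R]_n.+1.
Variables (s : R) (Omega Sigma : set V) (Om : V -> set V) (h f : V -> R).
Variables (alpha zeta etaf Cf : R).
Hypothesis H : setting s Omega Sigma Om h f alpha zeta etaf Cf.
Implicit Types (x y z w : V) (A : set V) (r rho c : R) (u v g j : V -> R).

Local Notation d := (dist_bdry Omega).
Local Notation k := (ker (@kexp R n s)).

Let p0 : 0 < @kexp R n s. Proof. exact: kexp_gt0 (st_s H). Qed.

(** With the kernel capped at distance rho the principal value becomes an ordinary integral. *)
Definition nonlocal rho u x : R :=
  lint (Om x) (fun w => (u x - u w) * k rho (x - w)).

Lemma finmeas_Om x : Omega x -> finmeas (Om x).
Proof.
move=> Ox; apply: sub_finmeas (Omega_finmeas (st_open H) (st_bounded H)).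
- exact: st_meas H _ Ox.
- exact: st_sub H _ Ox.
Qed.

Lemma bmfun_Om x u : Omega x -> bmfun Omega u -> bmfun (Om x) u.
Proof.
by move=> Ox; apply: bmfunS; [exact: open_leb_measurable (st_open H)|exact: st_sub H _ Ox].
Qed.

Lemma bmfun_Om_ker x y u rho : 0 < rho -> Omega x -> bmfun Omega u ->
  bmfun (Om x) (fun w => u w * k rho (y - w)).
Proof.
move=> rho0 Ox bu; apply: bmfunM; first exact: bmfun_Om.
exact: bmfun_ker p0 _ _ _ rho0 (st_meas H Ox).
Qed.

Lemma bmfun_diff A u (c : R) : bmfun A u -> bmfun A (fun w => c - u w).
Proof. by move=> bu; apply: bmfunB => //; exact: bmfun_cst. Qed.

Lemma local_refl x r : Omega x -> r <= zeta * d x ->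
  refl x @^-1` (Om x `&` eball x r) = Sigma `&` eball 0 r.
Proof.
move=> Ox rx; rewrite -(st_local H Ox rx); apply/seteqP.
by split => z [Oz]; rewrite /refl ?eball_sub ?eball0E => zr; split; rewrite ?eball_sub ?eball0E.
Qed.

Lemma lint_near x r g : Omega x -> r <= zeta * d x -> bmfun (Om x `&` eball x r) g ->
  lint (Om x `&` eball x r) g = lint (Sigma `&` eball 0 r) (fun z => g (x - z)).
Proof.
move=> Ox rx bg; rewrite -(lint_refl x _ bg) ?local_refl//.
by apply: measurableI; [exact: st_meas H _ Ox|exact: leb_measurable_eball].
Qed.

Lemma bmfun_near x r g : Omega x -> r <= zeta * d x -> bmfun (Om x `&` eball x r) g ->
  bmfun (Sigma `&` eball 0 r) (fun z => g (x - z)).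
Proof.
move=> Ox rx bg; rewrite -(local_refl Ox rx); apply: bmfun_refl bg.
by apply: measurableI; [exact: st_meas H _ Ox|exact: leb_measurable_eball].
Qed.

Lemma finmeas_Sigma r : finmeas (Sigma `&` eball 0 r).
Proof.
rewrite setIC; apply: finmeasI; first exact: finmeas_eball.
exact: open_leb_measurable (st_Sopen H).
Qed.

Lemma refl0_Sigma r : refl 0 @^-1` (Sigma `&` eball 0 r) = Sigma `&` eball 0 r.
Proof.
have S1 z : (Sigma `&` eball 0 r) z -> (Sigma `&` eball 0 r) (refl 0 z).
  move=> [Sz]; rewrite /refl sub0r !eball0E => zr; split; first exact: st_sym H _ Sz.
  by rewrite eball0E enormN.
apply/seteqP; split => z; last exact: S1.
by move=> /S1; rewrite reflK.
Qed.

Lemma lint_Sigma_sym r g : bmfun (Sigma `&` eball 0 r) g ->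
  lint (Sigma `&` eball 0 r) g = lint (Sigma `&` eball 0 r) (fun z => g (- z)).
Proof.
move=> bg; rewrite -(lint_refl 0 _ bg); last by case: (finmeas_Sigma r).
by rewrite refl0_Sigma; apply: eq_lint => z _; rewrite /refl sub0r.
Qed.

Lemma bmfun_Sigma_sym r g : bmfun (Sigma `&` eball 0 r) g ->
  bmfun (Sigma `&` eball 0 r) (fun z => g (- z)).
Proof.
move=> bg; have := @bmfun_refl _ _ 0 _ g _ bg; rewrite refl0_Sigma.
rewrite (_ : (fun z => g (refl 0 z)) = fun z => g (- z)); last first.
  by apply/funext => z; rewrite /refl sub0r.
by apply; case: (finmeas_Sigma r).
Qed.

Variable C0 : R.
Hypothesis C0_moment : forall rho x r, 0 < rho -> 0 < r ->
  lint (eball x r) (fun w => enorm (x - w) `^ 2 * k rho (x - w)) <= C0 * r `^ (2 - 2 * s).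

(** Seen from x, the near part of the domain is the symmetric set Sigma, so the integrand
    can be averaged with its reflection: first-order terms cancel, and what is left is a
    second difference, of size 2 c |z|^2, against the kernel. The even weight j stands for
    a capped kernel, a difference of two of them, or a truncated one. *)
Lemma near_lower_bound rho x r c u j : Omega x -> 0 < rho -> 0 < r -> r <= zeta * d x ->
  bmfun (Om x `&` eball x r) u -> 0 <= c ->
  (forall z, Om x (x - z) -> Om x (x + z) -> enorm z < r ->
     - (2 * c * enorm z ^+ 2) <= (u x - u (x - z)) + (u x - u (x + z))) ->
  bmfun (Om x `&` eball x r) (fun w => j (x - w)) ->
  (forall z, j (- z) = j z) -> (forall z, 0 <= j z <= k rho z) ->
  - (c * C0 * r `^ (2 - 2 * s)) <=
    lint (Om x `&` eball x r) (fun w => (u x - u w) * j (x - w)).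
Proof.
move=> Ox rho0 r0 rx bu c0 hu bj jN jk.
set B := Om x `&` eball x r; set S := Sigma `&` eball 0 r.
have SP z : S z -> Om x (x - z) /\ enorm z < r.
  by rewrite /S -(st_local H Ox rx) => -[? +]; rewrite eball0E.
have SN z : S z -> S (- z).
  by move=> Sz; rewrite /S -refl0_Sigma/= /refl sub0r opprK.
have fS : finmeas S := finmeas_Sigma r.
pose G z := (u x - u (x - z)) * j z.
have bGB : bmfun B (fun w => (u x - u w) * j (x - w)).
  exact: bmfunM (bmfun_diff _ bu) bj.
have bG : bmfun S G.
  have := bmfun_near Ox rx bGB; rewrite -/S.
  rewrite (_ : (fun z => _) = G)//; apply/funext => z.
  by rewrite /G opprB addrCA subrr addr0.
rewrite (lint_near Ox rx bGB) -/S (@eq_lint _ _ _ _ G); last first.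
  by move=> z _; rewrite /G opprB addrCA subrr addr0.
have bN := bmfun_Sigma_sym bG.
have -> : lint S G = 2^-1 * lint S (fun z => G z + G (- z)).
  by rewrite lintD// -lint_Sigma_sym//; field.
pose m z := enorm (0 - z) `^ 2 * k rho (0 - z).
have bm0 : bmfun (eball 0 r) m.
  by apply: (bmfun_enorm_pow_ker (st_s H) rho0 _ _ (@subset_refl _ _)) => //; exact: leb_measurable_eball.
have mS : leb_measurable S by case: fS.
have bm : bmfun S m by apply: bmfunS bm0; [exact: leb_measurable_eball|exact: subIsetr].
have le1 : lint S (fun z => - (2 * c) * m z) <= lint S (fun z => G z + G (- z)).
  apply: (le_lint fS (bmfunM (bmfun_cst _ _) bm) (bmfunD bG bN)) => z Sz.
  have [Oz zr] := SP z Sz; have [Oz' _] := SP _ (SN z Sz).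
  rewrite opprK in Oz'; rewrite /G opprK jN -mulrDl.
  have /andP[j0 jle] := jk z.
  apply: (le_trans _ (ler_wpM2r j0 (hu z Oz Oz' zr))).
  rewrite /m sub0r enormN kerN powR_mulrn ?enorm_ge0// !mulNr mulrA lerN2 ler_wpM2l//.
  by rewrite mulr_ge0 ?sqr_ge0// mulr_ge0.
have le2 : lint S m <= C0 * r `^ (2 - 2 * s).
  apply: le_trans (C0_moment 0 rho0 r0); apply: subset_lint => //.
  - exact: finmeas_eball.
  - exact: subIsetr.
  - by move=> z _; rewrite mulr_ge0// powR_ge0.
rewrite lintZ// in le1.
apply: (@le_trans _ _ (2^-1 * (- (2 * c) * lint S m))); last by rewrite ler_wpM2l.
rewrite [leRHS](_ : _ = - (c * lint S m)); last by field.
by rewrite lerN2 -mulrA ler_wpM2l.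
Qed.

Lemma nonlocal_diff rho r x u : Omega x -> 0 < rho -> rho <= r -> bmfun Omega u ->
  nonlocal rho u x - nonlocal r u x =
  lint (Om x `&` eball x r) (fun w => (u x - u w) * (k rho (x - w) - k r (x - w))).
Proof.
move=> Ox rho0 rr bu; have fO := finmeas_Om Ox; have r0 := lt_le_trans rho0 rr.
have bd := bmfun_diff (u x) bu.
have b1 := bmfun_Om_ker x rho0 Ox bd; have b2 := bmfun_Om_ker x r0 Ox bd.
rewrite /nonlocal -lintB//.
under [LHS]eq_lint => w _ do rewrite -mulrBr.
apply: (lint_support fO (leb_measurable_eball _ _)).
  rewrite (_ : (fun x0 => _) = fun w => (u x - u w) * k rho (x - w) - (u x - u w) * k r (x - w)).
    exact: bmfunB b1 b2.
  by apply/funext => w; rewrite mulrBr.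
move=> w _ /negP; rewrite -leNgt enormB => rw.
by rewrite !ker_far ?subrr ?mulr0//; exact: le_trans rw.
Qed.

(** The two operators differ only in the ball of radius r, by the integral of a second
    difference. The error depends on r but not on rho: an equation that holds at the tiny
    scale rho gives information at the fixed scale r. *)
Lemma nonlocal_scale rho r x c u : Omega x -> 0 < rho -> rho <= r -> r <= zeta * d x ->
  bmfun Omega u -> 0 <= c ->
  (forall z, Omega (x - z) -> Omega (x + z) -> enorm z < r ->
     - (2 * c * enorm z ^+ 2) <= (u x - u (x - z)) + (u x - u (x + z))) ->
  nonlocal r u x <= nonlocal rho u x + c * C0 * r `^ (2 - 2 * s).
Proof.
move=> Ox rho0 rr rx bu c0 hu; have r0 := lt_le_trans rho0 rr.
have mO := st_meas H Ox.
rewrite -lerBlDl -opprB lerNl; rewrite nonlocal_diff//.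
have bj := bmfunB (bmfun_ker p0 x rho0 mO) (bmfun_ker p0 x r0 mO).
apply: (@near_lower_bound rho x r c u (fun z => k rho z - k r z) Ox rho0 r0 rx
  (bmfunS mO (@subIsetl _ _ _) (bmfun_Om Ox bu)) c0 _ (bmfunS mO (@subIsetl _ _ _) bj)).
- by move=> z /(st_sub H Ox) ? /(st_sub H Ox) ?; exact: hu.
- by move=> z; rewrite !kerN.
- by move=> z; rewrite subr_ge0 ker_anti// gerBl ker_ge0.
Qed.

(** After translation both near parts are integrals over the same piece of Sigma, so that
    a pointwise inequality between the increments is enough. *)
Lemma nonlocal_near_compare r r' x y u v : Omega x -> Omega y -> 0 < r -> r <= r' ->
  r' <= zeta * d x -> r' <= zeta * d y -> bmfun Omega u -> bmfun Omega v ->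
  (forall z, Omega (x - z) -> Omega (y - z) -> v y - v (y - z) <= u x - u (x - z)) ->
  nonlocal r v y - nonlocal r' v y <= nonlocal r u x - nonlocal r' u x.
Proof.
move=> Ox Oy r0 rr' rx ry bu bv uv; have r'0 := lt_le_trans r0 rr'.
have bB g z : Omega z -> bmfun Omega g -> bmfun (Om z `&` eball z r')
    (fun w => (g z - g w) * (k r (z - w) - k r' (z - w))).
  move=> Oz bg; apply: bmfunS (st_meas H Oz) (@subIsetl _ _ _) _; apply: bmfunM.
    exact: bmfun_diff (bmfun_Om Oz bg).
  exact: bmfunB (bmfun_ker p0 z r0 (st_meas H Oz)) (bmfun_ker p0 z r'0 (st_meas H Oz)).
have bx := bB _ _ Ox bu; have by_ := bB _ _ Oy bv.
rewrite (nonlocal_diff Ox r0 rr' bu) (nonlocal_diff Oy r0 rr' bv).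
rewrite (lint_near Ox rx bx) (lint_near Oy ry by_).
apply: (le_lint (finmeas_Sigma r') (bmfun_near Oy ry by_) (bmfun_near Ox rx bx)) => z Sz.
have E w : w - (w - z) = z by rewrite opprB addrCA subrr addr0.
rewrite !E; apply: ler_wpM2r; first by rewrite subr_ge0 ker_anti.
have Sx : (Sigma `&` eball 0 r') z := Sz.
rewrite -(st_local H Ox rx) in Sx; case: Sx => Ozx _.
rewrite -(st_local H Oy ry) in Sz; case: Sz => Ozy _.
by apply: uv; [exact: st_sub H _ Ox _ Ozx|exact: st_sub H _ Oy _ Ozy].
Qed.

(** The far part of the operator depends continuously on the point: the capped kernel is
    Lipschitz and the domain moves little in measure. *)
Lemma lint_ker_stability r x y g (M : R) : 0 < r -> Omega x -> Omega y ->
  bmfun Omega g -> (forall w, Omega w -> `|g w| <= M) ->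
  `|lint (Om x) (fun w => g w * k r (x - w)) - lint (Om y) (fun w => g w * k r (y - w))|
  <= M * (vol Omega * (@kexp R n s * r `^ (- @kexp R n s) / r) * enorm (x - y) +
          r `^ (- @kexp R n s) * vol (Om x `+` Om y)).
Proof.
move=> r0 Ox Oy bg gM; have M0 : 0 <= M := le_trans (normr_ge0 _) (gM x Ox).
have fx := finmeas_Om Ox; have fy := finmeas_Om Oy.
have fO := Omega_finmeas (st_open H) (st_bounded H); have [mO _] := fO.
have bxy := bmfun_Om_ker y r0 Ox bg; have bxx := bmfun_Om_ker x r0 Ox bg.
have bO : bmfun Omega (fun w => g w * k r (y - w)) := bmfunM bg (bmfun_ker p0 y r0 mO).
rewrite -[X in `|X|](subrKA (lint (Om x) (fun w => g w * k r (y - w)))).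
apply: (le_trans (ler_normD _ _)); rewrite mulrDr; apply: lerD.
  rewrite -lintB//; set L := @kexp R n s * _ / _.
  have L0 : 0 <= L by rewrite divr_ge0 ?mulr_ge0 ?powR_ge0 ?(ltW p0) ?(ltW r0).
  apply: (@le_trans _ _ (M * (L * enorm (x - y)) * vol (Om x))).
    apply: (norm_lint_le_cst fx (bmfunB bxx bxy)) => w Ow.
    rewrite -mulrBr normrM ler_pM ?gM//; first exact: st_sub H _ Ox _ Ow.
    apply: (le_trans (ker_lipschitz p0 _ _ r0)).
    have -> : x - w - (y - w) = x - y by rewrite opprB addrA subrK.
    by [].
  rewrite -mulrA ler_wpM2l// -[vol Omega * _ * _]mulrA [leRHS]mulrC.
  apply: (ler_wpM2l (mulr_ge0 L0 (enorm_ge0 _))).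
  exact: le_vol (st_meas H Ox) fO (st_sub H Ox).
rewrite mulrA; apply: (lint_setY fx fy).
  by apply: bmfunS mO _ bO => w [] Ow; [exact: st_sub H _ Ox _ Ow|exact: st_sub H _ Oy _ Ow].
move=> w OO; rewrite normrM ler_pM ?ker_norm_le//.
by apply: gM; case: OO => Ow; [exact: st_sub H _ Ox _ Ow|exact: st_sub H _ Oy _ Ow].
Qed.

End operator.

(** * Paraboloids as test functions, and the comparison principle *)

Section uniform.
Context {R : realType} {n : nat}.
Notation V := 'rV[R]_n.+1.
Implicit Types (x y z w : V) (A B C K : set V) (r e t : R).

(** Stated for a pseudo-distance E, so as to apply to several quantities at once: the
    oscillations of h, of f and of the domains of integration will be added up. *)
Lemma compact_uniform K (E : V -> V -> R) : compact K ->
  (forall e x, 0 < e -> K x ->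
     exists2 r : R, 0 < r & forall y, K y -> enorm (y - x) < r -> E x y < e) ->
  (forall x y z, K x -> K y -> K z -> E y z <= E x y + E x z) ->
  forall e, 0 < e ->
    exists2 t : R, 0 < t & forall x y, K x -> K y -> enorm (x - y) < t -> E x y < e.
Proof.
move=> cK Ec Et e e0.
pose P t x := K x -> forall y, K y -> enorm (x - y) < t -> E x y < e.
have : \forall t \near (0 : R)^'+, K `<=` P t.
  move/compact_near_coveringP : cK; apply => x Kx.
  have [r r0 xr] := Ec (e / 2) x (divr_gt0 e0 (ltr0n _ 2)) Kx.
  exists (eball x (r / 2), [set t | t < r / 2]) => /=.
    split; last by apply: nbhs_right_lt; rewrite divr_gt0.
    by apply/nbhs_eball; exists (r / 2); rewrite ?divr_gt0.
  move=> [y t] /= [yx tr] Ky z Kz yz.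
  have h1 : E x y < e / 2 by apply: xr => //; rewrite /eball/= in yx; lra.
  have h2 : E x z < e / 2.
    apply: xr => //; apply: (le_lt_trans (enorm_distD y _ _)).
    by rewrite enormB; rewrite /eball/= in yx; lra.
  by have := Et x y z Kx Ky Kz; lra.
move=> KP; have [t [t0 Pt]] : exists t : R, 0 < t /\ K `<=` P t.
  apply: (@filter_ex _ ((0 : R)^'+)); near=> t; split; last by near: t.
  by near: t; exact: nbhs_right_gt.
by exists t => // x y Kx; exact: Pt.
Unshelve. all: by end_near. Qed.

Lemma vol_setY_triangle A B C : finmeas A -> finmeas B -> finmeas C ->
  vol (A `+` C) <= vol (B `+` A) + vol (B `+` C).
Proof.
move=> fA fB fC; have mY (X Y : set V) : finmeas X -> finmeas Y -> finmeas (X `+` Y).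
  move=> [mX fX] [mY fY]; split.
    by apply: measurableU; exact: measurableD.
  apply: (@le_lt_trans _ _ (leb R n X + leb R n Y)%E); last exact: lte_add_pinfty.
  apply: (@le_trans _ _ (leb R n (X `|` Y))).
    by apply: le_leb_outer => x [[? _]|[? _]]; [left|right].
  exact: measureU2.
have fBA := mY _ _ fB fA; have fBC := mY _ _ fB fC; have fAC := mY _ _ fA fC.
rewrite -lee_fin EFinD /vol !fineK ?finmeas_fin_num//.
apply: (@le_trans _ _ (leb R n ((B `+` A) `|` (B `+` C)))).
  apply: le_leb_outer => x [[Ax Cx]|[Cx Ax]]; have [Bx|Bx] := pselect (B x).
  - by right; left.
  - by left; right.
  - by left; left.
  - by right; right.
by apply: measureU2; [case: fBA|case: fBC].
Qed.

End uniform.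

Section comparison.
Context {R : realType} {n : nat}.
Notation V := 'rV[R]_n.+1.
Variables (s : R) (Omega Sigma : set V) (Om : V -> set V) (h f : V -> R).
Variables (alpha zeta etaf Cf : R).
Hypothesis H : setting s Omega Sigma Om h f alpha zeta etaf Cf.
Implicit Types (x y z w : V) (A : set V) (r rho c : R) (u v g j : V -> R).

Local Notation d := (dist_bdry Omega).
Local Notation k := (ker (@kexp R n s)).
Local Notation L := (nonlocal s Om).

Variable C0 : R.
Hypothesis C0_gt0 : 0 < C0.

Let p0 : 0 < @kexp R n s. Proof. exact: kexp_gt0 (st_s H). Qed.

(** A notion of subsolution, at scale r, shared by solutions of the capped equations and by
    viscosity subsolutions. The test function is a paraboloid centred at y0, and it only
    serves to bound the second differences of u at x: the operator acts on u. *)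
Definition quadratic_sub g r u := forall x y0 c, Omega x -> 0 <= c -> r <= zeta * d x ->
  (forall w, Omega w -> u w <= u x + c * (enorm (w - y0) ^+ 2 - enorm (x - y0) ^+ 2)) ->
  h x * u x + L r u x <= g x + c * C0 * r `^ (2 - 2 * s).

Lemma nonlocalN r u x : 0 < r -> Omega x -> bmfun Omega u ->
  L r (fun w => - u w) x = - L r u x.
Proof.
move=> r0 Ox bu; transitivity (-1 * L r u x); last by rewrite mulN1r.
rewrite /nonlocal -lintZ.
- by apply: eq_lint => w _; ring.
- exact: finmeas_Om H _ Ox.
- exact: bmfun_Om_ker H _ _ _ _ r0 Ox (bmfun_diff _ bu).
Qed.

Lemma Om_cvg e x : 0 < e -> Omega x -> exists2 r : R, 0 < r &
  forall y, Omega y -> enorm (y - x) < r -> vol (Om x `+` Om y) < e.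
Proof.
move=> e0 Ox; have := st_Om H Ox.
move=> /fine_cvgP[_ /cvgrPdist_lt/(_ _ e0)].
rewrite near_withinE => /nbhs_eball[r r0 xr]; exists r => // y Oy yx.
have /= := xr y yx Oy; rewrite sub0r normrN setYC.
by rewrite (ger0_norm (vol_ge0 _)).
Qed.

Lemma data_uniform del e : 0 < del -> 0 < e -> exists2 t : R, 0 < t &
  forall x y, Omega x -> del <= d x -> Omega y -> del <= d y -> enorm (x - y) < t ->
    [/\ `|h x - h y| < e, `|f x - f y| < e & vol (Om x `+` Om y) < e].
Proof.
move=> del0 e0; have [[x0 Ox0]|noO] := pselect (exists x, Omega x); last first.
  by exists 1 => // x y Ox; case: noO; exists x.
have b0 := dist_gt0_bdry_nonempty (st_dist H Ox0).
pose E x y := `|h x - h y| + `|f x - f y| + vol (Om x `+` Om y).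
have [] := @compact_uniform _ _ _ E
    (compact_inner (st_open H) (st_bounded H) del0 b0) _ _ e e0; last first.
- move=> t t0 tE; exists t => // x y Ox dx Oy dy xy.
  have := tE x y (conj Ox dx) (conj Oy dy) xy.
  rewrite /E; have := vol_ge0 (Om x `+` Om y); have := normr_ge0 (h x - h y).
  by have := normr_ge0 (f x - f y); move=> *; split; lra.
- move=> x y z [Ox _] [Oy _] [Oz _]; rewrite /E.
  have h1 := vol_setY_triangle (finmeas_Om H Oy) (finmeas_Om H Ox) (finmeas_Om H Oz).
  have h2 : `|h y - h z| <= `|h x - h y| + `|h x - h z|.
    by rewrite (distrC (h x) (h y)) (le_trans _ (ler_normD _ _))// subrKA.
  have h3 : `|f y - f z| <= `|f x - f y| + `|f x - f z|.
    by rewrite (distrC (f x) (f y)) (le_trans _ (ler_normD _ _))// subrKA.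
  lra.
- move=> e' x e'0 [Ox dx]; have e3 : 0 < e' / 3 by rewrite divr_gt0.
  have [r1 r10 H1] := (continuousP_enorm h x).1 (st_h H (mem_set Ox)) _ e3.
  have [r2 r20 H2] := (continuousP_enorm f x).1 (st_f H (mem_set Ox)) _ e3.
  have [r3 r30 H3] := Om_cvg e3 Ox.
  exists (Num.min r1 (Num.min r2 r3)); first by rewrite !lt_min r10 r20.
  move=> y [Oy dy]; rewrite !lt_min => /and3P[h1 h2 h3].
  have := H1 y h1; have := H2 y h2; have := H3 y Oy h3.
  by rewrite /E (distrC (h x)) (distrC (f x)); lra.
Qed.

Lemma h_lower_bound : exists2 h0 : R, 0 < h0 & forall x, Omega x -> h0 <= h x.
Proof.
have [D D0 [_ HD]] := diameter_bound (st_bounded H).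
exists (alpha * D `^ (- (2 * s))); first by rewrite mulr_gt0 ?powR_gt0 ?(st_alpha H).
move=> x Ox; apply: le_trans (st_hlb H Ox); rewrite ler_wpM2l ?(ltW (st_alpha H))//.
apply: le_powRN; [|exact: st_dist H _ Ox|].
  by have /andP[? _] := st_s H; rewrite mulr_ge0 ?ltW.
by apply: HD => //; exact: dist_gt0_bdry_nonempty (st_dist H Ox).
Qed.

Lemma small_power a e : 0 < a -> 0 < e -> exists2 r : R, 0 < r & forall r', 0 < r' -> r' <= r ->
  r' `^ a <= e.
Proof.
move=> a0 e0; exists (e `^ a^-1); first exact: powR_gt0.
move=> r' r'0 r'r; rewrite -[leRHS](powRr1 (ltW e0)) -(mulVf (lt0r_neq0 a0)) powRrM.
by apply: (ge0_ler_powR (ltW a0)); rewrite ?nnegrE ?powR_ge0 ?(ltW r'0).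
Qed.

(** The penalty excludes pairs with a point near the boundary: either both points are near
    it, and both values are small, or the points are at least del apart and the
    penalty exceeds 2 M. *)
Lemma doubling_max (M del kap c : R) u v x1 : 0 < kap -> 0 <= c -> 2 * M < c * del ^+ 2 ->
  0 < del -> {in Omega, continuous u} -> {in Omega, continuous v} ->
  (forall x, Omega x -> `|u x| <= M) -> (forall x, Omega x -> `|v x| <= M) ->
  (forall x, Omega x -> d x < 2 * del -> `|u x| <= kap / 4 /\ `|v x| <= kap / 4) ->
  Omega x1 -> kap < u x1 - v x1 ->
  exists x y, [/\ Omega x /\ del <= d x, Omega y /\ del <= d y,
    kap <= u x - v y, enorm (x - y) < del /\ c * enorm (x - y) ^+ 2 <= 2 * M &
    forall w w', Omega w -> Omega w' ->
      u w - v w' - c * enorm (w - w') ^+ 2 <= u x - v y - c * enorm (x - y) ^+ 2].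
Proof.
move=> kap0 c0 cdel del0 cu cv uM vM uvk Ox1 k1.
have b0 := dist_gt0_bdry_nonempty (st_dist H Ox1).
pose K : set V := [set x | Omega x /\ del <= d x].
have cK : compact K := compact_inner (st_open H) (st_bounded H) del0 b0.
have Kx1 : K x1.
  split=> //; rewrite leNgt; apply/negP => dx.
  have /uvk[//|] : Omega x1 by [].
    by rewrite (lt_trans dx)// ltr_pMl// ltr1n.
  by rewrite !ler_norml => /andP[? ?] /andP[? ?]; lra.
pose Phi (z : V * V) := u z.1 - v z.2 - c * enorm (z.1 - z.2) ^+ 2.
have [] := @compact_EVT_max _ _ Phi (K `*` K).
- by exists (x1, x1).
- exact: compact_setX.
- apply: continuous_in_subspaceT => -[a b]; rewrite inE => -[[/= Oa _] [/= Ob _]].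
  apply: cvgB; first apply: cvgB.
  + apply: (@continuous_comp _ _ _ fst u); first exact: cvg_fst.
    by apply: cu; rewrite inE.
  + apply: (@continuous_comp _ _ _ snd v); first exact: cvg_snd.
    by apply: cv; rewrite inE.
  + apply: cvgM; first exact: cvg_cst.
    apply: (@continuous_comp _ _ _ (fun z : V * V => enorm (z.1 - z.2)) (fun t : R => t ^+ 2)).
      apply: (@continuous_comp _ _ _ (fun z : V * V => z.1 - z.2) (@enorm R n)).
        by apply: cvgB; [exact: cvg_fst|exact: cvg_snd].
      exact: continuous_enorm.
    exact: exprn_continuous.
move=> [x y]; rewrite inE => -[/= [Ox dx] [Oy dy]] PhiK.
have k2 : kap < Phi (x, y).
  have := PhiK (x1, x1); rewrite inE => /(_ (conj Kx1 Kx1)); apply: lt_le_trans.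
  by rewrite /Phi/= subrr enorm0 expr0n mulr0 subr0.
have ux := uM _ Ox; have vy := vM _ Oy; rewrite !ler_norml in ux vy.
have cxy : c * enorm (x - y) ^+ 2 <= 2 * M.
  by move: k2; rewrite /Phi/=; move: ux vy => /andP[? ?] /andP[? ?]; lra.
have far w w' : Omega w -> Omega w' -> ~ (K w /\ K w') -> Phi (w, w') <= kap.
  move=> Ow Ow' nK; rewrite /Phi/=.
  have sq0 : 0 <= c * enorm (w - w') ^+ 2 by rewrite mulr_ge0// sqr_ge0.
  have lip1 := dist_lipschitz w w' b0; have lip2 := dist_lipschitz w' w b0.
  have [dw|dw] := ltP (d w) (2 * del); have [dw'|dw'] := ltP (d w') (2 * del).
  - have [+ _] := uvk _ Ow dw; have [_ +] := uvk _ Ow' dw'.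
    by rewrite !ler_norml => /andP[? ?] /andP[? ?]; lra.
  - have dle : del <= enorm (w - w').
      rewrite leNgt; apply/negP => ww; apply: nK; split; split => //; last by lra.
      by rewrite enormB in ww; lra.
    have h1 : c * del ^+ 2 <= c * enorm (w - w') ^+ 2.
      by rewrite ler_wpM2l// lerXn2r// ?nnegrE ?enorm_ge0// ltW.
    have := uM _ Ow; have := vM _ Ow'; rewrite !ler_norml => /andP[? ?] /andP[? ?]; lra.
  - have dle : del <= enorm (w - w').
      by rewrite leNgt; apply/negP => ww; apply: nK; split; split => //; lra.
    have h1 : c * del ^+ 2 <= c * enorm (w - w') ^+ 2.
      by rewrite ler_wpM2l// lerXn2r// ?nnegrE ?enorm_ge0// ltW.
    have := uM _ Ow; have := vM _ Ow'; rewrite !ler_norml => /andP[? ?] /andP[? ?]; lra.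
  - by case: nK; split; split => //; lra.
exists x, y; split => //.
- have : 0 <= c * enorm (x - y) ^+ 2 by rewrite mulr_ge0// sqr_ge0.
  by move: k2; rewrite /Phi/= => *; lra.
- split => //; have := le_lt_trans cxy cdel.
  have c1 : 0 < c.
    rewrite lt_neqAle c0 andbT; apply: contraTneq cdel => <-; rewrite mul0r -leNgt.
    by rewrite mulr_ge0// (le_trans (normr_ge0 _) (uM _ Ox)).
  by rewrite ltr_pM2l// ltr_pXn2r// ?nnegrE ?enorm_ge0// ltW.
- move=> w w' Ow Ow'; rewrite -/(Phi (w, w')) -/(Phi (x, y)).
  have [[Kw Kw']|/far] := pselect (K w /\ K w'); first by apply: PhiK; rewrite inE.
  by move=> /(_ Ow Ow') h1; apply: (le_trans h1); exact: ltW.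
Qed.

(** Doubling of variables. At a maximum point (x, y) of u(x) - v(y) - c |x-y|^2 the function
    u is touched at x by a paraboloid centred at y, and v at y by one centred at x. The
    two inequalities subtract; near parts compare pointwise, far parts up to the
    oscillation e of the data, and h (u - v) >= h0 kap gives a contradiction. *)
Lemma comparison (M del kap : R) : 0 < M -> 0 < del -> 0 < kap ->
  exists2 r : R, 0 < r & forall u v,
  {in Omega, continuous u} -> {in Omega, continuous v} ->
  (forall x, Omega x -> `|u x| <= M) -> (forall x, Omega x -> `|v x| <= M) ->
  (forall x, Omega x -> d x < 2 * del -> `|u x| <= kap / 4 /\ `|v x| <= kap / 4) ->
  quadratic_sub f r u -> quadratic_sub (fun x => - f x) r (fun x => - v x) ->
  forall x, Omega x -> u x - v x <= kap.
Proof.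
move=> M0 del0 kap0; have [h0 h00 hh] := h_lower_bound.
have z0 := st_zeta H; have /andP[s0 s1] := st_s H.
pose r1 := zeta * del; have r10 : 0 < r1 by rewrite mulr_gt0.
pose lip := vol Omega * (@kexp R n s * r1 `^ (- @kexp R n s) / r1).
pose top := r1 `^ (- @kexp R n s).
have lip0 : 0 <= lip.
  exact: mulr_ge0 (vol_ge0 _) (divr_ge0 (mulr_ge0 (ltW p0) (powR_ge0 _ _)) (ltW r10)).
have top0 : 0 <= top by exact: powR_ge0.
(* S e bounds the sum of all errors caused by the oscillation e of the data. *)
pose S := M + 1 + 2 * M * (lip + top); have S0 : 0 < S.
  by rewrite /S ltr_pwDl ?mulr_ge0 ?addr_ge0 ?(ltW M0)// addr_gt0.
pose e := h0 * kap / (4 * S); have e0 : 0 < e by rewrite divr_gt0 ?mulr_gt0.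
have eS : e * S = h0 * kap / 4 by rewrite /e; field; rewrite gt_eqF.
have [t t0 tunif] := data_uniform del0 e0.
pose t' := Num.min del (Num.min t e).
have t'0 : 0 < t' by rewrite !lt_min del0 t0.
(* With this opening the maximum point satisfies |x - y| < t'; it is chosen before the
   scale r, which can then make c C0 r^(2-2s) small. *)
pose c := (2 * M + 1) / t' ^+ 2.
have c0 : 0 < c by rewrite divr_gt0 ?exprn_gt0// addr_gt0 ?mulr_gt0.
have ct' : c * t' ^+ 2 = 2 * M + 1 by rewrite /c divfK// expf_eq0/= gt_eqF.
have q0 : 0 < 2 - 2 * s by lra.
have K0 : 0 < 8 * c * C0 by exact: mulr_gt0 (mulr_gt0 _ c0) C0_gt0.
have [r2 r20 r2P] := small_power q0 (divr_gt0 (mulr_gt0 h00 kap0) K0).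
pose r := Num.min r1 r2; have r0 : 0 < r by rewrite lt_min r10.
have rr1 : r <= r1 by rewrite ge_min lexx.
have rs : 2 * (c * C0 * r `^ (2 - 2 * s)) <= h0 * kap / 4.
  have := r2P r r0; rewrite ge_min lexx orbT => /(_ isT).
  rewrite (ler_pdivlMr _ _ K0).
  have -> : r `^ (2 - 2 * s) * (8 * c * C0) = 4 * (2 * (c * C0 * r `^ (2 - 2 * s))) by ring.
  by rewrite -ler_pdivlMl// [X in _ <= X]mulrC.
exists r => // u v cu cv uM vM uvk Hu Hv x1 Ox1; rewrite leNgt; apply/negP => k1.
have cdel : 2 * M < c * del ^+ 2.
  have : c * t' ^+ 2 <= c * del ^+ 2.
    by rewrite ler_wpM2l ?(ltW c0)// lerXn2r ?nnegrE ?(ltW t'0) ?(ltW del0)// ge_min lexx.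
  by lra.
have [x [y [[Ox dx] [Oy dy] kxy [_ cxy] Pmax]]] :=
  doubling_max kap0 (ltW c0) cdel del0 cu cv uM vM uvk Ox1 k1.
have xyt : enorm (x - y) < t'.
  have : c * enorm (x - y) ^+ 2 < c * t' ^+ 2 by lra.
  by rewrite ltr_pM2l// ltr_pXn2r// ?nnegrE ?enorm_ge0// ltW.
have [xyt1 xye] : enorm (x - y) < t /\ enorm (x - y) < e.
  by move: xyt; rewrite !lt_min => /and3P[_ ? ?].
have [hxy fxy Oxy] := tunif x y Ox dx Oy dy xyt1.
have r1x : r1 <= zeta * d x by rewrite ler_wpM2l ?(ltW z0).
have r1y : r1 <= zeta * d y by rewrite ler_wpM2l ?(ltW z0).
have bu : bmfun Omega u.
  split; last by exists M.
  exact: continuous_leb_measurable_fun (st_open H) cu.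
have bv : bmfun Omega v.
  split; last by exists M.
  exact: continuous_leb_measurable_fun (st_open H) cv.
have subx : h x * u x + L r u x <= f x + c * C0 * r `^ (2 - 2 * s).
  apply: (Hu x y c Ox (ltW c0) (le_trans rr1 r1x)) => w Ow.
  by have := Pmax w y Ow Oy; lra.
have suby : h y * - v y - L r v y <= - f y + c * C0 * r `^ (2 - 2 * s).
  rewrite -nonlocalN//; apply: (Hv y x c Oy (ltW c0) (le_trans rr1 r1y)) => w Ow.
  by have := Pmax x w Ox Ow; rewrite (enormB x w) (enormB x y); lra.
have near : L r v y - L r1 v y <= L r u x - L r1 u x.
  apply: (nonlocal_near_compare H Ox Oy r0 rr1 r1x r1y bu bv) => z Oxz Oyz.
  have := Pmax _ _ Oxz Oyz.
  have -> : x - z - (y - z) = x - y by rewrite opprB addrA subrK.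
  by clear => *; lra.
pose g w := v y - v w.
have bg : bmfun Omega g by exact: bmfun_diff.
have far1 : lint (Om x) (fun w => g w * k r1 (x - w)) <= L r1 u x.
  apply: (le_lint (finmeas_Om H Ox) (bmfun_Om_ker H x r10 Ox bg)
    (bmfun_Om_ker H x r10 Ox (bmfun_diff (u x) bu))) => w Ow.
  apply: ler_wpM2r; first exact: ker_ge0.
  have := Pmax w w (st_sub H Ox Ow) (st_sub H Ox Ow).
  rewrite subrr enorm0 expr0n mulr0 subr0 /g.
  have : 0 <= c * enorm (x - y) ^+ 2 by rewrite mulr_ge0 ?(ltW c0)// sqr_ge0.
  by clear => *; lra.
have gM w : Omega w -> `|g w| <= 2 * M.
  move=> Ow; apply: (le_trans (ler_normB _ _)); apply: (le_trans (lerD (vM _ Oy) (vM _ Ow))).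
  by rewrite mulr_natl mulr2n.
have := lint_ker_stability H r10 Ox Oy bg gM; rewrite -/lip -/top ler_norml => /andP[far2 _].
have far3 : 2 * M * (lip * enorm (x - y) + top * vol (Om x `+` Om y)) <= 2 * M * (lip + top) * e.
  have M20 : 0 <= 2 * M by exact: mulr_ge0 (ltW M0).
  rewrite -[leRHS]mulrA; apply: (ler_wpM2l M20); rewrite mulrDl.
  by apply: lerD; rewrite ler_wpM2l// ltW.
have hx : h0 * kap <= h x * (u x - v y).
  by apply: ler_pM; rewrite ?(ltW h00) ?(ltW kap0)// hh.
have hv : - (e * M) <= (h x - h y) * v y.
  have : `|(h x - h y) * v y| <= e * M by rewrite normrM ler_pM ?vM// ltW.
  by rewrite ler_norml => /andP[].
have fxy' : f x - f y <= e by rewrite (le_trans (ler_norm _))// ltW.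
have eS' : e * M + e + 2 * M * (lip + top) * e = h0 * kap / 4 by rewrite -eS /S; ring.
have hk : 0 < h0 * kap by rewrite mulr_gt0.
have Ly : L r1 v y = lint (Om y) (fun w => g w * k r1 (y - w)) by [].
have hE : h x * u x + h y * - v y = h x * (u x - v y) + (h x - h y) * v y by ring.
rewrite -Ly in far2; move: subx suby near far1 far2 far3 hx hv fxy' eS' hk rs hE.
move: (h x * u x) (h y * - v y) (h x * (u x - v y)) ((h x - h y) * v y).
move: (L r u x) (L r v y) (L r1 u x) (L r1 v y) (f x) (f y) (lint _ _).
move: (c * C0 * _) (2 * M * (lip * _ + _)) (2 * M * (lip + top) * e) (e * M) (h0 * kap).
by clear => *; lra.
Qed.

End comparison.

(** * A barrier built on a power of the distance *)

Section barrier.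
Context {R : realType} {n : nat}.
Notation V := 'rV[R]_n.+1.
Variables (s : R) (Omega Sigma : set V) (Om : V -> set V) (h f : V -> R).
Variables (alpha zeta etaf Cf : R).
Hypothesis H : setting s Omega Sigma Om h f alpha zeta etaf Cf.
Implicit Types (x y z w : V) (A : set V) (r rho c : R) (u v g j : V -> R).

Local Notation d := (dist_bdry Omega).
Local Notation k := (ker (@kexp R n s)).
Local Notation L := (nonlocal s Om).

Let p0 : 0 < @kexp R n s. Proof. exact: kexp_gt0 (st_s H). Qed.

Lemma bmfun_dist_pow (a : R) : 0 <= a -> bmfun Omega (fun x => d x `^ a).
Proof.
move=> a0; have [[x0 Ox0]|noO] := pselect (exists x, Omega x); last first.
  have -> : Omega = set0 by apply/seteqP; split => // x Ox; case: noO; exists x.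
  by split; [exact: measurable_fun_set0|exists 0].
have b0 := dist_gt0_bdry_nonempty (st_dist H Ox0).
have [D D0 [_ HD]] := diameter_bound (st_bounded H).
split; last first.
  exists (D `^ a) => x Ox; rewrite ger0_norm ?powR_ge0//.
  by apply: (ge0_ler_powR a0); rewrite ?nnegrE ?dist_ge0 ?(ltW D0)//; exact: HD.
apply: (measurableT_comp (measurable_powR a)).
apply: continuous_leb_measurable_fun; first exact: st_open H.
by move=> x _; exact: continuous_dist.
Qed.

Lemma nonlocalZ (c : R) r u x : 0 < r -> Omega x -> bmfun Omega u ->
  L r (fun w => c * u w) x = c * L r u x.
Proof.
move=> r0 Ox bu; rewrite /nonlocal -lintZ.
- by apply: eq_lint => w _; ring.
- exact: finmeas_Om H _ Ox.
- exact: bmfun_Om_ker H _ _ _ _ r0 Ox (bmfun_diff _ bu).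
Qed.

(** If q is a boundary point nearest to x, then |.-q|^a touches d^a from above at x. Writing it
    as the power a/2 of |.-q|^2 and using concavity bounds it by a quadratic function,
    whose second differences are given by the parallelogram identity. *)
Lemma dist_pow_second_diff (a : R) x z : 0 < a < 1 -> Omega x ->
  - (2 * (a / 2 * d x `^ a / d x ^+ 2) * enorm z ^+ 2) <=
    (d x `^ a - d (x - z) `^ a) + (d x `^ a - d (x + z) `^ a).
Proof.
move=> /andP[a0 a1] Ox; have dx := st_dist H Ox.
have b0 := dist_gt0_bdry_nonempty dx.
have [q bq dq] := dist_nearest (st_bounded H) x b0.
have D2 : 0 < d x ^+ 2 by rewrite exprn_gt0.
have tangent y : d y `^ a <= d x `^ a * (1 + a / 2 * (enorm (y - q) ^+ 2 / d x ^+ 2 - 1)).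
  apply: (@le_trans _ _ (enorm (y - q) `^ a)).
    by apply: (ge0_ler_powR (ltW a0)); rewrite ?nnegrE ?dist_ge0 ?enorm_ge0//; exact: dist_le.
  have -> : enorm (y - q) `^ a = d x `^ a * (enorm (y - q) ^+ 2 / d x ^+ 2) `^ (a / 2).
    rewrite -!powR_mulrn ?enorm_ge0 ?(ltW dx)// -powRN.
    rewrite powRM ?powR_ge0// -!powRrM.
    have -> : 2 * (a / 2) = a by field.
    have -> : - 2 * (a / 2) = - a by field.
    rewrite mulrCA -powRD ?subrr ?powRr0 ?mulr1//.
    by rewrite (gt_eqF dx) implybT.
  rewrite ler_wpM2l ?powR_ge0//; apply: powR_le_tangent.
    by rewrite divr_ge0 ?sqr_ge0.
  by apply/andP; split; lra.
have t1 := tangent (x - z); have t2 := tangent (x + z).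
have par := enorm_parallelogram (x - q) z.
have e1 : x - z - q = x - q - z by rewrite addrAC.
have e2 : x + z - q = x - q + z by rewrite addrAC.
rewrite e1 in t1; rewrite e2 in t2; rewrite -dq in par.
have e3 : d x `^ a * (1 + a / 2 * (enorm (x - q - z) ^+ 2 / d x ^+ 2 - 1)) +
    d x `^ a * (1 + a / 2 * (enorm (x - q + z) ^+ 2 / d x ^+ 2 - 1)) =
    2 * d x `^ a + 2 * (a / 2 * d x `^ a / d x ^+ 2) * enorm z ^+ 2.
  have -> : enorm (x - q + z) ^+ 2 = 2 * d x ^+ 2 + 2 * enorm z ^+ 2 - enorm (x - q - z) ^+ 2.
    by rewrite -par; ring.
  by field; rewrite gt_eqF.
move: t1 t2 e3.
move: (d (x - z) `^ a) (d (x + z) `^ a) => A B t1 t2 e3.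
have := lerD t1 t2; rewrite e3; lra.
Qed.

(** Away from x the increment of d^a is at most a multiple of |x-w|^s, which the kernel
    integrates at infinity; the factor a makes the far part small with a. *)
Lemma dist_pow_growth (a t : R) x w : 0 < a < s -> Omega x -> 0 < t ->
  t * d x <= enorm (x - w) ->
  d w `^ a <= d x `^ a + a / s * (1 + t^-1) `^ s * (d x `^ (a - s) * enorm (x - w) `^ s).
Proof.
move=> /andP[a0 as_] Ox t0 tx; have dx := st_dist H Ox.
have s0 : 0 < s by exact: lt_trans as_.
have b0 := dist_gt0_bdry_nonempty dx.
have dw : d w <= d x + enorm (x - w) by rewrite enormB; exact: dist_lipschitz.
set e := enorm (x - w) in tx dw *.
have e0 : 0 <= e by exact: enorm_ge0.
apply: (@le_trans _ _ ((d x + e) `^ a)).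
  by apply: (ge0_ler_powR (ltW a0)); rewrite ?nnegrE ?dist_ge0// addr_ge0 ?dist_ge0.
have -> : (d x + e) `^ a = d x `^ a * ((1 + e / d x) `^ s) `^ (a / s).
  rewrite -powRrM mulrCA divff ?gt_eqF// mulr1 -powRM ?(ltW dx)//.
    by congr powR; field; rewrite gt_eqF.
  by rewrite addr_ge0// divr_ge0 ?(ltW dx).
have as1 : 0 < a / s < 1 by rewrite divr_gt0//= ltr_pdivrMr// mul1r.
have h1 := powR_le_tangent (powR_ge0 (1 + e / d x) s) as1.
have h2 : (1 + e / d x) `^ s <= (1 + t^-1) `^ s * (e / d x) `^ s.
  rewrite -powRM ?divr_ge0 ?addr_ge0 ?invr_ge0 ?(ltW t0) ?(ltW dx)//.
  have ed0 : 0 <= e / d x by rewrite divr_ge0 ?(ltW dx).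
  have ti0 : 0 <= t^-1 by rewrite invr_ge0 ltW.
  apply: (ge0_ler_powR (ltW s0)).
  - by rewrite nnegrE addr_ge0.
  - by rewrite nnegrE mulr_ge0// addr_ge0.
  rewrite mulrDl mul1r [leLHS]addrC lerD2l.
  by rewrite mulrC ler_pdivlMr// mul1r ler_pdivlMr.
have -> : d x `^ (a - s) * e `^ s = d x `^ a * (e / d x) `^ s.
  rewrite powRM ?invr_ge0 ?(ltW dx)// -[(d x)^-1]powR_inv1 ?(ltW dx)// -powRrM mulN1r.
  by rewrite powRD ?(gt_eqF dx) ?implybT// -!mulrA; congr (_ * _); rewrite mulrC.
rewrite [X in _ <= _ + X](_ : _ = d x `^ a * (a / s * ((1 + t^-1) `^ s * (e / d x) `^ s))); last by ring.
rewrite -[X in _ <= X + _]mulr1 -mulrDr ler_wpM2l ?powR_ge0//.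
apply: (le_trans h1); rewrite lerD2l ler_wpM2l//; first by case/andP: as1 => /ltW.
by rewrite (le_trans _ h2)// gerBl.
Qed.

Variable C0 C1 : R.
Hypothesis C0_gt0 : 0 < C0.
Hypothesis C1_gt0 : 0 < C1.
Hypothesis C0_moment : forall rho x r, 0 < rho -> 0 < r ->
  lint (eball x r) (fun w => enorm (x - w) `^ 2 * k rho (x - w)) <= C0 * r `^ (2 - 2 * s).
Hypothesis C1_moment : forall rho x r A D, 0 < rho -> 0 < r ->
  leb_measurable A -> A `<=` eball x D ->
  lint (A `\` eball x r) (fun w => enorm (x - w) `^ s * k rho (x - w)) <= C1 * r `^ (- s).

(** The bound carries a factor a and is uniform in rho: this is what makes it possible to
    absorb it into the zero-order term for small a. *)
Lemma nonlocal_dist_pow : exists2 B : R, 0 < B & forall a rho x, 0 < a < s -> 0 < rho -> Omega x ->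
  - (a * B * d x `^ (a - 2 * s)) <= L rho (fun w => d w `^ a) x.
Proof.
have /andP[s0 s1] := st_s H; have z0 := st_zeta H.
pose A := (1 + zeta^-1) `^ s.
exists (2^-1 * C0 * zeta `^ (2 - 2 * s) + s^-1 * A * C1 * zeta `^ (- s)).
  by rewrite addr_gt0// !mulr_gt0 ?powR_gt0 ?invr_gt0// addr_gt0// invr_gt0.
move=> a rho x /andP[a0 as_] rho0 Ox; have dx := st_dist H Ox.
have bdr := dist_gt0_bdry_nonempty dx.
have a1 : a < 1 by rewrite (lt_trans as_).
pose b w := d w `^ a.
have bb : bmfun Omega b by exact: bmfun_dist_pow (ltW a0).
pose r := zeta * d x; have r0 : 0 < r by rewrite mulr_gt0.
have fO := finmeas_Om H Ox; have mO := st_meas H Ox.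
have bI : bmfun (Om x) (fun w => (b x - b w) * k rho (x - w)).
  exact: bmfun_Om_ker H _ _ _ _ rho0 Ox (bmfun_diff _ bb).
pose c := a / 2 * d x `^ a / d x ^+ 2.
have c0 : 0 <= c by rewrite divr_ge0 ?sqr_ge0 ?mulr_ge0 ?powR_ge0 ?divr_ge0 ?(ltW a0).
have near : - (c * C0 * r `^ (2 - 2 * s)) <=
    lint (Om x `&` eball x r) (fun w => (b x - b w) * k rho (x - w)).
  apply: (near_lower_bound H C0_moment Ox rho0 r0 (lexx _)
    (bmfunS mO (@subIsetl _ _ _) (bmfun_Om H Ox bb)) c0 _
    (bmfunS mO (@subIsetl _ _ _) (bmfun_ker p0 x rho0 mO))).
  - by move=> z _ _ _; apply: dist_pow_second_diff => //; rewrite a0 a1.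
  - by move=> z; exact: kerN.
  - by move=> z; rewrite ker_ge0 lexx.
rewrite /nonlocal (lint_split fO (leb_measurable_eball x r) bI).
have [D D0 [HD _]] := diameter_bound (st_bounded H).
have OD : Om x `<=` eball x D.
  by move=> w /(st_sub H Ox) Ow; exact: HD.
pose m w := enorm (x - w) `^ s * k rho (x - w).
have bm : bmfun (Om x) m := bmfun_enorm_pow_ker (st_s H) rho0 (ltW s0) mO OD.
have fD : finmeas (Om x `\` eball x r) := finmeasD fO (leb_measurable_eball _ _).
have SD : Om x `\` eball x r `<=` Om x by exact: subDsetl.
pose E := a / s * A * d x `^ (a - s).
have E0 : 0 <= E by rewrite !mulr_ge0 ?powR_ge0 ?invr_ge0 ?(ltW a0) ?(ltW s0).
have far : - (E * (C1 * r `^ (- s))) <=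
    lint (Om x `\` eball x r) (fun w => (b x - b w) * k rho (x - w)).
  apply: (@le_trans _ _ (lint (Om x `\` eball x r) (fun w => - E * m w))).
    rewrite (lintZ _ fD (bmfunS mO SD bm)) mulNr lerN2 ler_wpM2l//.
    exact: C1_moment OD.
  apply: (le_lint fD (bmfunM (bmfun_cst _ _) (bmfunS mO SD bm)) (bmfunS mO SD bI)).
  move=> w [Ow /negP]; rewrite -leNgt enormB => rw.
  rewrite /m mulrA ler_wpM2r ?ker_ge0//.
  have as2 : 0 < a < s by rewrite a0.
  have gr := dist_pow_growth as2 Ox z0 rw.
  rewrite mulNr lerNl opprB lerBlDl; apply: (le_trans gr); rewrite -/A lerD2l.
  by rewrite mulrA.
apply: le_trans (lerD near far).
have e1 : d x `^ a / d x ^+ 2 * d x `^ (2 - 2 * s) = d x `^ (a - 2 * s).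
  rewrite -powR_mulrn ?(ltW dx)// -powRN -!powRD ?(gt_eqF dx) ?implybT//.
  by congr powR; ring.
have e2 : d x `^ (a - s) * d x `^ (- s) = d x `^ (a - 2 * s).
  by rewrite -powRD ?(gt_eqF dx) ?implybT//; congr powR; ring.
have e3 : c * C0 * r `^ (2 - 2 * s) =
    a * (2^-1 * C0 * zeta `^ (2 - 2 * s)) * d x `^ (a - 2 * s).
  by rewrite -e1 /c /r powRM ?(ltW z0) ?(ltW dx)//; ring.
have e4 : E * (C1 * r `^ (- s)) =
    a * (s^-1 * A * C1 * zeta `^ (- s)) * d x `^ (a - 2 * s).
  by rewrite -e2 /E /r powRM ?(ltW z0) ?(ltW dx)//; ring.
by rewrite e3 e4 -opprD -mulrDl -mulrDr.
Qed.

(** The zero-order term h d^eta is at least alpha d^(eta-2s), and the operator takes away at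
    most half of it once eta B <= alpha / 2. *)
Lemma barrier : exists eta K : R, [/\ 0 < eta, 0 < K & forall rho x, 0 < rho -> Omega x ->
  `|f x| <= h x * (K * d x `^ eta) + L rho (fun w => K * d w `^ eta) x].
Proof.
have [B B0 HB] := nonlocal_dist_pow; have /andP[s0 s1] := st_s H.
have al0 := st_alpha H; have ef0 := st_etaf H; have Cf0 := st_Cf H.
have [D D0 [_ HD]] := diameter_bound (st_bounded H).
(* eta <= etaf absorbs the growth of f, eta < s is needed for the far part of the
   operator, and the last bound lets the zero-order term dominate. *)
pose eta := Num.min etaf (Num.min (s / 2) (alpha / (2 * B))).
have eta0 : 0 < eta by rewrite !lt_min ef0 !divr_gt0 ?mulr_gt0.
have etas : 0 < eta < s.
  by rewrite eta0 (@le_lt_trans _ _ (s / 2))// ?ge_min ?lexx ?orbT// ltr_pdivrMr// ltr_pMr// ltr1n.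
have etaB : eta * B <= alpha / 2.
  have : eta <= alpha / (2 * B) by rewrite !ge_min lexx !orbT.
  by rewrite ler_pdivlMr ?mulr_gt0// => h1; lra.
have etaf_le : eta <= etaf by rewrite ge_min lexx.
pose K := 2 * Cf * D `^ (etaf - eta) / alpha.
have K0 : 0 < K by rewrite divr_gt0// !mulr_gt0 ?powR_gt0.
exists eta, K; split => // rho x rho0 Ox; have dx := st_dist H Ox.
have bdr := dist_gt0_bdry_nonempty dx.
rewrite (nonlocalZ _ rho0 Ox (bmfun_dist_pow (ltW eta0))).
have h1 := HB eta rho x etas rho0 Ox.
set P := d x `^ (eta - 2 * s) in h1.
have P0 : 0 < P by exact: powR_gt0.
have h2 : alpha * P <= h x * d x `^ eta.
  rewrite /P addrC powRD ?(gt_eqF dx) ?implybT// mulrA ler_wpM2r ?powR_ge0//.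
  exact: st_hlb H _ Ox.
have h3 : `|f x| <= Cf * D `^ (etaf - eta) * P.
  have -> : `|f x| = `|f x| * d x `^ (2 * s - etaf) * (d x `^ (etaf - eta) * P).
    rewrite -mulrA -!powRD ?(gt_eqF dx) ?implybT//.
    by rewrite (_ : _ + _ = 0) ?powRr0 ?mulr1//; ring.
  rewrite -[leRHS]mulrA; apply: ler_pM.
  - by rewrite mulr_ge0 ?powR_ge0.
  - by rewrite mulr_ge0 ?powR_ge0.
  - exact: st_growth H _ Ox.
  - rewrite ler_wpM2r ?powR_ge0//; apply: ge0_ler_powR; rewrite ?nnegrE ?subr_ge0 ?dist_ge0 ?(ltW D0)//.
    exact: HD.
apply: (le_trans h3).
have -> : Cf * D `^ (etaf - eta) * P = K * (alpha / 2 * P).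
  by rewrite /K; field; rewrite gt_eqF.
rewrite [h x * (K * _)]mulrCA -mulrDr ler_wpM2l ?(ltW K0)//.
have h4 : eta * B * P <= alpha / 2 * P by rewrite ler_wpM2r ?(ltW P0).
move: h1 h2 h4; lra.
Qed.

End barrier.

(** * Solving the capped equations *)

Lemma lint_dominated_cvg {R : realType} {n : nat} (A : set 'rV[R]_n.+1)
    (g_ : nat -> 'rV[R]_n.+1 -> R) (g : 'rV[R]_n.+1 -> R) (M : R) :
  finmeas A -> (forall m, bmfun A (g_ m)) -> (forall m x, A x -> `|g_ m x| <= M) ->
  (forall x, A x -> g_ ^~ x @ \oo --> g x) ->
  bmfun A g /\ lint A (g_ m) @[m --> \oo] --> lint A g.
Proof.
move=> fA bg gM gcvg; have mA : leb_measurable A by case: fA.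
have bg' : bmfun A g.
  split.
    apply: (@measurable_fun_cvg _ (caratheodory_type (@leb_om R n)) R A g_ g) => // m.
    by case: (bg m).
  exists M => x Ax; have cn : `|g_ m x| @[m --> \oo] --> `|g x|.
    by apply: cvg_norm; exact: gcvg.
  have <- := cvg_lim (@Rhausdorff R) cn; apply: limr_le; first by apply: cvgP cn.
  by apply: nearW => m; exact: gM.
split => //; rewrite unlock; apply: fine_cvg; rewrite fineK; last first.
  by apply: integrable_fin_num => //; exact: bmfun_integrable.
have [] := @dominated_convergence _ _ _ (leb R n) A mA (fun m x => (g_ m x)%:E)
    (fun x => (g x)%:E) (fun=> M%:E).
- by move=> m; apply/measurable_EFinP; case: (bg m).
- by apply/measurable_EFinP; case: bg'.
- by apply: aeW => x Ax; apply: cvg_EFin; [exact: nearW|exact: gcvg].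
- exact: bmfun_integrable fA (bmfun_cst _ _).
- by apply: aeW => x m Ax; rewrite lee_fin; exact: gM.
- by [].
Qed.

Section fixpoint.
Context {R : realType} {n : nat}.
Notation V := 'rV[R]_n.+1.
Variables (s : R) (Omega Sigma : set V) (Om : V -> set V) (h f : V -> R).
Variables (alpha zeta etaf Cf : R).
Hypothesis H : setting s Omega Sigma Om h f alpha zeta etaf Cf.
Implicit Types (x y z w : V) (A : set V) (r : R) (u v g j : V -> R).

Local Notation k := (ker (@kexp R n s)).
Local Notation L := (nonlocal s Om).

Let p0 : 0 < @kexp R n s. Proof. exact: kexp_gt0 (st_s H). Qed.

Lemma h_gt0 x : Omega x -> 0 < h x.
Proof. by move=> Ox; have [h0 h00 hh] := h_lower_bound H; exact: lt_le_trans (hh x Ox). Qed.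

Variable rho : R.
Hypothesis rho0 : 0 < rho.

Definition conv g x : R := lint (Om x) (fun w => g w * k rho (x - w)).

Definition mass x : R := lint (Om x) (fun w => k rho (x - w)).

Lemma mass_ge0 x : 0 <= mass x.
Proof. by apply: lint_ge0 => w _; exact: ker_ge0. Qed.

Lemma nonlocalE u x : Omega x -> bmfun Omega u -> L rho u x = u x * mass x - conv u x.
Proof.
move=> Ox bu; have fO := finmeas_Om H Ox.
have bk := bmfun_ker p0 x rho0 (st_meas H Ox).
rewrite /mass /conv -(lintZ _ fO bk) -(lintB fO (bmfunM (bmfun_cst _ _) bk) (bmfun_Om_ker H x rho0 Ox bu)).
by apply: eq_lint => w _; rewrite mulrBl.
Qed.

Lemma conv_continuous g : bmfun Omega g -> {in Omega, continuous (conv g)}.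
Proof.
move=> bg x; rewrite inE => Ox; apply/continuousP_enorm => e e0.
have [_ [M gM]] := bg.
pose K := `|M| + 1; have K0 : 0 < K by rewrite ltr_pwDr.
have gK w : Omega w -> `|g w| <= K.
  by move=> /gM h1; rewrite (le_trans h1)// (le_trans (ler_norm _))// lerDl.
pose a := vol Omega * (@kexp R n s * rho `^ (- @kexp R n s) / rho).
pose b := rho `^ (- @kexp R n s).
have a0 : 0 <= a.
  exact: mulr_ge0 (vol_ge0 _) (divr_ge0 (mulr_ge0 (ltW p0) (powR_ge0 _ _)) (ltW rho0)).
have b0 : 0 < b by exact: powR_gt0.
pose e' := e / (K * (a + b)); have e'0 : 0 < e'.
  by apply: divr_gt0 e0 (mulr_gt0 K0 _); rewrite ltr_wpDl.
have [r1 r10 H1] := Om_cvg H e'0 Ox.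
have : nbhs x Omega by apply: open_nbhs_nbhs; split => //; exact: st_open H.
move=> /nbhs_eball[r2 r20 H2].
exists (Num.min r1 (Num.min r2 e')); first by rewrite !lt_min r10 r20.
move=> y; rewrite !lt_min => /and3P[y1 y2 y3].
have Oy : Omega y by apply: H2.
rewrite distrC; apply: (le_lt_trans (lint_ker_stability H rho0 Ox Oy bg gK)).
rewrite -/b -/a.
have v1 := H1 y Oy y1; rewrite enormB.
apply: (@lt_le_trans _ _ (K * (a * e' + b * e'))).
  by rewrite ltr_pM2l// ler_ltD ?ltr_pM2l// ler_wpM2l// ltW.
by rewrite -mulrDl mulrA /e' mulrC divfK// gt_eqF// mulr_gt0// ltr_wpDl.
Qed.

Lemma mass_continuous : {in Omega, continuous mass}.
Proof.
have -> : mass = conv (fun=> 1).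
  by apply/funext => x; apply: eq_lint => w _; rewrite mul1r.
by apply: conv_continuous; exact: bmfun_cst.
Qed.

(** The value at x that solves the capped equation when the values u w under the integral
    are given. *)
Definition resolvent u x : R := (f x + conv u x) / (h x + mass x).

Lemma denom_gt0 x : Omega x -> 0 < h x + mass x.
Proof. by move=> Ox; rewrite ltr_pwDl ?mass_ge0 ?h_gt0. Qed.

(** The integral against a capped kernel is continuous even if u is only measurable: the
    fixed point will be continuous although it is obtained as a pointwise limit. *)
Lemma resolvent_continuous u : bmfun Omega u -> {in Omega, continuous (resolvent u)}.
Proof.
move=> bu x xO; have Ox : Omega x by rewrite inE in xO.
have c1 : f y + conv u y @[y --> x] --> f x + conv u x.
  exact: cvgD (st_f H xO) (conv_continuous bu xO).
have c2 : h y + mass y @[y --> x] --> h x + mass x.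
  exact: cvgD (st_h H xO) (mass_continuous xO).
by apply: (cvgM c1 (cvgV _ c2)); rewrite gt_eqF// denom_gt0.
Qed.

Lemma resolvent_mono u v : bmfun Omega u -> bmfun Omega v ->
  (forall x, Omega x -> u x <= v x) -> forall x, Omega x -> resolvent u x <= resolvent v x.
Proof.
move=> bu bv uv x Ox; rewrite ler_wpM2r ?invr_ge0 ?(ltW (denom_gt0 Ox))// lerD2l.
apply: (le_lint (finmeas_Om H Ox) (bmfun_Om_ker H x rho0 Ox bu) (bmfun_Om_ker H x rho0 Ox bv)).
by move=> w /(st_sub H Ox) Ow; rewrite ler_wpM2r ?ker_ge0// uv.
Qed.

Lemma resolvent_fix u x : Omega x -> bmfun Omega u -> u x = resolvent u x ->
  h x * u x + L rho u x = f x.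
Proof.
move=> Ox bu ux; rewrite nonlocalE//.
have -> : h x * u x + (u x * mass x - conv u x) = (h x + mass x) * u x - conv u x by ring.
by rewrite {1}ux /resolvent mulrC divfK ?gt_eqF ?denom_gt0// addrK.
Qed.

Variable b : V -> R.
Hypothesis bb : bmfun Omega b.
Hypothesis b_ge0 : forall x, Omega x -> 0 <= b x.
Hypothesis b_super : forall x, Omega x -> `|f x| <= h x * b x + L rho b x.

Lemma resolvent_super x : Omega x -> resolvent b x <= b x.
Proof.
move=> Ox; rewrite ler_pdivrMr ?denom_gt0//.
have := b_super Ox; rewrite nonlocalE// ler_norml => /andP[_ h1].
have -> : b x * (h x + mass x) = h x * b x + (b x * mass x - conv b x) + conv b x by ring.
by rewrite lerD2r.
Qed.

Lemma bmfunN A u : bmfun A u -> bmfun A (fun w => - u w).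
Proof.
move=> bu; have -> : (fun w => - u w) = (fun w => 0 - u w) by apply/funext => w; rewrite sub0r.
exact: bmfun_diff.
Qed.

Lemma resolvent_sub x : Omega x -> - b x <= resolvent (fun w => - b w) x.
Proof.
move=> Ox; rewrite ler_pdivlMr ?denom_gt0//.
have := b_super Ox; have := nonlocalE Ox (bmfunN bb).
rewrite (nonlocalN H rho0 Ox bb) => e1; rewrite ler_norml => /andP[h1 _].
rewrite -lerBlDr; apply: le_trans h1.
have -> : L rho b x = b x * mass x + conv (fun w => - b w) x.
  by rewrite -[LHS]opprK e1; ring.
by rewrite le_eqVlt; apply/orP; left; apply/eqP; ring.
Qed.

Fixpoint iterate (m : nat) : V -> R :=
  if m is m'.+1 then resolvent (iterate m') else b.

(** The iteration starts from a supersolution, hence decreases; it stays above the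
    subsolution - b. *)
Lemma iterateP m : [/\ bmfun Omega (iterate m),
  forall x, Omega x -> `|iterate m x| <= b x &
  forall x, Omega x -> iterate m.+1 x <= iterate m x].
Proof.
elim: m => [|m [bu ub uS]].
  split => // x Ox; first by rewrite /= ger0_norm ?b_ge0.
  exact: resolvent_super.
have ub' x : Omega x -> `|iterate m.+1 x| <= b x.
  move=> Ox; rewrite ler_norml; apply/andP; split.
    apply: (le_trans (resolvent_sub Ox)); apply: (resolvent_mono (bmfunN bb) bu) => // w /ub.
    by rewrite ler_norml => /andP[].
  apply: (le_trans _ (resolvent_super Ox)); apply: (resolvent_mono bu bb) => // w /ub.
  by rewrite ler_norml => /andP[].
have bS : bmfun Omega (iterate m.+1).
  split; first exact: continuous_leb_measurable_fun (st_open H) (resolvent_continuous bu).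
  have [_ [M bM]] := bb; exists M => x Ox.
  by rewrite (le_trans (ub' x Ox))// (le_trans (ler_norm _))// bM.
by split => //; exact: (resolvent_mono bS bu).
Qed.

(** Monotone iteration between the barriers - b and b. *)
Lemma approx_solution : exists u, [/\ {in Omega, continuous u},
  forall x, Omega x -> `|u x| <= b x &
  forall x, Omega x -> h x * u x + L rho u x = f x].
Proof.
pose u x := limn (iterate ^~ x).
have ucvg x : Omega x -> iterate ^~ x @ \oo --> u x.
  move=> Ox; apply: nonincreasing_is_cvgn.
    by apply/nonincreasing_seqP => m; have [_ _] := iterateP m; exact.
  exists (- b x) => _ [m _ <-]; have [_ /(_ x Ox) + _] := iterateP m.
  by rewrite ler_norml => /andP[].
have [_ [M bM]] := bb.
have iM m x : Omega x -> `|iterate m x| <= M.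
  move=> Ox; have [_ /(_ x Ox) h1 _] := iterateP m.
  by rewrite (le_trans h1)// (le_trans (ler_norm _))// bM.
have fO := Omega_finmeas (st_open H) (st_bounded H).
have bi m : bmfun Omega (iterate m) by have [] := iterateP m.
have [bu _] := lint_dominated_cvg fO bi iM ucvg.
have ufix x : Omega x -> u x = resolvent u x.
  move=> Ox; have cv : resolvent (iterate m) x @[m --> \oo] --> resolvent u x.
    have c1 : conv (iterate m) x @[m --> \oo] --> conv u x.
      apply: (lint_dominated_cvg (M := M * rho `^ (- @kexp R n s)) (finmeas_Om H Ox)
        (fun m => bmfun_Om_ker H x rho0 Ox (bi m)) _ _).2.
        move=> m w /(st_sub H Ox) Ow; rewrite normrM ler_pM ?iM//.
        exact: (ker_norm_le p0 _ rho0).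
      by move=> w /(st_sub H Ox) Ow; apply: cvgMl; exact: ucvg.
    exact: cvgMl (cvgD (cvg_cst _) c1).
  have := ucvg x Ox; rewrite -(cvg_shiftn 1) => cv1.
  apply: (@cvg_unique _ (@Rhausdorff R)) cv1 _.
  by rewrite (_ : (fun m => _) = fun m => resolvent (iterate m) x)//; apply/funext => m; rewrite addn1.
exists u; split.
- have cr := resolvent_continuous bu.
  move=> x xO; have Ox : Omega x by rewrite inE in xO.
  have : u y @[y --> x] --> resolvent u x; last by rewrite -ufix.
  have nO : nbhs x Omega by apply: open_nbhs_nbhs; split => //; exact: st_open H.
  have ne : \forall y \near nbhs x, resolvent u y = u y.
    by apply: filterS nO => y Oy; rewrite -ufix.
  exact: cvg_trans (near_eq_cvg ne) (cr x xO).
- move=> x Ox; have cn : `|iterate m x| @[m --> \oo] --> `|u x|.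
    by apply: cvg_norm; exact: ucvg.
  have <- := cvg_lim (@Rhausdorff R) cn; apply: limr_le; first by apply: cvgP cn.
  by apply: nearW => m; have [_ /(_ x Ox)] := iterateP m.
- by move=> x Ox; apply: (resolvent_fix Ox bu); exact: ufix.
Qed.

End fixpoint.

(** * Convergence of the capped solutions *)

Section limit.
Context {R : realType} {n : nat}.
Notation V := 'rV[R]_n.+1.
Variables (s : R) (Omega Sigma : set V) (Om : V -> set V) (h f : V -> R).
Variables (alpha zeta etaf Cf : R).
Hypothesis H : setting s Omega Sigma Om h f alpha zeta etaf Cf.
Implicit Types (x y z w : V) (A : set V) (r rho c : R) (u v g j : V -> R).

Local Notation d := (dist_bdry Omega).
Local Notation k := (ker (@kexp R n s)).
Local Notation L := (nonlocal s Om).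

Variable C0 : R.
Hypothesis C0_gt0 : 0 < C0.
Hypothesis C0_moment : forall rho x r, 0 < rho -> 0 < r ->
  lint (eball x r) (fun w => enorm (x - w) `^ 2 * k rho (x - w)) <= C0 * r `^ (2 - 2 * s).

Local Notation qsub := (quadratic_sub s Omega Om h zeta C0).

Lemma continuous_bounded_bmfun u M : {in Omega, continuous u} ->
  (forall x, Omega x -> `|u x| <= M) -> bmfun Omega u.
Proof.
move=> cu uM; split; last by exists M.
exact: continuous_leb_measurable_fun (st_open H) cu.
Qed.

(** A touching paraboloid bounds the second differences of u by those of the paraboloid,
    which do not depend on its centre. *)
Lemma approx_quadratic_sub g rho r u : 0 < rho -> rho <= r -> bmfun Omega u ->
  (forall x, Omega x -> h x * u x + L rho u x = g x) -> qsub g r u.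
Proof.
move=> rho0 rr bu eqn x y0 c Ox c0 rx touch.
rewrite -(eqn x Ox) -addrA lerD2l.
apply: (nonlocal_scale H C0_moment Ox rho0 rr rx bu c0) => z Oxz Oxz' _.
have t1 := touch _ Oxz; have t2 := touch _ Oxz'.
have par := enorm_parallelogram (x - y0) z.
have e1 : x - z - y0 = x - y0 - z by rewrite addrAC.
have e2 : x + z - y0 = x - y0 + z by rewrite addrAC.
rewrite e1 in t1; rewrite e2 in t2.
have e3 : c * (enorm (x - y0 - z) ^+ 2 - enorm (x - y0) ^+ 2) +
   c * (enorm (x - y0 + z) ^+ 2 - enorm (x - y0) ^+ 2) = 2 * c * enorm z ^+ 2.
  have -> : enorm (x - y0 + z) ^+ 2 =
    2 * enorm (x - y0) ^+ 2 + 2 * enorm z ^+ 2 - enorm (x - y0 - z) ^+ 2 by rewrite -par; ring.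
  by ring.
rewrite -e3; move: t1 t2; move: (c * _) (c * _) (u x) (u _) (u _) => *; lra.
Qed.

Lemma dist_pow_small (K eta e : R) : 0 < K -> 0 < eta -> 0 < e ->
  exists2 del : R, 0 < del & forall x, Omega x -> d x < 2 * del -> K * d x `^ eta <= e.
Proof.
move=> K0 eta0 e0; have [r r0 Hr] := small_power eta0 (divr_gt0 e0 K0).
exists (r / 2); first exact: divr_gt0.
move=> x Ox dx; rewrite mulrC -ler_pdivlMr//; apply: Hr; first exact: st_dist H _ Ox.
by rewrite mulrC divfK// in dx; exact: ltW.
Qed.

Definition approx_family (U : R -> V -> R) (eta K : R) := forall rho, 0 < rho ->
  [/\ {in Omega, continuous (U rho)}, forall x, Omega x -> `|U rho x| <= K * d x `^ eta &
      forall x, Omega x -> h x * U rho x + L rho (U rho) x = f x].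

Lemma dist_pow_bound (K eta : R) : 0 < K -> 0 < eta ->
  exists2 M : R, 0 < M & forall x, Omega x -> K * d x `^ eta <= M.
Proof.
move=> K0 eta0; have [D D0 [_ HD]] := diameter_bound (st_bounded H).
exists (K * D `^ eta); first by rewrite mulr_gt0// powR_gt0.
move=> x Ox; rewrite ler_pM2l//; apply: (ge0_ler_powR (ltW eta0)); rewrite ?nnegrE ?dist_ge0 ?(ltW D0)//.
by apply: HD => //; exact: dist_gt0_bdry_nonempty (st_dist H Ox).
Qed.

Lemma approx_family_compare U eta K v : 0 < eta -> 0 < K -> approx_family U eta K ->
  {in Omega, continuous v} ->
  (forall e, 0 < e -> exists2 del : R, 0 < del & forall x, Omega x -> d x < 2 * del -> `|v x| <= e) ->
  forall M, 0 < M -> (forall x, Omega x -> `|v x| <= M) ->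
  forall kap, 0 < kap -> exists2 r : R, 0 < r & forall rho, 0 < rho -> rho <= r ->
    qsub f r v -> qsub (fun x => - f x) r (fun x => - v x) ->
    forall x, Omega x -> `|v x - U rho x| <= kap.
Proof.
move=> eta0 K0 UP cv vsmall M M0 vM kap kap0.
have [M' M'0 HM'] := dist_pow_bound K0 eta0.
have k4 : 0 < kap / 4 by exact: divr_gt0.
have [del1 del10 H1] := dist_pow_small K0 eta0 k4.
have [del2 del20 H2] := vsmall _ k4.
have MM : 0 < M + M' by exact: addr_gt0.
have dd : 0 < Num.min del1 del2 by rewrite lt_min del10.
have [r r0 Hr] := comparison H C0_gt0 MM dd kap0.
exists r => // rho rho0 rr qv qv' x Ox; have [cU bU eU] := UP rho rho0.
have uM y : Omega y -> `|U rho y| <= M + M'.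
  by move=> Oy; rewrite (le_trans (bU y Oy))// (le_trans (HM' y Oy))// lerDr ltW.
have vM' y : Omega y -> `|v y| <= M + M'.
  by move=> Oy; rewrite (le_trans (vM y Oy))// lerDl ltW.
have bUf : bmfun Omega (U rho) := continuous_bounded_bmfun cU uM.
have small1 y : Omega y -> d y < 2 * Num.min del1 del2 -> `|U rho y| <= kap / 4.
  move=> Oy dy; rewrite (le_trans (bU y Oy))// H1// (lt_le_trans dy)//.
  by rewrite ler_pM2l// ge_min lexx.
have small2 y : Omega y -> d y < 2 * Num.min del1 del2 -> `|v y| <= kap / 4.
  move=> Oy dy; rewrite H2// (lt_le_trans dy)//.
  by rewrite ler_pM2l// ge_min lexx orbT.
have qU : qsub f r (U rho) := approx_quadratic_sub rho0 rr bUf eU.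
have qU' : qsub (fun x => - f x) r (fun x => - U rho x).
  apply: (approx_quadratic_sub rho0 rr (bmfunN bUf)) => y Oy.
  by rewrite (nonlocalN H rho0 Oy bUf) -eU//; ring.
have h1 : v x - U rho x <= kap.
  by apply: (Hr v (U rho)) => // y Oy dy; split; [exact: small2|exact: small1].
have h2 : U rho x - v x <= kap.
  by apply: (Hr (U rho) v) => // y Oy dy; split; [exact: small1|exact: small2].
by rewrite ler_norml; apply/andP; split; lra.
Qed.

Variable C1 : R.
Hypothesis C1_gt0 : 0 < C1.
Hypothesis C1_moment : forall rho x r A D, 0 < rho -> 0 < r ->
  leb_measurable A -> A `<=` eball x D ->
  lint (A `\` eball x r) (fun w => enorm (x - w) `^ s * k rho (x - w)) <= C1 * r `^ (- s).

Lemma approx_family_ex : exists U eta K, [/\ 0 < eta, 0 < K & approx_family U eta K].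
Proof.
have [eta [K [eta0 K0 bar]]] := barrier H C0_gt0 C1_gt0 C0_moment C1_moment.
have /choice[U UP] : forall rho, exists u, 0 < rho ->
  [/\ {in Omega, continuous u}, forall x, Omega x -> `|u x| <= K * d x `^ eta &
      forall x, Omega x -> h x * u x + L rho u x = f x].
  move=> rho; have [rho0|_] := ltP 0 rho; last by exists (fun=> 0).
  have bb : bmfun Omega (fun w => K * d w `^ eta).
    exact: bmfunM (bmfun_cst _ _) (bmfun_dist_pow H (ltW eta0)).
  have [|x Ox|u uP] := @approx_solution _ _ _ _ _ _ _ _ _ _ _ _ H rho rho0 _ bb.
  - by move=> x Ox; rewrite mulr_ge0 ?powR_ge0// ltW.
  - exact: bar.
  - by exists u.
by exists U, eta, K.
Qed.

(** Two capped solutions are a sub- and a supersolution at any common larger scale, so the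
    comparison principle shows that they are uniformly close. *)
Lemma limit_ex U eta K : 0 < eta -> 0 < K -> approx_family U eta K ->
  exists u, [/\ {in Omega, continuous u},
    forall x, Omega x -> `|u x| <= K * d x `^ eta,
    forall x, ~ Omega x -> u x = 0 &
    forall kap, 0 < kap -> exists2 r : R, 0 < r & forall rho, 0 < rho -> rho <= r ->
      forall x, Omega x -> `|U rho x - u x| <= kap].
Proof.
move=> eta0 K0 UP.
have [M M0 HM] := dist_pow_bound K0 eta0.
have UM rho x : 0 < rho -> Omega x -> `|U rho x| <= M.
  by move=> rho0 Ox; have [_ /(_ x Ox) h1 _] := UP rho rho0; rewrite (le_trans h1)// HM.
have bU rho : 0 < rho -> bmfun Omega (U rho).
  move=> rho0; have [cU _ _] := UP rho rho0.
  by apply: (continuous_bounded_bmfun cU) => x Ox; exact: UM.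
have cauchy kap : 0 < kap -> exists2 r : R, 0 < r & forall rho rho', 0 < rho -> rho <= r ->
    0 < rho' -> rho' <= r -> forall x, Omega x -> `|U rho x - U rho' x| <= kap.
  move=> kap0; have k4 : 0 < kap / 4 by exact: divr_gt0.
  have [del del0 Hd] := dist_pow_small K0 eta0 k4.
  have [r r0 Hr] := comparison H C0_gt0 M0 del0 kap0.
  exists r => // rho rho' rho0 rr rho'0 rr' x Ox.
  have small y t : 0 < t -> Omega y -> d y < 2 * del -> `|U t y| <= kap / 4.
    by move=> t0 Oy dy; have [_ /(_ y Oy) h1 _] := UP t t0; rewrite (le_trans h1)// Hd.
  have le1 a b : 0 < a -> a <= r -> 0 < b -> b <= r -> U a x - U b x <= kap.
    move=> a0 ar b0 br; have [ca _ ea] := UP a a0; have [cb _ eb] := UP b b0.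
    apply: (Hr (U a) (U b)) => //.
    - by move=> y; exact: UM.
    - by move=> y; exact: UM.
    - by move=> y Oy dy; split; exact: small.
    - exact: approx_quadratic_sub a0 ar (bU a a0) ea.
    - apply: (approx_quadratic_sub b0 br (bmfunN (bU b b0))) => y Oy.
      by rewrite (nonlocalN H b0 Oy (bU b b0)) -eb//; ring.
  have h1 := le1 _ _ rho0 rr rho'0 rr'; have h2 := le1 _ _ rho'0 rr' rho0 rr.
  by rewrite ler_norml; apply/andP; split; lra.
pose v x := lim (U rho x @[rho --> (0 : R)^'+]).
have vcvg x : Omega x -> U rho x @[rho --> (0 : R)^'+] --> v x.
  move=> Ox; apply/cauchy_cvgP/cauchy_ballP => e e0.
  have e2 : 0 < e / 2 by exact: divr_gt0.
  have [r r0 Hr] := cauchy _ e2.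
  exists ([set U rho x | rho in `]0, r]%classic], [set U rho x | rho in `]0, r]%classic]) => /=.
    have near0 : \forall rho \near (0 : R)^'+, `]0, r]%classic rho.
      near=> rho; rewrite /= in_itv/=; apply/andP; split.
        by near: rho; exact: nbhs_right_gt.
      by near: rho; exact: nbhs_right_le.
    by split; apply: filterS near0 => rho ?; exists rho.
  move=> [_ _] /= [[a +] <-] [b + <-]; rewrite !in_itv/= => /andP[a0 ar] /andP[b0 br].
  by rewrite /ball/= (le_lt_trans (Hr _ _ a0 ar b0 br x Ox))// ltr_pdivrMr// ltr_pMr// ltr1n.
have vlim kap : 0 < kap -> exists2 r : R, 0 < r & forall rho, 0 < rho -> rho <= r ->
      forall x, Omega x -> `|U rho x - v x| <= kap.
  move=> kap0; have [r r0 Hr] := cauchy _ kap0; exists r => // rho rho0 rr x Ox.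
  have cn : `|U rho x - U t x| @[t --> (0 : R)^'+] --> `|U rho x - v x|.
    by apply: cvg_norm; apply: cvgB; [exact: cvg_cst|exact: vcvg].
  have <- := cvg_lim (@Rhausdorff R) cn; apply: limr_le; first by apply: cvgP cn.
  near=> t; have t0 : 0 < t by near: t; exact: nbhs_right_gt.
  have tr : t <= r by near: t; exact: nbhs_right_le.
  exact: Hr rho0 rr t0 tr x Ox.
pose u x := if pselect (Omega x) then v x else 0.
have uE x : Omega x -> u x = v x by rewrite /u; case: pselect.
exists u; split.
- move=> x xO; have Ox : Omega x by rewrite inE in xO.
  apply/continuousP_enorm => e e0.
  have [r r0 Hr] := vlim _ (divr_gt0 e0 (ltr0n _ 3)).
  have [cU _ _] := UP r r0.
  have [r1 r10 H1] := (continuousP_enorm _ _).1 (cU x xO) _ (divr_gt0 e0 (ltr0n _ 3)).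
  have : nbhs x Omega by apply: open_nbhs_nbhs; split => //; exact: st_open H.
  move=> /nbhs_eball[r2 r20 H2].
  exists (Num.min r1 r2); first by rewrite lt_min r10.
  move=> y; rewrite lt_min => /andP[y1 y2].
  have Oy : Omega y by exact: H2.
  rewrite !uE//; have := H1 y y1; have := Hr r r0 (lexx _) x Ox; have := Hr r r0 (lexx _) y Oy.
  move: (v y) (v x) (U r x) (U r y) => a b c' d'; rewrite !ler_norml !ltr_norml.
  by move=> /andP[? ?] /andP[? ?] /andP[? ?]; apply/andP; split; lra.
- move=> x Ox; rewrite uE//.
  have cn : `|U t x| @[t --> (0 : R)^'+] --> `|v x| by apply: cvg_norm; exact: vcvg.
  have <- := cvg_lim (@Rhausdorff R) cn; apply: limr_le; first by apply: cvgP cn.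
  near=> t; have t0 : 0 < t by near: t; exact: nbhs_right_gt.
  by have [_ + _] := UP t t0; exact.
- by move=> x nOx; rewrite /u; case: pselect.
- move=> kap kap0; have [r r0 Hr] := vlim _ kap0; exists r => // rho rho0 rr x Ox.
  by rewrite uE//; exact: Hr.
Unshelve. all: by end_near. Qed.

End limit.

(** * Second differences of functions of class C2 *)

Section lines.
Context {R : realType} {n : nat}.
Notation V := 'rV[R]_n.+1.
Implicit Types (x y z w e : V) (g : V -> R).

Lemma is_derive_line g y e (t dg : R) :
  is_derive (t *: e + y) e g dg <-> is_derive t (1 : R) (fun r : R => g (r *: e + y)) dg.
Proof.
have E : (fun h => h^-1 *: ((g \o shift (t *: e + y)) (h *: e) - g (t *: e + y))) =
         (fun h => h^-1 *: (((fun r : R => g (r *: e + y)) \o shift t) (h *: (1 : R))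
                            - g (t *: e + y))).
  apply/funext => h /=; congr (_ *: (g _ - _)).
  by rewrite [h *: 1]mulr1 scalerDl addrA.
by split => -[d1 d2]; split; move: d1 d2; rewrite /derivable /derive E.
Qed.

Definition ccube x (r : R) : set V := [set y | forall i, `|y ord0 i - x ord0 i| <= r].

Lemma ccube_of_enorm x y (r : R) : enorm (y - x) <= r -> ccube x r y.
Proof.
move=> yx i; apply: le_trans yx.
by have := coord_le_enorm (y - x) i; rewrite !mxE.
Qed.

Local Notation unit i := (delta_mx ord0 i : V).

Lemma coord_lipschitz g (dg : 'I_n.+1 -> V -> R) x (r l : R) i a (t : R) :
  (forall y, ccube x r y -> is_derive y (unit i) g (dg i y)) ->
  (forall y, ccube x r y -> `|dg i y| <= l) ->
  ccube x r a -> ccube x r (a + t *: unit i) ->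
  `|g (a + t *: unit i) - g a| <= l * `|t|.
Proof.
move=> dgP dgl.
wlog t0 : a t / 0 <= t => [hw|ca cb].
  have [/hw|/ltW t0 ca cb] := leP 0 t; first exact.
  have := hw (a + t *: unit i) (- t).
  rewrite oppr_ge0 -addrA -scalerDl subrr scale0r addr0 normrN distrC.
  by apply.
pose F (tau : R) := g (tau *: unit i + a).
have inside tau : 0 <= tau <= t -> ccube x r (tau *: unit i + a).
  move=> /andP[h0 ht] j; have := ca j; have := cb j; rewrite !mxE.
  have [->|ji] := eqVneq j i; last by rewrite andbF !mulr0 ?addr0 ?add0r.
  by rewrite eqxx !mulr1 !ler_norml => /andP[? ?] /andP[? ?]; apply/andP; split; lra.
have der tau : 0 <= tau <= t -> is_derive tau (1 : R) F (dg i (tau *: unit i + a)).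
  by move=> /inside h; apply/is_derive_line; exact: dgP.
have [||c] := @MVT_segment R F (fun tau => dg i (tau *: unit i + a)) 0 t t0.
- by move=> tau; rewrite in_itv/= => /andP[? ?]; apply: der; rewrite !ltW.
- apply: continuous_in_subspaceT => tau; rewrite inE/= in_itv/= => ht.
  by apply: differentiable_continuous; apply/derivable1_diffP; have [] := der _ ht.
rewrite in_itv/= => hc; rewrite /F scale0r add0r subr0 [a + _]addrC => ->.
by rewrite normrM ler_wpM2r//; apply: dgl; exact: inside.
Qed.

(** Changing one coordinate at a time, the intermediate points stay in the cube. *)
Lemma cube_lipschitz g (dg : 'I_n.+1 -> V -> R) x (r l : R) a b :
  (forall i y, ccube x r y -> is_derive y (unit i) g (dg i y)) ->
  (forall i y, ccube x r y -> `|dg i y| <= l) ->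
  ccube x r a -> ccube x r b ->
  `|g b - g a| <= l * \sum_(i < n.+1) `|b ord0 i - a ord0 i|.
Proof.
move=> dgP dgl ca cb.
have l0 : 0 <= l := le_trans (normr_ge0 _) (dgl ord0 a ca).
pose c (S : seq 'I_n.+1) : V := \row_j (if j \in S then b ord0 j else a ord0 j).
have cc S : ccube x r (c S).
  by move=> j; rewrite mxE; case: ifP => _; [exact: cb|exact: ca].
have step S : `|g (c S) - g a| <= l * \sum_(i <- S) `|b ord0 i - a ord0 i|.
  elim: S => [|i S IH].
    have -> : c [::] = a by apply/rowP => j; rewrite mxE.
    by rewrite subrr normr0 big_nil mulr0.
  rewrite big_cons mulrDr.
  have ciS : c (i :: S) = c S + (b ord0 i - c S ord0 i) *: unit i.
    apply/rowP => j; rewrite !mxE inE; have [->|ji] := eqVneq j i; rewrite ?eqxx /=.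
      by rewrite mulr1 addrC subrK.
    by rewrite ?andbF mulr0 addr0.
  rewrite -(subrKA (g (c S))) (le_trans (ler_normD _ _))// lerD//.
  have cb' : ccube x r (c S + (b ord0 i - c S ord0 i) *: unit i) by rewrite -ciS; exact: cc.
  rewrite ciS; apply: (le_trans (coord_lipschitz (dgP i) (dgl i) (cc S) cb')).
  by rewrite ler_wpM2l// mxE; case: ifP => _ //; rewrite subrr normr0.
have := step (index_enum 'I_n.+1).
have -> // : c (index_enum 'I_n.+1) = b.
by apply/rowP => j; rewrite mxE mem_index_enum.
Qed.

Lemma is_derive_coord i x e : is_derive x e (fun y : V => y ord0 i) (e ord0 i).
Proof.
have -> : x = 0 *: e + x by rewrite scale0r add0r.
apply/is_derive_line.
have -> : (fun r : R => (r *: e + x) ord0 i) = ( *%R^~ (e ord0 i)) + cst (x ord0 i).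
  by apply/funext => r; rewrite !mxE.
rewrite -[X in is_derive _ _ _ X]addr0; apply: is_deriveD.
have := @is_deriveM _ _ id (cst (e ord0 i)) (0 : R) 1 1 0 (is_derive_id _ _) (is_derive_cst _ _ _).
by rewrite scaler0 add0r [_ *: 1]mulr1.
Qed.

(** Without its affine part at y, phi has a gradient of size l N |z| on the cube of half-side
    |z|, hence increments of size l N^2 |z|^2. *)
Lemma second_difference_bound (phi : V -> R) (dphi : 'I_n.+1 -> V -> R)
    (ddphi : 'I_n.+1 -> 'I_n.+1 -> V -> R) x (r l : R) :
  (forall i y, ccube x r y -> is_derive y (unit i) phi (dphi i y)) ->
  (forall i j y, ccube x r y -> is_derive y (unit j) (dphi i) (ddphi i j y)) ->
  (forall i j y, ccube x r y -> `|ddphi i j y| <= l) ->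
  forall y z, enorm (y - x) <= r / 2 -> enorm z <= r / 2 ->
  `|phi (y + z) + phi (y - z) - 2 * phi y| <= 2 * l * n.+1%:R ^+ 2 * enorm z ^+ 2.
Proof.
move=> d1 d2 d2l y z yx zr.
pose N : R := n.+1%:R.
have sub w : ccube y (enorm z) w -> ccube x r w.
  move=> wy i; have yx' := le_trans (coord_le_enorm (y - x) i) yx.
  have := wy i; rewrite !mxE in yx'.
  rewrite !ler_norml in yx' *; move=> /andP[h1 h2]; have /andP[h3 h4] := yx'.
  by apply/andP; split; lra.
have e0 : 0 <= enorm z by exact: enorm_ge0.
have cy : ccube y (enorm z) y by move=> i; rewrite subrr normr0.
have l0 : 0 <= l := le_trans (normr_ge0 _) (d2l ord0 ord0 y (sub _ cy)).
have dl i w : ccube y (enorm z) w -> `|dphi i w - dphi i y| <= l * (N * enorm z).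
  move=> wy; apply: (le_trans (@cube_lipschitz (dphi i) (ddphi i) y (enorm z) l y w _ _ cy wy)).
  - by move=> j v /sub; exact: d2.
  - by move=> j v /sub; exact: d2l.
  - rewrite ler_wpM2l// mulr_natl -[X in _ *+ X]card_ord -sumr_const.
    by apply: ler_sum => j _; exact: wy.
pose g w := phi w - \sum_(i < n.+1) dphi i y * w ord0 i.
have dgP i w : ccube y (enorm z) w -> is_derive w (unit i) g (dphi i w - dphi i y).
  move=> /sub wx; apply: is_deriveB; first exact: d1.
  have -> : (fun w0 : V => \sum_(j < n.+1) dphi j y * w0 ord0 j) =
      \sum_(j < n.+1) (fun w0 : V => dphi j y * w0 ord0 j).
    by apply/funext => w0; rewrite fct_sumE.
  have -> : dphi i y = \sum_(j < n.+1) dphi j y * (unit i) ord0 j.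
    rewrite (bigD1 i)//= mxE !eqxx mulr1 big1 ?addr0// => j ji.
    by rewrite mxE (negbTE ji) andbF mulr0.
  by apply: is_derive_sum => j; apply: (is_deriveZ _ (is_derive_coord _ _ _)).
have taylor v : enorm v = enorm z -> `|g (y + v) - g y| <= l * N ^+ 2 * enorm z ^+ 2.
  move=> vz; have cv : ccube y (enorm z) (y + v).
    by apply: ccube_of_enorm; rewrite addrAC subrr add0r vz.
  apply: (le_trans (cube_lipschitz dgP dl cy cv)).
  have -> : l * N ^+ 2 * enorm z ^+ 2 = l * (N * enorm z) * (N * enorm z) by ring.
  apply: ler_wpM2l; first by rewrite !mulr_ge0.
  rewrite mulr_natl -[X in _ *+ X]card_ord -sumr_const; apply: ler_sum => j _.
  exact: cv.
have t1 := taylor z erefl; have t2 := taylor (- z) (enormN z).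
have -> : phi (y + z) + phi (y - z) - 2 * phi y = (g (y + z) - g y) + (g (y - z) - g y).
  rewrite /g; have -> : \sum_(i < n.+1) dphi i y * (y + z) ord0 i =
      \sum_(i < n.+1) dphi i y * y ord0 i + \sum_(i < n.+1) dphi i y * z ord0 i.
    by rewrite -big_split; apply: eq_bigr => i _; rewrite mxE mulrDr.
  have -> : \sum_(i < n.+1) dphi i y * (y - z) ord0 i =
      \sum_(i < n.+1) dphi i y * y ord0 i - \sum_(i < n.+1) dphi i y * z ord0 i.
    by rewrite -sumrB; apply: eq_bigr => i _; rewrite !mxE mulrDr mulrN.
  by ring.
apply: (le_trans (ler_normD _ _)); apply: (le_trans (lerD t1 t2)).
by rewrite le_eqVlt; apply/orP; left; apply/eqP; rewrite /N; ring.
Qed.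

Variable Omega : set V.
Hypothesis Omega_open : open Omega.

Lemma within_continuous_at (g : V -> R) x : {within Omega, continuous g} -> Omega x ->
  {for x, continuous g}.
Proof. by rewrite continuous_open_subspace// => cg Ox; apply: cg; rewrite inE. Qed.

(** The second partial derivatives are continuous, hence bounded near x. *)
Lemma C2_second_difference phi x : C2_on Omega phi -> Omega x ->
  exists r l : R, [/\ 0 < r, 0 <= l, eball x (2 * r) `<=` Omega &
    forall y z, enorm (y - x) < r -> enorm z < r ->
      `|phi (y + z) + phi (y - z) - 2 * phi y| <= 2 * l * enorm z ^+ 2].
Proof.
move=> [[_ C1] C2] Ox.
have near_x : nbhs x [set y | Omega y /\
    forall i j, `|partial j (partial i phi) y| <= `|partial j (partial i phi) x| + 1].
  apply: filterI; first exact: open_nbhs_nbhs.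
  have H i : nbhs x [set y | forall j, `|partial j (partial i phi) y| <=
      `|partial j (partial i phi) x| + 1].
    have H' j : nbhs x [set y | `|partial j (partial i phi) y| <=
        `|partial j (partial i phi) x| + 1].
      have [_ /(_ j)[_ cj]] := C2 i.
      have [r r0 Hr] := (continuousP_enorm _ _).1 (within_continuous_at cj Ox) 1 ltr01.
      apply/nbhs_eball; exists r => // y /Hr h1 /=.
      have h2 := ler_dist_dist (partial j (partial i phi) y) (partial j (partial i phi) x).
      rewrite -lerBlDl (le_trans (ler_norm _))// (le_trans h2)//.
      exact: ltW.
    exact: filter_forall H'.
  exact: filter_forall H.
have [r0 r00 Hr0] := (nbhs_eball _ _).1 near_x.
pose N : R := n.+1%:R; have N0 : 0 < N by rewrite ltr0n.
(* A cube of half-side r is contained in the ball of radius N r = r0 / 2. *)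
pose r := r0 / (2 * N); have rr0 : 0 < r by rewrite divr_gt0// mulr_gt0.
have N1 : 1 <= N by rewrite ler1n.
have Nr : N * r = r0 / 2 by rewrite /r; field; rewrite gt_eqF.
have cub y : ccube x r y -> eball x r0 y.
  move=> yx; apply: (le_lt_trans (enorm_le_sum _)).
  apply: (@le_lt_trans _ _ (N * r)); last by rewrite Nr ltr_pdivrMr// ltr_pMr// ltr1n.
  rewrite mulr_natl -[X in _ *+ X]card_ord -sumr_const; apply: ler_sum => j _.
  by rewrite !mxE; exact: yx.
pose l := \sum_(i < n.+1) \sum_(j < n.+1) (`|partial j (partial i phi) x| + 1).
have lP i j y : ccube x r y -> `|partial j (partial i phi) y| <= l.
  move=> /cub/Hr0[_ /(_ i j)] h1; apply: (le_trans h1).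
  apply: (@le_trans _ _ (\sum_(j' < n.+1) (`|partial j' (partial i phi) x| + 1))).
    rewrite (bigD1 j isT) /= lerDl; apply: sumr_ge0 => j' _; exact: addr_ge0.
  rewrite /l [leRHS](bigD1 i isT) /= lerDl; apply: sumr_ge0 => i' _.
  by apply: sumr_ge0 => j' _; exact: addr_ge0.
have l0 : 0 <= l.
  by apply: sumr_ge0 => i' _; apply: sumr_ge0 => j' _; exact: addr_ge0.
exists (r / 4), (l * N ^+ 2); split.
- by rewrite divr_gt0.
- by rewrite mulr_ge0// sqr_ge0.
- move=> y; rewrite /eball/= => yx; have [|//] := Hr0 y.
  rewrite /eball/= (lt_le_trans yx)//.
  have : r <= N * r by rewrite ler_peMl// ltW.
  by rewrite Nr; lra.
- move=> y z yx zr; rewrite [2 * (l * _)]mulrA.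
  have r42 (t : R) : t < r / 4 -> t <= r / 2 by move=> *; lra.
  apply: (second_difference_bound (dphi := fun i => partial i phi)
    (ddphi := fun i j => partial j (partial i phi)) (x := x) (r := r)); last 2 first.
  + exact: r42.
  + exact: r42.
  + by move=> i w /cub/Hr0[Ow _]; apply: derivableP; have [+ _] := C1 i; exact.
  + move=> i j w /cub/Hr0[Ow _]; apply: derivableP.
    by have [_ /(_ j)[+ _]] := C2 i; exact.
  + by move=> i j w /lP.
Qed.

End lines.

(** * A calculus of functions of class C2 *)

Section C2calculus.
Context {R : realType} {n : nat}.
Notation V := 'rV[R]_n.+1.
Variable Omega : set V.
Implicit Types (x y z w e : V) (g phi : V -> R) (D E : 'I_n.+1 -> V -> R).
Local Notation unit i := (delta_mx ord0 i : V).

(** Functions of class C1 on Omega, with their partial derivatives as explicit data: sums,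
    products and compositions can then be formed without computing directional limits. *)
Definition C1d phi D := forall x, Omega x -> {for x, continuous phi} /\
  forall i, is_derive x (unit i) phi (D i x) /\ {for x, continuous (D i)}.

Definition C2d phi := exists D, C1d phi D /\ forall i, exists E, C1d (D i) E.

Lemma C1d_cst (c : R) : C1d (fun=> c) (fun _ _ => 0).
Proof.
move=> x _; split; first exact: cst_continuous.
by move=> i; split; [exact: is_derive_cst|exact: cst_continuous].
Qed.

Lemma C1d_coord j : C1d (fun y => y ord0 j) (fun i _ => (unit i) ord0 j).
Proof.
move=> x _; split; first exact: coord_continuous.
by move=> i; split; [exact: is_derive_coord|exact: cst_continuous].
Qed.

Lemma C1d_add f g D E : C1d f D -> C1d g E ->
  C1d (fun x => f x + g x) (fun i x => D i x + E i x).
Proof.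
move=> fD gE x Ox; have [cf df] := fD x Ox; have [cg dg] := gE x Ox.
split; first exact: cvgD cf cg.
move=> i; have [dfi cfi] := df i; have [dgi cgi] := dg i.
by split; [exact: is_deriveD|exact: cvgD cfi cgi].
Qed.

Lemma C1d_mul f g D E : C1d f D -> C1d g E ->
  C1d (fun x => f x * g x) (fun i x => f x * E i x + g x * D i x).
Proof.
move=> fD gE x Ox; have [cf df] := fD x Ox; have [cg dg] := gE x Ox.
split; first exact: cvgM cf cg.
move=> i; have [dfi cfi] := df i; have [dgi cgi] := dg i.
by split; [exact: is_deriveM|exact: cvgD (cvgM cf cgi) (cvgM cg cfi)].
Qed.

Lemma C1d_comp (q q1 : R -> R) f D : C1d f D ->
  (forall x, Omega x -> is_derive (f x) (1 : R) q (q1 (f x))) ->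
  (forall x, Omega x -> {for f x, continuous q1}) ->
  C1d (fun x => q (f x)) (fun i x => q1 (f x) * D i x).
Proof.
move=> fD qd qc x Ox; have [cf df] := fD x Ox.
have cq : {for f x, continuous q}.
  by apply: differentiable_continuous; apply/derivable1_diffP; have [] := qd x Ox.
split; first exact: (continuous_comp cf cq).
move=> i; have [dfi cfi] := df i; split; last first.
  exact: cvgM (continuous_comp cf (qc x Ox)) cfi.
have xE : x = 0 *: unit i + x by rewrite scale0r add0r.
rewrite xE; apply/is_derive_line; rewrite xE in dfi; move/is_derive_line : dfi => dfi.
rewrite -xE in dfi *; apply: (@is_derive1_comp _ q (fun r : R => f (r *: unit i + x))) => //.
by rewrite -xE; exact: qd.
Qed.

Lemma C2d_cst (c : R) : C2d (fun=> c).
Proof.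
exists (fun _ _ => 0); split; first exact: C1d_cst.
by move=> i; exists (fun _ _ => 0); exact: C1d_cst.
Qed.

Lemma C2d_coord j : C2d (fun y => y ord0 j).
Proof.
exists (fun i _ => (unit i) ord0 j); split; first exact: C1d_coord.
by move=> i; exists (fun _ _ => 0); exact: C1d_cst.
Qed.

Lemma C2d_add f g : C2d f -> C2d g -> C2d (fun x => f x + g x).
Proof.
move=> [D [fD DE]] [D' [gD DE']].
exists (fun i x => D i x + D' i x); split; first exact: C1d_add.
move=> i; have [E DEi] := DE i; have [E' DEi'] := DE' i.
by exists (fun j x => E j x + E' j x); exact: C1d_add.
Qed.

Lemma C2d_mul f g : C2d f -> C2d g -> C2d (fun x => f x * g x).
Proof.
move=> [D [fD DE]] [D' [gD DE']].
exists (fun i x => f x * D' i x + g x * D i x); split; first exact: C1d_mul.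
move=> i; have [E DEi] := DE i; have [E' DEi'] := DE' i.
by eexists; apply: C1d_add; [exact: C1d_mul fD DEi'|exact: C1d_mul gD DEi].
Qed.

Lemma C2d_comp (q q1 q2 : R -> R) f : C2d f ->
  (forall x, Omega x -> is_derive (f x) (1 : R) q (q1 (f x))) ->
  (forall x, Omega x -> is_derive (f x) (1 : R) q1 (q2 (f x))) ->
  (forall x, Omega x -> {for f x, continuous q2}) ->
  C2d (fun x => q (f x)).
Proof.
move=> [D [fD DE]] d1 d2 c2.
have c1 x : Omega x -> {for f x, continuous q1}.
  move=> Ox; apply: differentiable_continuous; apply/derivable1_diffP.
  by have [] := d2 x Ox.
exists (fun i x => q1 (f x) * D i x); split; first exact: C1d_comp.
move=> i; have [E DEi] := DE i; eexists; apply: C1d_mul DEi.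
exact: C1d_comp fD d2 c2.
Qed.

Lemma C2d_sum (I : Type) (S : seq I) (F : I -> V -> R) :
  (forall i, C2d (F i)) -> C2d (fun x => \sum_(i <- S) F i x).
Proof.
move=> CF; elim: S => [|i S IH].
  have -> : (fun x => \sum_(i <- [::]) F i x) = fun=> 0.
    by apply/funext => x; rewrite big_nil.
  exact: C2d_cst.
have -> : (fun x => \sum_(j <- i :: S) F j x) = fun x => F i x + \sum_(j <- S) F j x.
  by apply/funext => x; rewrite big_cons.
exact: C2d_add.
Qed.

Lemma C2d_sqr_enorm x : C2d (fun y => enorm (y - x) ^+ 2).
Proof.
have -> : (fun y => enorm (y - x) ^+ 2) =
    fun y => \sum_(i < n.+1) (y ord0 i + - x ord0 i) * (y ord0 i + - x ord0 i).
  by apply/funext => y; rewrite sqr_enorm; apply: eq_bigr => i _; rewrite !mxE expr2.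
apply: C2d_sum => i; apply: C2d_mul; apply: C2d_add; by [exact: C2d_coord|exact: C2d_cst].
Qed.

(** A power of the positive part with exponent at least 2; its derivative at 0 vanishes. *)
Lemma is_derive_pos_part (k : nat) (t : R) :
  is_derive t (1 : R) (fun r : R => Num.max 0 r ^+ k.+2) (k.+2%:R * Num.max 0 t ^+ k.+1).
Proof.
have [t0|t0|->] := ltgtP t 0.
- rewrite expr0n mulr0.
  have ne : \forall r \near t, cst (0 : R) r = Num.max 0 r ^+ k.+2.
    by apply: filterS (lt_nbhsl t0) => r r0; rewrite /= max_l ?ltW// expr0n.
  exact: near_eq_is_derive ne (is_derive_cst _ _ _).
- have ne : \forall r \near t, r ^+ k.+2 = Num.max 0 r ^+ k.+2.
    by apply: filterS (lt_nbhsr t0) => r r0; rewrite /= max_r ?ltW.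
  apply: near_eq_is_derive ne _.
  have := @is_deriveX _ _ id k.+2 t 1 1 (is_derive_id t 1).
  by rewrite [_ *: 1]mulr1 exprfctE.
- rewrite expr0n mulr0.
  have H : h^-1 *: (((fun r : R => Num.max 0 r ^+ k.+2) \o shift 0) (h *: 1) -
      Num.max 0 (0 : R) ^+ k.+2) @[h --> 0^'] --> (0 : R).
    apply/cvgrPdist_le => e e0.
    have : \forall h \near (0 : R)^', `|h| <= Num.min e 1.
      apply: cvg_within; apply/nbhs_ballP; exists (Num.min e 1) => /=.
        by rewrite lt_min e0 ltr01.
      by move=> h; rewrite /ball/= sub0r normrN => /ltW.
    apply: filterS => h; rewrite le_min => /andP[he h1].
    rewrite sub0r normrN maxxx expr0n subr0 /= addr0 [h *: 1]mulr1.
    have mh : `|Num.max 0 h| <= `|h|.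
      by have [h0|h0] := leP h 0; [rewrite normr0|].
    have m0 : 0 <= Num.max 0 h by rewrite le_max lexx.
    rewrite normrM normfV normrX; have [->|hn0] := eqVneq h 0.
      by rewrite normr0 invr0 mul0r ltW.
    rewrite mulrC ler_pdivrMr ?normr_gt0// exprS exprSr mulrA.
    apply: ler_pM; rewrite ?mulr_ge0 ?exprn_ge0//.
    rewrite -[leRHS]mulr1; apply: ler_pM; rewrite ?exprn_ge0//.
      exact: le_trans mh he.
    by apply: exprn_ile1 => //; exact: le_trans mh h1.
  split; first by apply/cvg_ex; exists 0.
  exact: cvg_lim H.
Qed.

(** The simplest function of class C2 that vanishes exactly on a half-line. *)
Definition pcube (t : R) : R := Num.max 0 t ^+ 3.

Lemma C2d_pcube f : C2d f -> C2d (fun x => pcube (f x)).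
Proof.
move=> cf; apply: (C2d_comp (q1 := fun t => 3%:R * Num.max 0 t ^+ 2)
   (q2 := fun t => 3%:R * (2%:R * Num.max 0 t ^+ 1)) cf).
- by move=> x _; exact: (is_derive_pos_part 1).
- move=> x _; apply: (is_deriveZ _ (is_derive_pos_part 0 (f x))).
- move=> x _.
  have cm : {for f x, continuous (fun t : R => Num.max 0 t)}.
    exact: (@continuous_max _ _ (cst 0) id (f x) (cvg_cst _) cvg_id).
  exact: cvgMr (cvgMr cm).
Qed.

Lemma C2d_inv f : C2d f -> (forall x, Omega x -> f x != 0) -> C2d (fun x => (f x)^-1).
Proof.
move=> cf f0; apply: (C2d_comp (q := fun t => t^-1) (q1 := fun t => - (t ^- 2))
   (q2 := fun t => 2%:R * t ^- 3) cf).
- move=> x Ox; have := @is_deriveV _ id (f x) 1 1 (f0 x Ox) (is_derive_id _ _).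
  by rewrite [_ *: 1]mulr1.
- move=> x Ox; have fx := f0 x Ox.
  have h1 := @is_deriveX _ _ id 2 (f x) 1 1 (is_derive_id _ _).
  have fx2 : (id ^+ 2 : R -> R) (f x) != 0 by rewrite exprfctE expf_eq0.
  have := is_deriveN (is_deriveV fx2 h1); rewrite !exprfctE /= => h2.
  have Z (a b : R) : a *: (b : R^o) = a * b by [].
  by apply: (is_derive_eq h2); rewrite /= !Z expr1; field.
- move=> x Ox; have fx := f0 x Ox.
  apply: cvgMr; apply: cvgV; first by rewrite expf_eq0.
  exact: exprn_continuous.
Qed.

Hypothesis Omega_open : open Omega.

Lemma continuous_congr f g x : (forall x, Omega x -> f x = g x) -> Omega x ->
  {for x, continuous f} -> {for x, continuous g}.
Proof.
move=> fg Ox cf; have ne : \forall y \near nbhs x, f y = g y.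
  by apply: filterS (open_nbhs_nbhs (conj Omega_open Ox)) => y; exact: fg.
have : g y @[y --> x] --> f x by exact: cvg_trans (near_eq_cvg ne) cf.
by rewrite fg.
Qed.

Lemma C1d_congr f g D : (forall x, Omega x -> f x = g x) -> C1d f D -> C1d g D.
Proof.
move=> fg fD x Ox; have [cf df] := fD x Ox; split; first exact: continuous_congr cf.
move=> i; have [dfi cfi] := df i; split => //; apply: near_eq_is_derive dfi.
by apply: filterS (open_nbhs_nbhs (conj Omega_open Ox)) => y; exact: fg.
Qed.

Lemma C1d_partial f D i x : C1d f D -> Omega x -> D i x = partial i f x.
Proof. by move=> fD Ox; have [_ /(_ i)[[_ <-] _]] := fD x Ox. Qed.

Lemma C1d_C1 f D : C1d f D -> C1_on Omega f.
Proof.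
move=> fD; have cin g : (forall x, Omega x -> {for x, continuous g}) -> {within Omega, continuous g}.
  by move=> cg; apply: continuous_in_subspaceT => x; rewrite inE; exact: cg.
split; first by apply: cin => x /fD[].
move=> i; split; first by move=> x /fD[_ /(_ i)[[]]].
apply: cin => x Ox; have [_ /(_ i)[_ cD]] := fD x Ox.
by apply: continuous_congr cD => // y Oy; exact: C1d_partial.
Qed.

Lemma C2d_C2 f : C2d f -> C2_on Omega f.
Proof.
move=> [D [fD DE]]; split; first exact: C1d_C1 fD.
move=> i; have [E DEi] := DE i; apply: (C1d_C1 (D := E)).
by apply: C1d_congr DEi => x Ox; exact: C1d_partial.
Qed.

End C2calculus.

(** * The principal value for functions of class C2 *)

Section principal_value.
Context {R : realType} {n : nat}.
Notation V := 'rV[R]_n.+1.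
Notation T := (caratheodory_type (@leb_om R n)).
Variables (s : R) (Omega Sigma : set V) (Om : V -> set V) (h f : V -> R).
Variables (alpha zeta etaf Cf : R).
Hypothesis H : setting s Omega Sigma Om h f alpha zeta etaf Cf.
Implicit Types (x y z w : V) (A : set V) (r rho c l : R) (u v g j phi : V -> R).

Local Notation d := (dist_bdry Omega).
Local Notation k := (ker (@kexp R n s)).
Local Notation L := (nonlocal s Om).
Local Notation p := (@kexp R n s).

Let p0 : 0 < p. Proof. exact: kexp_gt0 (st_s H). Qed.

Variable C0 : R.
Hypothesis C0_gt0 : 0 < C0.
Hypothesis C0_moment : forall rho x r, 0 < rho -> 0 < r ->
  lint (eball x r) (fun w => enorm (x - w) `^ 2 * k rho (x - w)) <= C0 * r `^ (2 - 2 * s).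

(** The integral before the limit in the principal value. It may be infinite: a test
    function need not be integrable near the boundary. *)
Definition truncated rho phi x : \bar R :=
  (\int[leb R n]_(y in Om x `\` eball x rho) ((phi x - phi y) / enorm (x - y) `^ p)%:E)%E.

Lemma LsE phi x : Ls s (Om x) phi x = lim (truncated rho phi x @[rho --> 0^'+]).
Proof. by []. Qed.

Lemma kernel_far rho x y c : ~ eball x rho y -> c / enorm (x - y) `^ p = c * k rho (x - y).
Proof.
move=> yx; have h1 : rho <= enorm (x - y) by rewrite enormB leNgt; exact/negP.
by rewrite (ker_far _ h1) powRN.
Qed.

Lemma leb_measurable_ring x rho : Omega x -> leb_measurable (Om x `\` eball x rho).
Proof.
by move=> Ox; apply: measurableD; [exact: st_meas H _ Ox|exact: leb_measurable_eball].
Qed.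

Lemma measurable_ker A x rho : 0 < rho -> leb_measurable A ->
  measurable_fun (A : set T) (fun w : T => k rho (x - w)).
Proof. by move=> rho0 mA; have [] := bmfun_ker p0 x rho0 mA. Qed.

Lemma truncatedE rho phi x :
  truncated rho phi x =
  (\int[leb R n]_(y in Om x `\` eball x rho) ((phi x - phi y) * k rho (x - y))%:E)%E.
Proof.
by apply: eq_integral => y; rewrite inE => -[_ yx]; rewrite (kernel_far _ yx).
Qed.

Lemma truncated_bounded rho phi x : 0 < rho -> Omega x -> bmfun Omega phi ->
  truncated rho phi x = (lint (Om x `\` eball x rho) (fun y => (phi x - phi y) * k rho (x - y)))%:E.
Proof.
move=> rho0 Ox bphi; rewrite truncatedE unlock /Rintegral fineK//.
apply: integrable_fin_num; first exact: leb_measurable_ring.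
have b := bmfun_Om_ker H x rho0 Ox (bmfun_diff (phi x) bphi).
apply: (bmfun_integrable (finmeasD (finmeas_Om H Ox) (leb_measurable_eball _ _))).
exact: bmfunS (st_meas H Ox) (@subDsetl _ _ _) b.
Qed.

Lemma truncated_nonlocal rho phi x : 0 < rho -> Omega x -> bmfun Omega phi ->
  truncated rho phi x =
  (L rho phi x - lint (Om x `&` eball x rho) (fun y => (phi x - phi y) * k rho (x - y)))%:E.
Proof.
move=> rho0 Ox bphi; rewrite truncated_bounded//; congr _%:E.
have b := bmfun_Om_ker H x rho0 Ox (bmfun_diff (phi x) bphi).
rewrite /nonlocal (lint_split (finmeas_Om H Ox) (leb_measurable_eball x rho) b).
by rewrite addrC addKr.
Qed.

(** phi may fail to be integrable, so positive and negative parts are compared separately. *)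
Lemma le_truncated rho phi u x : 0 < rho -> Omega x -> phi x = u x ->
  (forall y, Omega y -> u y <= phi y) ->
  measurable_fun (Omega : set T) (phi : T -> R) -> measurable_fun (Omega : set T) (u : T -> R) ->
  (truncated rho phi x <= truncated rho u x)%E.
Proof.
move=> rho0 Ox ux uphi mphi mu; rewrite !truncatedE.
set A := Om x `\` eball x rho.
have mA : leb_measurable A := leb_measurable_ring rho Ox.
have AO : A `<=` Omega by move=> y [Oy _]; exact: st_sub H _ Ox _ Oy.
have mO : leb_measurable Omega := open_leb_measurable (st_open H).
have mG g : measurable_fun (Omega : set T) (g : T -> R) ->
    measurable_fun (A : set T) (fun y : T => ((g x - g y) * k rho (x - y))%:E).
  move=> mg; apply/measurable_EFinP; apply: measurable_funM; last exact: measurable_ker.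
  apply: measurable_funB; first exact: measurable_cst.
  exact: measurable_funS mg.
have le1 y : A y -> (((phi x - phi y) * k rho (x - y))%:E <= ((u x - u y) * k rho (x - y))%:E)%E.
  move=> Ay; rewrite lee_fin ler_wpM2r ?ker_ge0// ux lerD2l lerN2.
  by apply: uphi; exact: AO.
rewrite integralE [leRHS]integralE; apply: leeB.
  apply: ge0_le_integral; first exact: mA.
  - by move=> y _; exact: funepos_ge0.
  - exact: measurable_funepos (mG phi mphi).
  - exact: measurable_funepos (mG u mu).
  - by move=> y Ay; apply: (@funepos_le _ _ A) => [z|]; rewrite inE//; exact: le1.
apply: ge0_le_integral; first exact: mA.
- by move=> y _; exact: funeneg_ge0.
- exact: measurable_funeneg (mG u mu).
- exact: measurable_funeneg (mG phi mphi).
- by move=> y Ay; apply: (@funeneg_le _ _ A) => [z|]; rewrite inE//; exact: le1.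
Qed.

Lemma bmfun_cutoff_ker A x rho : 0 < rho -> leb_measurable A ->
  bmfun A (fun w => (rho <= enorm (x - w))%R%:R * k rho (x - w)).
Proof.
move=> rho0 mA; apply: bmfunM; last exact: bmfun_ker p0 _ _ _ rho0 mA.
split; last by exists 1 => w _; rewrite ger0_norm ?ler0n// lern1 leq_b1.
have -> : (fun w => (rho <= enorm (x - w))%R%:R) = \1_(~` eball x rho) :> (V -> R).
  apply/funext => w; rewrite indicE enormB leNgt; congr (nat_of_bool _)%:R.
  by apply/negP/idP; rewrite inE.
by apply: measurable_indic; apply: measurableC; exact: leb_measurable_eball.
Qed.

(** By symmetry of Sigma the integral over a ring around x involves only second differences
    of phi; this holds for the two signs. *)
Lemma ring_bound x rho rho' l phi : Omega x -> 0 < rho' -> rho' <= rho -> rho <= zeta * d x ->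
  bmfun (Om x `&` eball x rho) phi -> 0 <= l ->
  (forall z, enorm z < rho -> `|phi (x + z) + phi (x - z) - 2 * phi x| <= 2 * l * enorm z ^+ 2) ->
  `|lint ((Om x `&` eball x rho) `\` eball x rho') (fun y => (phi x - phi y) * k rho' (x - y))|
    <= l * C0 * rho `^ (2 - 2 * s).
Proof.
move=> Ox r'0 rr rx bphi l0 hphi; have r0 := lt_le_trans r'0 rr.
set A := Om x `&` eball x rho.
have fA : finmeas A := finmeasI (finmeas_Om H Ox) (leb_measurable_eball _ _).
have mA : leb_measurable A by case: fA.
pose j z := (rho' <= enorm z)%R%:R * k rho' z.
have bj : bmfun A (fun w => j (x - w)) := bmfun_cutoff_ker x r'0 mA.
have jN z : j (- z) = j z by rewrite /j enormN kerN.
have jk z : 0 <= j z <= k rho' z.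
  by rewrite /j; have [_|_] := leP rho' (enorm z); rewrite ?mul0r ?mul1r ?lexx ?ker_ge0.
have mC : leb_measurable (~` eball x rho') by apply: measurableC; exact: leb_measurable_eball.
have E g : bmfun A g -> lint (A `\` eball x rho') (fun y => (g x - g y) * k rho' (x - y)) =
    lint A (fun y => (g x - g y) * j (x - y)).
  move=> bg; have bgj := bmfunM (bmfun_diff (g x) bg) bj.
  rewrite (lint_support fA mC bgj) -?setDE; last first.
    move=> y _ /contrapT; rewrite /eball/= enormB => yx.
    by rewrite /j leNgt yx mul0r mulr0.
  apply: eq_lint => y [_ yx]; rewrite /j.
  have -> : rho' <= enorm (x - y) by rewrite enormB leNgt; exact/negP.
  by rewrite mul1r.
have lower := near_lower_bound H C0_moment Ox r'0 r0 rx bphi l0 _ bj jN jk.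
have bNphi := bmfunN bphi.
have upper := near_lower_bound H C0_moment Ox r'0 r0 rx bNphi l0 _ bj jN jk.
rewrite (E phi bphi) ler_norml; apply/andP; split.
  apply: lower => z _ _ /hphi; rewrite ler_norml => /andP[_ h1].
  by rewrite lerNl; apply: le_trans h1; rewrite le_eqVlt; apply/orP; left; apply/eqP; ring.
rewrite -lerN2; apply: le_trans (upper _) _.
  move=> z _ _ /hphi; rewrite ler_norml => /andP[h1 _].
  by apply: (le_trans h1); rewrite le_eqVlt; apply/orP; left; apply/eqP; ring.
have bgj := bmfunM (bmfun_diff (phi x) bphi) bj.
rewrite -[leRHS]mulN1r -(lintZ _ fA bgj) le_eqVlt; apply/orP; left; apply/eqP.
by apply: eq_lint => y _; ring.
Qed.

Lemma ball_upper x rho l phi : Omega x -> 0 < rho -> rho <= zeta * d x ->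
  bmfun (Om x `&` eball x rho) phi -> 0 <= l ->
  (forall z, Om x (x - z) -> Om x (x + z) -> enorm z < rho ->
     (phi x - phi (x - z)) + (phi x - phi (x + z)) <= 2 * l * enorm z ^+ 2) ->
  lint (Om x `&` eball x rho) (fun y => (phi x - phi y) * k rho (x - y)) <= l * C0 * rho `^ (2 - 2 * s).
Proof.
move=> Ox r0 rx bphi l0 hphi; set A := Om x `&` eball x rho.
have fA : finmeas A := finmeasI (finmeas_Om H Ox) (leb_measurable_eball _ _).
have mA : leb_measurable A by case: fA.
have bk : bmfun A (fun w => k rho (x - w)) := bmfun_ker p0 x r0 mA.
have jN z : k rho (- z) = k rho z by exact: kerN.
have jk z : 0 <= k rho z <= k rho z by rewrite ker_ge0 lexx.
have upper := near_lower_bound H C0_moment Ox r0 r0 rx (bmfunN bphi) l0 _ bk jN jk.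
rewrite -lerN2; apply: le_trans (upper _) _.
- move=> z Oz Oz' zr; have := hphi z Oz Oz' zr.
  by rewrite -lerN2 => h1; apply: (le_trans h1); rewrite le_eqVlt; apply/orP; left; apply/eqP; ring.
- have bgj := bmfunM (bmfun_diff (phi x) bphi) bk.
  rewrite -[leRHS]mulN1r -(lintZ _ fA bgj) le_eqVlt; apply/orP; left; apply/eqP.
  by apply: eq_lint => y _; ring.
Qed.

Lemma truncated_split rho r phi x : 0 < rho -> rho <= r -> Omega x ->
  measurable_fun (Omega : set T) (phi : T -> R) -> bmfun (Om x `&` eball x r) phi ->
  truncated rho phi x = (truncated r phi x +
    (lint ((Om x `&` eball x r) `\` eball x rho) (fun y => (phi x - phi y) * k rho (x - y)))%:E)%E.
Proof.
move=> rho0 rr Ox mphi bphi; have r0 := lt_le_trans rho0 rr.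
set B := (Om x `&` eball x r) `\` eball x rho.
have mO : leb_measurable Omega := open_leb_measurable (st_open H).
have fI : finmeas (Om x `&` eball x r) := finmeasI (finmeas_Om H Ox) (leb_measurable_eball _ _).
have fB : finmeas B := finmeasD fI (leb_measurable_eball _ _).
have mB : leb_measurable B by case: fB.
have mI : leb_measurable (Om x `&` eball x r) by case: fI.
have mA rho1 : leb_measurable (Om x `\` eball x rho1) := leb_measurable_ring rho1 Ox.
have AU : Om x `\` eball x rho = (Om x `\` eball x r) `|` B.
  apply/seteqP; split => [y [Oy yx]|y [[Oy yx]|[[Oy _] yx]]]; last by [].
    have [yr|yr] := pselect (eball x r y); first by right; split.
    by left.
  by split => // yx'; apply: yx; rewrite /eball/= in yx' *; exact: lt_le_trans rr.
have bG : bmfun B (fun y => (phi x - phi y) * k rho (x - y)).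
  apply: bmfunM (bmfun_diff _ _) (bmfun_ker p0 x rho0 mB).
  exact: bmfunS mI (@subDsetl _ _ _) bphi.
have mG : measurable_fun ((Om x `\` eball x rho) : set T)
    (fun y : T => ((phi x - phi y) * k rho (x - y))%:E).
  apply/measurable_EFinP; apply: measurable_funM; last exact: measurable_ker.
  apply: measurable_funB; first exact: measurable_cst.
  by apply: measurable_funS mphi => // y [/(st_sub H Ox)].
rewrite truncatedE AU integral_setU; last 4 first.
- exact: mA.
- exact: mB.
- by rewrite -AU.
- by apply/disj_setPS => y [[_ ?] [[_ ?] _]].
congr (_ + _)%E; last first.
  rewrite unlock /Rintegral fineK//; apply: integrable_fin_num; first exact: mB.
  exact: bmfun_integrable fB bG.
apply: eq_integral => y; rewrite inE => -[_ yx]; rewrite -(kernel_far (rho := rho))//.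
by move=> yr; apply: yx; rewrite /eball/= in yr *; exact: lt_le_trans rr.
Qed.

Lemma C2_local phi x : C2_on Omega phi -> Omega x -> exists r l, [/\ 0 < r /\ r <= zeta * d x, 0 <= l,
  bmfun (Om x `&` eball x r) phi, measurable_fun (Omega : set T) (phi : T -> R) &
  forall z, enorm z < r -> `|phi (x + z) + phi (x - z) - 2 * phi x| <= 2 * l * enorm z ^+ 2].
Proof.
move=> Cphi Ox; have oO := st_open H.
have [r1 [l [r10 l0 r1O H1]]] := C2_second_difference oO Cphi Ox.
have cphi : {in Omega, continuous phi}.
  by case: Cphi => -[+ _] _; rewrite continuous_open_subspace.
have [r2 r20 H2] := (continuousP_enorm _ _).1 (cphi x (mem_set Ox)) _ ltr01.
have zd : 0 < zeta * d x by rewrite mulr_gt0 ?(st_zeta H) ?(st_dist H).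
have mphi : measurable_fun (Omega : set T) (phi : T -> R) := continuous_leb_measurable_fun oO cphi.
exists (Num.min r1 (Num.min r2 (zeta * d x))), l; split => //.
- by rewrite !lt_min r10 r20 !ge_min lexx !orbT.
- split.
    by apply: measurable_funS mphi; [exact: open_leb_measurable|move=> y [/(st_sub H Ox)]].
  exists (`|phi x| + 1) => y [_]; rewrite /eball/= !lt_min => /and3P[_ /H2 h2 _].
  rewrite -lerBlDl; apply: le_trans (ltW h2).
  by rewrite (le_trans (ler_norm _))// ler_dist_dist.
- by move=> z; rewrite !lt_min => /and3P[zr _ _]; apply: H1 => //; rewrite subrr enorm0.
Qed.

(** The integral away from x is a fixed extended real number, and the integrals over the
    rings that are added as rho decreases form a Cauchy family. *)
Lemma truncated_cvg phi x : C2_on Omega phi -> Omega x ->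
  cvg (truncated rho phi x @[rho --> (0 : R)^'+]).
Proof.
move=> Cphi Ox; have [r [l [[r0 rx] l0 bphi mphi hphi]]] := C2_local Cphi Ox.
have /andP[s0 s1] := st_s H; have q0 : 0 < 2 - 2 * s by lra.
set A := Om x `&` eball x r in bphi.
pose N rho := lint (A `\` eball x rho) (fun y => (phi x - phi y) * k rho (x - y)).
have fA : finmeas A := finmeasI (finmeas_Om H Ox) (leb_measurable_eball _ _).
have mA : leb_measurable A by case: fA.
have Nd rho rho' : 0 < rho' -> rho' <= rho -> rho <= r ->
    `|N rho' - N rho| <= l * C0 * rho `^ (2 - 2 * s).
  move=> r'0 rr rler; have rho0 := lt_le_trans r'0 rr.
  have sub : Om x `&` eball x rho `<=` A.
    by move=> y [Oy yr]; split => //; rewrite /eball/= in yr *; exact: lt_le_trans rler.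
  have mAr : leb_measurable (Om x `&` eball x rho).
    by case: (finmeasI (finmeas_Om H Ox) (leb_measurable_eball x rho)).
  have h1 := ring_bound Ox r'0 rr (le_trans rler rx) (bmfunS mA sub bphi) l0
    (fun z zr => hphi z (lt_le_trans zr rler)).
  apply: le_trans h1; rewrite /N.
  have fD : finmeas (A `\` eball x rho') := finmeasD fA (leb_measurable_eball _ _).
  have mD : leb_measurable (A `\` eball x rho') by case: fD.
  have bG : bmfun (A `\` eball x rho') (fun y => (phi x - phi y) * k rho' (x - y)).
    apply: bmfunM (bmfun_diff _ _) (bmfun_ker p0 x r'0 mD).
    exact: bmfunS mA (@subDsetl _ _ _) bphi.
  rewrite (lint_split fD (leb_measurable_eball x rho) bG).
  have -> : (A `\` eball x rho') `&` eball x rho = (Om x `&` eball x rho) `\` eball x rho'.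
    apply/seteqP; split => [y [[[Oy _] ?] ?]//|y [[Oy yr] ?]]; split => //; split => //; split => //.
    by rewrite /eball/= in yr *; exact: lt_le_trans rler.
  have -> : (A `\` eball x rho') `\` eball x rho = A `\` eball x rho.
    apply/seteqP; split => [y [[? _] ?]//|y [Ay yr]]; split => //; split => // yr'.
    by apply: yr; rewrite /eball/= in yr' *; exact: lt_le_trans rr.
  rewrite [X in _ + X - _](@eq_lint _ _ _ _ (fun y => (phi x - phi y) * k rho (x - y))) ?addrK//.
  move=> y [_ yr]; rewrite -(kernel_far _ yr) -(kernel_far (rho := rho'))// => yr'.
  by apply: yr; rewrite /eball/= in yr' *; exact: lt_le_trans rr.
have Ncvg : cvg (N rho @[rho --> (0 : R)^'+]).
  apply/cauchy_cvgP/cauchy_ballP => e e0.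
  have lC : 0 < l * C0 + 1 by rewrite ltr_pwDr// mulr_ge0// ltW.
  have [t t0 Ht] := small_power q0 (divr_gt0 e0 (mulr_gt0 (ltr0n R 2) lC)).
  pose t' := Num.min t r; have t'0 : 0 < t' by rewrite lt_min t0.
  exists ([set N rho | rho in `]0, t']%classic], [set N rho | rho in `]0, t']%classic]) => /=.
    have near0 : \forall rho \near (0 : R)^'+, `]0, t']%classic rho.
      near=> rho; rewrite /= in_itv/=; apply/andP; split.
        by near: rho; exact: nbhs_right_gt.
      by near: rho; exact: nbhs_right_le.
    by split; apply: filterS near0 => rho ?; exists rho.
  move=> [_ _] /= [[a +] <-] [b + <-]; rewrite !in_itv/= => /andP[a0 ar] /andP[b0 br].
  rewrite /ball/=; wlog ab : a b a0 ar b0 br / a <= b => [hw|].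
    by have [/hw|/ltW/hw] := leP a b; [exact|rewrite distrC; exact].
  have bt : b <= t by rewrite (le_trans br)// ge_min lexx.
  have br' : b <= r by rewrite (le_trans br)// ge_min lexx orbT.
  apply: (le_lt_trans (Nd b a a0 ab br')).
  have := Ht b b0 bt; rewrite ler_pdivlMr ?mulr_gt0// => h1.
  have bq0 : 0 <= b `^ (2 - 2 * s) by exact: powR_ge0.
  have h2 : 0 <= l * C0 by rewrite mulr_ge0// ltW.
  have h3 : l * C0 * b `^ (2 - 2 * s) <= (l * C0 + 1) * b `^ (2 - 2 * s).
    by rewrite ler_wpM2r// lerDl.
  apply: (le_lt_trans h3); rewrite mulrC.
  move: h1; rewrite mulrA [_ * 2]mulrC -mulrA; move: (_ * (l * C0 + 1)) e0 => m; lra.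
have E : \forall rho \near (0 : R)^'+, (truncated r phi x + (N rho)%:E = truncated rho phi x)%E.
  near=> rho; have rho0 : 0 < rho by near: rho; exact: nbhs_right_gt.
  have rr : rho <= r by near: rho; exact: nbhs_right_le.
  by rewrite (truncated_split rho0 rr Ox mphi bphi).
have : cvg ((truncated r phi x + (N rho)%:E)%E @[rho --> (0 : R)^'+]).
  apply/cvg_ex; exists (truncated r phi x + (lim (N rho @[rho --> (0 : R)^'+]))%:E)%E.
  apply: cvgeD; first by rewrite fin_num_adde_defl.
    exact: cvg_cst.
  by apply: cvg_EFin; [exact: nearW|exact: Ncvg].
move=> /cvg_ex[a ca]; apply/cvg_ex; exists a.
exact: cvg_trans (near_eq_cvg E) ca.
Unshelve. all: by end_near. Qed.

End principal_value.

(** * The limit is a viscosity solution *)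

Section stability.
Context {R : realType} {n : nat}.
Notation V := 'rV[R]_n.+1.
Variables (s : R) (Omega Sigma : set V) (Om : V -> set V) (h f : V -> R).
Variables (alpha zeta etaf Cf : R).
Hypothesis H : setting s Omega Sigma Om h f alpha zeta etaf Cf.
Implicit Types (x y z w : V) (A : set V) (r rho c l : R) (u v g j phi : V -> R).

Local Notation d := (dist_bdry Omega).
Local Notation k := (ker (@kexp R n s)).
Local Notation L := (nonlocal s Om).
Local Notation p := (@kexp R n s).

Let p0 : 0 < p. Proof. exact: kexp_gt0 (st_s H). Qed.

Variable C0 : R.
Hypothesis C0_gt0 : 0 < C0.
Hypothesis C0_moment : forall rho x r, 0 < rho -> 0 < r ->
  lint (eball x r) (fun w => enorm (x - w) `^ 2 * k rho (x - w)) <= C0 * r `^ (2 - 2 * s).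

Lemma compact_closed_eball x (a : R) : compact [set y | enorm (y - x) <= a].
Proof.
apply: bounded_closed_compact.
  exists (enorm x + a); split; first exact: num_real.
  move=> M aM y /= yx; apply: (le_trans (mx_norm_le_enorm y)).
  have := enormD (y - x) x; rewrite subrK => h1; apply: (le_trans h1).
  by apply: ltW; apply: le_lt_trans aM; rewrite addrC lerD2l.
have -> : [set y | enorm (y - x) <= a] = (fun y => enorm (x - y)) @^-1` [set t | t <= a].
  by apply/seteqP; split => y /=; rewrite enormB.
by apply: preimage_closed; [move=> y _; exact: continuous_enormB|exact: closed_le].
Qed.

Lemma nonlocal_stable r x u v (e : R) : 0 < r -> Omega x -> bmfun Omega u -> bmfun Omega v ->
  0 <= e -> (forall w, Omega w -> `|u w - v w| <= e) ->
  L r v x <= L r u x + 2 * e * (r `^ (- p) * vol Omega).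
Proof.
move=> r0 Ox bu bv e0 uv; have fO := finmeas_Om H Ox.
have bu' := bmfun_Om_ker H x r0 Ox (bmfun_diff (u x) bu).
have bv' := bmfun_Om_ker H x r0 Ox (bmfun_diff (v x) bv).
rewrite -lerBlDl /nonlocal -(lintB fO bv' bu').
apply: (le_trans (ler_norm _)).
apply: (@le_trans _ _ (2 * e * r `^ (- p) * vol (Om x))).
  apply: (norm_lint_le_cst fO (bmfunB bv' bu')) => w Ow.
  rewrite -mulrBl normrM; apply: ler_pM; [exact: normr_ge0|exact: normr_ge0| |exact: (ker_norm_le p0 _ r0)].
  have -> : v x - v w - (u x - u w) = (u w - v w) - (u x - v x) by ring.
  apply: (le_trans (ler_normB _ _)); rewrite mulr_natl mulr2n.
  by apply: lerD; apply: uv => //; exact: st_sub H _ Ox _ Ow.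
rewrite -mulrA ler_wpM2l ?mulr_ge0// ler_wpM2l ?powR_ge0//.
exact: le_vol (st_meas H Ox) (Omega_finmeas (st_open H) (st_bounded H)) (st_sub H Ox).
Qed.

Lemma nonlocal_continuous r u : 0 < r -> {in Omega, continuous u} -> bmfun Omega u ->
  {in Omega, continuous (L r u)}.
Proof.
move=> r0 cu bu x xO; have Ox : Omega x by rewrite inE in xO.
apply: (@continuous_congr _ _ _ (st_open H) (fun x => u x * mass s Om r x - conv s Om r u x)) => //.
  by move=> y Oy; rewrite (nonlocalE H r0 Oy bu).
exact: cvgB (cvgM (cu x xO) (mass_continuous H r0 xO)) (conv_continuous H r0 bu xO).
Qed.

Variables (g : V -> R) (U : R -> V -> R) (u : V -> R) (M : R).
Hypothesis cg : {in Omega, continuous g}.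
Hypothesis cU : forall rho, 0 < rho -> {in Omega, continuous (U rho)}.
Hypothesis bU : forall rho, 0 < rho -> forall x, Omega x -> `|U rho x| <= M.
Hypothesis eqU : forall rho, 0 < rho -> forall x, Omega x -> h x * U rho x + L rho (U rho) x = g x.
Hypothesis cu : {in Omega, continuous u}.
Hypothesis bu : forall x, Omega x -> `|u x| <= M.
Hypothesis limU : forall kap, 0 < kap -> exists2 r : R, 0 < r &
  forall rho, 0 < rho -> rho <= r -> forall x, Omega x -> `|U rho x - u x| <= kap.

Let bmu : bmfun Omega u := continuous_bounded_bmfun H cu bu.

(** The term |w-x|^2 makes the contact strict, so that the perturbed maximum over the small
    ball is a maximum over all of Omega. *)
Lemma touching_max phi x (a kap rho : R) : C2_on Omega phi -> Omega x -> u x = phi x ->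
  (forall y, Omega y -> u y <= phi y) -> 0 < a -> [set y | enorm (y - x) <= a] `<=` Omega ->
  2 * kap < a ^+ 2 -> 0 < rho -> (forall y, Omega y -> `|U rho y - u y| <= kap) ->
  exists2 y, enorm (y - x) <= a & forall w, Omega w ->
    U rho w - (phi w + enorm (w - x) ^+ 2) <= U rho y - (phi y + enorm (y - x) ^+ 2).
Proof.
move=> Cphi Ox ux uphi a0 aO ka rho0 Uk.
pose F w := U rho w - (phi w + enorm (w - x) ^+ 2).
have cphi : {in Omega, continuous phi}.
  by case: Cphi => -[+ _] _; rewrite continuous_open_subspace//; exact: st_open H.
have [y yB ymax] : exists2 y, y \in [set y | enorm (y - x) <= a] &
    forall t, t \in [set y | enorm (y - x) <= a] -> F t <= F y.
  apply: compact_EVT_max.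
  - by exists x; rewrite /= subrr enorm0 ltW.
  - exact: compact_closed_eball.
  - apply: continuous_in_subspaceT => y; rewrite inE => /aO Oy.
    have yO : y \in Omega by rewrite inE.
    have c2 : {for y, continuous (fun w => enorm (w - x) ^+ 2)}.
      have -> : (fun w => enorm (w - x) ^+ 2) = fun w => enorm (x - w) ^+ 2.
        by apply/funext => w; rewrite enormB.
      by apply: (@continuous_comp _ _ _ (fun w => enorm (x - w)) (fun t => t ^+ 2));
          [exact: continuous_enormB|exact: exprn_continuous].
    exact: cvgB (cU rho0 yO) (cvgD (cphi y yO) c2).
rewrite inE/= in yB; exists y => // w Ow.
have [wa|wa] := leP (enorm (w - x)) a; first by apply: ymax; rewrite inE.
have Fx : F x <= F y by apply: ymax; rewrite inE/= subrr enorm0 ltW.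
apply: le_trans Fx; rewrite /F subrr enorm0 expr0n addr0.
have := Uk w Ow; have := Uk x Ox; have := uphi w Ow; rewrite -ux !ler_norml.
have : a ^+ 2 <= enorm (w - x) ^+ 2.
  by rewrite lerXn2r ?nnegrE ?enorm_ge0 ?(ltW a0)// ltW.
move: (enorm _ ^+ 2) (a ^+ 2) ka => b b' kb ? ? /andP[? ?] /andP[? ?].
lra.
Qed.

(** At the maximum point y the capped solution is touched from above by phi + |.-x|^2, whose
    second differences are at most 2 (l + 1) |z|^2: the capped equation at y gives the
    inequality at scale r for the capped solution. Then rho tends to 0 and y to x. *)
Lemma limit_scale phi x r r1 l : C2_on Omega phi -> Omega x -> u x = phi x ->
  (forall y, Omega y -> u y <= phi y) -> 0 <= l -> 0 < r -> r < r1 -> r <= zeta * (d x / 2) ->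
  (forall y z, enorm (y - x) < r1 -> enorm z < r1 ->
      `|phi (y + z) + phi (y - z) - 2 * phi y| <= 2 * l * enorm z ^+ 2) ->
  h x * u x + L r u x <= g x + (l + 1) * C0 * r `^ (2 - 2 * s).
Proof.
move=> Cphi Ox ux uphi l0 r0 rr1 rx hphi.
have xO : x \in Omega by rewrite inE.
have dx := st_dist H Ox; have b0 := dist_gt0_bdry_nonempty dx.
set E := _ * C0 * _.
apply/ler_addgt0Pl => e e0.
pose G y := h y * u y + L r u y - g y.
have cG : {for x, continuous G}.
  exact: cvgB (cvgD (cvgM (st_h H xO) (cu xO)) (nonlocal_continuous r0 cu bmu xO)) (cg xO).
have [a1 a10 H1] := (continuousP_enorm _ _).1 cG _ (divr_gt0 e0 (ltr0n R 2)).
have [a2 a20 H2] := (continuousP_enorm _ _).1 (st_h H xO) _ ltr01.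
have : nbhs x Omega by apply: open_nbhs_nbhs; split => //; exact: st_open H.
move=> /nbhs_eball[a3 a30 H3].
pose a := Num.min (Num.min a1 a2) (Num.min a3 (Num.min r1 (d x / 2))) / 2.
have m0 : 0 < Num.min (Num.min a1 a2) (Num.min a3 (Num.min r1 (d x / 2))).
  by rewrite !lt_min a10 a20 a30 (lt_trans r0 rr1) divr_gt0.
have a0 : 0 < a by rewrite divr_gt0.
have [aa1 aa2 aa3 aar ad] : [/\ a < a1, a < a2, a < a3, a < r1 & a < d x / 2].
  have : a < Num.min (Num.min a1 a2) (Num.min a3 (Num.min r1 (d x / 2))).
    by rewrite /a ltr_pdivrMr// ltr_pMr// ltr1n.
  by rewrite !lt_min => /andP[/andP[? ?] /and3P[? ? ?]].
have aO : [set y | enorm (y - x) <= a] `<=` Omega.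
  by move=> y /= ya; apply: H3; exact: le_lt_trans ya aa3.
have hx0 : 0 < h x := h_gt0 H Ox.
pose B := h x + 1 + 2 * (r `^ (- p) * vol Omega).
have rv0 : 0 <= r `^ (- p) * vol Omega by rewrite mulr_ge0 ?powR_ge0 ?vol_ge0.
have B0 : 0 < B by rewrite /B; lra.
(* The first bound makes the maximum over the ball of radius a a maximum over Omega, the
   second controls the passage from the capped solution to u. *)
pose kap := Num.min (a ^+ 2 / 3) (e / 2 / B).
have kap0 : 0 < kap by rewrite lt_min !divr_gt0// exprn_gt0.
have ka : 2 * kap < a ^+ 2.
  have : kap <= a ^+ 2 / 3 by rewrite ge_min lexx.
  have : 0 < a ^+ 2 by rewrite exprn_gt0.
  by move: (a ^+ 2) => *; lra.
have kB : kap * B <= e / 2 by rewrite -ler_pdivlMr// ge_min lexx orbT.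
have [r2 r20 Hr2] := limU kap0.
pose rho := Num.min r2 r; have rho0 : 0 < rho by rewrite lt_min r20.
have rhor : rho <= r by rewrite ge_min lexx orbT.
have Uk y : Omega y -> `|U rho y - u y| <= kap by apply: Hr2 => //; rewrite ge_min lexx.
have [y ya ymax] := touching_max Cphi Ox ux uphi a0 aO ka rho0 Uk.
have Oy : Omega y by exact: aO.
have bmU : bmfun Omega (U rho) := continuous_bounded_bmfun H (cU rho0) (bU rho0).
have dy : d x / 2 <= d y.
  by have := dist_lipschitz x y b0; have := le_lt_trans ya ad; rewrite (enormB y x); lra.
have ry : r <= zeta * d y.
  by apply: (le_trans rx); rewrite ler_wpM2l ?(ltW (st_zeta H)).
have sd z : Omega (y - z) -> Omega (y + z) -> enorm z < r ->
    - (2 * (l + 1) * enorm z ^+ 2) <= (U rho y - U rho (y - z)) + (U rho y - U rho (y + z)).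
  move=> O1 O2 zr; have t1 := ymax _ O1; have t2 := ymax _ O2.
  have par := enorm_parallelogram (y - x) z.
  have e1 : y - z - x = y - x - z by rewrite addrAC.
  have e2 : y + z - x = y - x + z by rewrite addrAC.
  rewrite e1 in t1; rewrite e2 in t2.
  have := hphi y z (le_lt_trans ya aar) (lt_trans zr rr1); rewrite ler_norml => /andP[_ h1].
  have par' : enorm (y - x + z) ^+ 2 = 2 * enorm (y - x) ^+ 2 + 2 * enorm z ^+ 2 - enorm (y - x - z) ^+ 2.
    by rewrite -par; ring.
  rewrite par' in t2; move: t1 t2 h1 => {ymax par par' e1 e2 hphi}.
  rewrite mulrDr mulr1 mulrDl.
  move: (enorm (y - x) ^+ 2) (enorm (y - x - z) ^+ 2) (enorm z ^+ 2) (2 * l * _) => A B' Z lZ.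
  move: (U rho y) (U rho (y - z)) (U rho (y + z)) (phi y) (phi (y - z)) (phi (y + z)) => *.
  lra.
have l1 : 0 <= l + 1 by rewrite addr_ge0.
have sc := nonlocal_scale H C0_moment Oy rho0 rhor ry bmU l1 sd; rewrite -/E in sc.
have st := nonlocal_stable r0 Oy bmU bmu (ltW kap0) Uk.
have eqy := eqU rho0 Oy.
have hy : h y <= h x + 1.
  have := H2 y (le_lt_trans ya aa2); rewrite ltr_norml => /andP[_ ?]; lra.
have hy0 := h_gt0 H Oy.
have hu : h y * u y <= h y * U rho y + (h x + 1) * kap.
  rewrite -lerBlDl -mulrBr (le_trans (ler_norm _))// normrM distrC.
  by apply: ler_pM => //; [rewrite gtr0_norm|exact: Uk].
have Gy : G y <= E + e / 2.
  apply: le_trans (_ : _ <= E + kap * B) _; last by rewrite lerD2l.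
  rewrite /G -eqy; have -> : kap * B = (h x + 1) * kap + 2 * kap * (r `^ (- p) * vol Omega).
    by rewrite /B; ring.
  by move: sc st hu; move: (_ * vol _) => *; lra.
have -> : h x * u x + L r u x = G x + g x by rewrite /G subrK.
have := H1 y (le_lt_trans ya aa1); rewrite ltr_norml => /andP[+ _].
by move: (G x) (G y) Gy => Gx Gy' *; lra.
Qed.

(** The truncated integrals of phi are below those of u, and these differ from L_rho u by an
    integral over a small ball that the second differences of phi bound from below. *)
Lemma limit_visc_sub phi x : Omega x -> C2_on Omega phi -> u x = phi x ->
  (forall y, Omega y -> u y <= phi y) ->
  ((h x * phi x)%:E + Ls s (Om x) phi x <= (g x)%:E)%E.
Proof.
move=> Ox Cphi ux uphi; have oO := st_open H.
have /andP[s0 s1] := st_s H; have q0 : 0 < 2 - 2 * s by lra.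
have dx := st_dist H Ox; have zd : 0 < zeta * (d x / 2).
  by rewrite mulr_gt0 ?(st_zeta H)// divr_gt0.
have cphi : {in Omega, continuous phi}.
  by case: Cphi => -[+ _] _; rewrite continuous_open_subspace.
have mphi := continuous_leb_measurable_fun oO cphi.
have mu := continuous_leb_measurable_fun oO cu.
have [r1 [l [r10 l0 r1O H1]]] := C2_second_difference oO Cphi Ox.
pose K := 2 * (l + 1) * C0; have K0 : 0 < K.
  by rewrite !mulr_gt0// ltr_pwDr.
suff : (Ls s (Om x) phi x <= (g x - h x * u x)%:E)%E.
  by rewrite ux EFinB leeBrDl.
apply/lee_addgt0Pr => e e0; rewrite -EFinD.
have [t t0 Ht] := small_power q0 (divr_gt0 e0 K0).
rewrite LsE; apply: (lime_le (truncated_cvg H C0_gt0 C0_moment Cphi Ox)).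
near=> rho; have rho0 : 0 < rho by near: rho; exact: nbhs_right_gt.
have rr1 : rho < r1 by near: rho; exact: nbhs_right_lt.
have rz : rho <= zeta * (d x / 2) by near: rho; exact: nbhs_right_le.
have rt : rho <= t by near: rho; exact: nbhs_right_le.
have rz' : rho <= zeta * d x.
  by apply: (le_trans rz); rewrite ler_wpM2l ?(ltW (st_zeta H))//; lra.
apply: (le_trans (le_truncated H rho0 Ox (esym ux) uphi mphi mu)).
rewrite (truncated_nonlocal H rho0 Ox bmu) lee_fin.
have up := limit_scale Cphi Ox ux uphi l0 rho0 rr1 rz H1.
have mO := st_meas H Ox.
have bk : bmfun (Om x `&` eball x rho) (fun w => k rho (x - w)).
  exact: bmfunS mO (@subIsetl _ _ _) (bmfun_ker p0 x rho0 mO).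
have bu' := bmfunS mO (@subIsetl _ _ (eball x rho)) (bmfun_Om H Ox bmu).
have lo : - (l * C0 * rho `^ (2 - 2 * s)) <=
    lint (Om x `&` eball x rho) (fun w => (u x - u w) * k rho (x - w)).
  apply: (near_lower_bound H C0_moment Ox rho0 rho0 rz' bu' l0 _ bk).
  - move=> z Oz Oz' zr.
    have := H1 x z; rewrite subrr enorm0 => /(_ r10 (lt_trans zr rr1)).
    rewrite ler_norml => /andP[_ +].
    have := uphi _ (st_sub H Ox Oz); have := uphi _ (st_sub H Ox Oz'); rewrite ux.
    move: (phi _) (phi _) (phi _) (u _) (u _) => a b c u1 u2.
    by move: (2 * l * _) => *; lra.
  - by move=> z; rewrite kerN.
  - by move=> z; rewrite ker_ge0 lexx.
have := Ht rho rho0 rt; rewrite ler_pdivlMr// => h1.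
have pw0 : 0 <= C0 * rho `^ (2 - 2 * s) by rewrite mulr_ge0 ?(ltW C0_gt0) ?powR_ge0.
have h2 : (l + 1) * C0 * rho `^ (2 - 2 * s) + l * C0 * rho `^ (2 - 2 * s) <= e.
  apply: le_trans h1; rewrite /K; move: pw0.
  have -> : rho `^ (2 - 2 * s) * (2 * (l + 1) * C0) = 2 * (l + 1) * (C0 * rho `^ (2 - 2 * s)) by ring.
  rewrite -[_ * C0 * _]mulrA -[l * C0 * _]mulrA -mulrDl => P0.
  by rewrite ler_wpM2r//; lra.
move: up lo h2; move: (lint _ _) (L _ _ _) (h x * u x) (g x) (_ * rho `^ _) (_ * rho `^ _) => *.
lra.
Unshelve. all: by end_near. Qed.

End stability.

(** * Viscosity subsolutions tested with paraboloids *)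

Section approximation.
Context {R : realType} {n : nat}.
Notation V := 'rV[R]_n.+1.
Implicit Types (x y z a : V) (K Omega : set V) (v psi : V -> R).

Lemma continuous_within_enorm K v : {within K, continuous v} -> forall e x, 0 < e -> K x ->
  exists2 r : R, 0 < r & forall y, K y -> enorm (y - x) < r -> `|v x - v y| < e.
Proof.
move=> /subspace_continuousP cv e x e0 Kx; have := cv x Kx.
move=> /cvgrPdist_lt/(_ _ e0); rewrite near_withinE => /nbhs_eball[r r0 xr].
by exists r => // y Ky yx; exact: xr.
Qed.

Lemma uniform_continuity K v : compact K -> {within K, continuous v} -> forall e, 0 < e ->
  exists2 t : R, 0 < t & forall x y, K x -> K y -> enorm (x - y) < t -> `|v x - v y| < e.
Proof.
move=> cK cv; apply: (compact_uniform (E := fun x y => `|v x - v y|) cK).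
  exact: continuous_within_enorm.
move=> x y z _ _ _; rewrite (distrC (v x) (v y)).
by rewrite (le_trans _ (ler_normD _ _))// subrKA.
Qed.

Lemma finite_net K (t : R) : compact K -> 0 < t -> exists2 S : seq V,
  (forall a, a \in S -> K a) & forall x, K x -> exists2 a, a \in S & enorm (x - a) < t.
Proof.
rewrite compact_cover => cK t0.
have [] := cK V K (fun a => eball a t).
- by move=> a _; exact: open_eball.
- by move=> x Kx; exists x => //; rewrite /eball/= subrr enorm0.
move=> D DK KD; exists (enum_fset D) => [a /DK|x /KD[a /= aD xa]]; first by rewrite inE.
by exists a.
Qed.

Lemma pcube_ge0 (t : R) : 0 <= pcube t.
Proof. by rewrite exprn_ge0// le_max lexx. Qed.

Lemma pcube_gt0 (t : R) : 0 < t -> 0 < pcube t.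
Proof. by move=> t0; rewrite exprn_gt0// lt_max t0 orbT. Qed.

Lemma pcube_le0 (t : R) : t <= 0 -> pcube t = 0.
Proof. by move=> t0; rewrite /pcube max_l// expr0n. Qed.

(** A partition of unity: v is replaced by the average of its values at the points of a finite net,
    with weights of class C2 supported in balls on which v varies by less than e. *)
Lemma C2_approximation Omega K v e : compact K -> Omega `<=` K -> {within K, continuous v} ->
  0 < e -> exists2 psi, C2d Omega psi & forall x, Omega x -> `|psi x - v x| <= e.
Proof.
move=> cK OK cv e0; have [t t0 vt] := uniform_continuity cK cv e0.
have [S SK KS] := finite_net cK t0.
(* Written with sums and products only, in the form the C2 calculus recognises. *)
pose w a y := pcube (t ^+ 2 + (-1) * enorm (y - a) ^+ 2).
have w0 a y : 0 <= w a y by exact: pcube_ge0.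
have wpos a y : enorm (y - a) < t -> 0 < w a y.
  by move=> ya; rewrite pcube_gt0// mulN1r subr_gt0 ltrXn2r ?enorm_ge0.
have wnul a y : t <= enorm (y - a) -> w a y = 0.
  move=> ya; rewrite /w pcube_le0// mulN1r subr_le0.
  by rewrite lerXn2r ?nnegrE ?enorm_ge0// ltW.
have Cw a : C2d Omega (w a).
  apply: C2d_pcube; apply: C2d_add; first exact: C2d_cst.
  by apply: C2d_mul; [exact: C2d_cst|exact: C2d_sqr_enorm].
pose W y := \sum_(a <- S) w a y.
have W0 y : K y -> 0 < W y.
  move=> Ky; have [a aS ya] := KS y Ky; rewrite /W (big_rem a aS)/=.
  by rewrite ltr_pwDl ?wpos// sumr_ge0.
exists (fun y => (\sum_(a <- S) v a * w a y) * (W y)^-1).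
  apply: C2d_mul.
    by apply: C2d_sum => a; apply: C2d_mul; [exact: C2d_cst|exact: Cw].
  apply: C2d_inv; first exact: C2d_sum.
  by move=> x /OK /W0; exact: lt0r_neq0.
move=> x /OK Kx; have Wx := W0 x Kx.
have -> : (\sum_(a <- S) v a * w a x) / W x - v x = (\sum_(a <- S) (v a - v x) * w a x) / W x.
  rewrite -[in LHS](mulfK (lt0r_neq0 Wx) (v x)) -mulrBl; congr (_ / _).
  by rewrite /W mulr_sumr -sumrB; apply: eq_bigr => a _; rewrite mulrBl.
rewrite normrM normfV (gtr0_norm Wx) ler_pdivrMr//.
rewrite (le_trans (ler_norm_sum _ _ _))// /W mulr_sumr !big_seq.
apply: ler_sum => a aS; rewrite normrM (ger0_norm (w0 _ _)).
have [ax|ax] := ltP (enorm (x - a)) t; last by rewrite wnul// !mulr0.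
by rewrite ler_wpM2r// distrC ltW// vt//; exact: SK.
Qed.

Lemma cutoff_bounds (t : R) : 0 <= t ->
  [/\ 0 <= 1 - pcube (1 - t), 1 - pcube (1 - t) <= 1, 1 - pcube (1 - t) <= 3 * t &
      1 <= t -> 1 - pcube (1 - t) = 1].
Proof.
move=> t0; have [t1|t1] := leP 1 t.
  by rewrite pcube_le0 ?subr_le0// subr0; split => //; lra.
have -> : 1 - pcube (1 - t) = 3 * t - t ^+ 2 * (3 - t).
  by rewrite /pcube max_r ?subr_ge0 ?ltW//; ring.
have h0 : 0 <= t ^+ 2 * (3 - t) by rewrite mulr_ge0 ?sqr_ge0//; lra.
have h1 : 3 * t - t ^+ 2 * (3 - t) = 1 - (1 - t) ^+ 3 by ring.
have h2 : 0 <= (1 - t) ^+ 3 by rewrite exprn_ge0// subr_ge0 ltW.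
have h3 : (1 - t) ^+ 3 <= 1 by apply: exprn_ile1; lra.
by split; lra.
Qed.

End approximation.

Section viscosity_quadratic.
Context {R : realType} {n : nat}.
Notation V := 'rV[R]_n.+1.
Variables (s : R) (Omega Sigma : set V) (Om : V -> set V) (h f : V -> R).
Variables (alpha zeta etaf Cf : R).
Hypothesis H : setting s Omega Sigma Om h f alpha zeta etaf Cf.
Implicit Types (x y z w : V) (A : set V) (r rho c l : R) (u v g j phi : V -> R).

Local Notation d := (dist_bdry Omega).
Local Notation k := (ker (@kexp R n s)).
Local Notation L := (nonlocal s Om).
Local Notation p := (@kexp R n s).

Variable C0 : R.
Hypothesis C0_gt0 : 0 < C0.
Hypothesis C0_moment : forall rho x r, 0 < rho -> 0 < r ->
  lint (eball x r) (fun w => enorm (x - w) `^ 2 * k rho (x - w)) <= C0 * r `^ (2 - 2 * s).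

Local Notation qsub := (quadratic_sub s Omega Om h zeta C0).

(** The principal value gives an upper bound for the truncated integrals at small rho, hence
    for L_rho phi, and the change of scale is the one for the capped equations. *)
Lemma test_scale phi x r c (a : R) : C2_on Omega phi -> Omega x -> bmfun Omega phi ->
  0 < r -> r <= zeta * d x -> 0 <= c ->
  (forall z, Omega (x - z) -> Omega (x + z) -> enorm z < r ->
     - (2 * c * enorm z ^+ 2) <= (phi x - phi (x - z)) + (phi x - phi (x + z))) ->
  (Ls s (Om x) phi x <= a%:E)%E -> L r phi x <= a + c * C0 * r `^ (2 - 2 * s).
Proof.
move=> Cphi Ox bphi r0 rx c0 hphi La; have oO := st_open H.
have /andP[s0 s1] := st_s H; have q0 : 0 < 2 - 2 * s by lra.
have [r1 [l [r10 l0 r1O H1]]] := C2_second_difference oO Cphi Ox.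
apply/ler_addgt0Pr => e e0; have e2 : 0 < e / 2 by exact: divr_gt0.
have K0 : 0 < l * C0 + 1 by rewrite ltr_pwDr// mulr_ge0// ltW.
have [t t0 Ht] := small_power q0 (divr_gt0 e2 K0).
have trunc : \forall rho \near (0 : R)^'+, (truncated s Om rho phi x < (a + e / 2)%:E)%E.
  have cv := truncated_cvg H C0_gt0 C0_moment Cphi Ox.
  have oL : nbhs (lim (truncated s Om rho phi x @[rho --> (0 : R)^'+]))
      [set b : \bar R | (b < (a + e / 2)%:E)%E].
    apply: open_nbhs_nbhs; split; first exact: open_ereal_lt_ereal.
    by rewrite /= -LsE; apply: (le_lt_trans La); rewrite lte_fin ltrDl.
  exact: cv oL.
have [rho [[[[rho0 rr1] rr] rt] trho]] : exists rho : R,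
    ((((0 < rho /\ rho < r1) /\ rho <= r) /\ rho <= t) /\
    (truncated s Om rho phi x < (a + e / 2)%:E)%E).
  apply: (@filter_ex _ ((0 : R)^'+)); apply: filterI trunc.
  apply: filterI; last exact: nbhs_right_le.
  apply: filterI; last exact: nbhs_right_le.
  by apply: filterI; [exact: nbhs_right_gt|exact: nbhs_right_lt].
rewrite (truncated_nonlocal H rho0 Ox bphi) lte_fin in trho.
have mO := st_meas H Ox.
have bphi' := bmfunS mO (@subIsetl _ _ (eball x rho)) (bmfun_Om H Ox bphi).
have up : lint (Om x `&` eball x rho) (fun y => (phi x - phi y) * k rho (x - y)) <=
    l * C0 * rho `^ (2 - 2 * s).
  apply: (ball_upper H C0_moment Ox rho0 (le_trans rr rx) bphi' l0) => z Oz Oz' zr.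
  have := H1 x z; rewrite subrr enorm0 => /(_ r10 (lt_trans zr rr1)).
  rewrite ler_norml => /andP[+ _].
  by move: (phi _) (phi _) (phi _) (2 * l * _) => *; lra.
have sc := nonlocal_scale H C0_moment Ox rho0 rr rx bphi c0 hphi.
have := Ht rho rho0 rt; rewrite ler_pdivlMr// => h1.
have pw0 : 0 <= rho `^ (2 - 2 * s) by rewrite powR_ge0.
have h2 : l * C0 * rho `^ (2 - 2 * s) <= e / 2.
  by apply: le_trans h1; rewrite mulrC ler_wpM2l// lerDl.
move: sc trho up h2; move: (lint _ _) (L _ _ _) (L _ _ _) (_ * rho `^ _) (_ * r `^ _) => *.
lra.
Qed.

Variables (g v : V -> R) (M : R).
Hypothesis cv : {within closure Omega, continuous v}.
Hypothesis bv : forall x, Omega x -> `|v x| <= M.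
Hypothesis test : forall x phi, Omega x -> C2_on Omega phi -> v x = phi x ->
  (forall y, Omega y -> v y <= phi y) -> ((h x * phi x)%:E + Ls s (Om x) phi x <= (g x)%:E)%E.

Lemma within_closure_in : {in Omega, continuous v}.
Proof.
rewrite -continuous_open_subspace; last exact: st_open H.
exact: continuous_subspaceW (@subset_closure _ _) cv.
Qed.

(** The touching paraboloid phi is far from v away from x, and the operator applied to it says
    little about the operator applied to v. Off a small ball it is replaced by psi + e2,
    where psi is a C2 approximation of v; the cut-off th vanishes to second order at x, so that
    the opening grows only by 6 e2 / dl^2, while the test function stays within e1 + 2 e2
    of v everywhere. *)
Lemma visc_quadratic_sub r : 0 < r -> qsub g r v.
Proof.
move=> r0 x y0 c Ox c0 rx touch; have oO := st_open H.
have cvO := within_closure_in; have bmv := continuous_bounded_bmfun H cvO bv.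
pose phi w := v x + c * (enorm (w - y0) ^+ 2 + - enorm (x - y0) ^+ 2).
have phix : phi x = v x by rewrite /phi subrr mulr0 addr0.
have vphi w : Omega w -> v w <= phi w by exact: touch.
have Cphi : C2d Omega phi.
  apply: C2d_add; first exact: C2d_cst.
  apply: C2d_mul; first exact: C2d_cst.
  by apply: C2d_add; [exact: C2d_sqr_enorm|exact: C2d_cst].
have cphi : {in Omega, continuous phi}.
  by have [[]] := C2d_C2 oO Cphi; rewrite continuous_open_subspace.
pose P := C0 * r `^ (2 - 2 * s); have P0 : 0 < P by rewrite mulr_gt0// powR_gt0.
pose B := r `^ (- p) * vol Omega; have B0 : 0 <= B by rewrite mulr_ge0 ?powR_ge0 ?vol_ge0.
rewrite -mulrA -/P; apply/ler_addgt0Pr => e e0.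
have B1 : 0 < 12 * B + 1 by lra.
(* e1 bounds phi - v on the small ball and e2 the distance of psi to v; e2 is chosen after
   the radius dl, to compensate the factor 1 / dl^2 in the opening. *)
pose e1 := e / (12 * B + 1); have e10 : 0 < e1 by rewrite divr_gt0.
have e1B : 6 * e1 * B <= e / 2.
  have : e1 * (12 * B + 1) = e by rewrite /e1 divfK// lt0r_neq0.
  by rewrite mulrDr mulr1 (mulrCA e1) -mulrA; move: (e1 * B) e10 => *; lra.
have [dl dl0 near_x] : exists2 dl : R, 0 < dl & forall w, enorm (w - x) < dl -> `|phi w - v w| < e1.
  have cd : {for x, continuous (fun w => phi w - v w)}.
    exact: (cvgB (cphi x (mem_set Ox)) (cvO x (mem_set Ox))).
  have [dl dl0 Hd] := (continuousP_enorm _ _).1 cd _ e10.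
  by exists dl => // w /Hd; rewrite phix subrr subr0.
pose e2 := Num.min e1 (e * dl ^+ 2 / (12 * P)).
have d20 : 0 < dl ^+ 2 by rewrite exprn_gt0.
have P12 : 0 < 12 * P by rewrite mulr_gt0.
have e20 : 0 < e2 by rewrite lt_min e10 divr_gt0// mulr_gt0.
have e21 : e2 <= e1 by rewrite ge_min lexx.
have e2P : 6 * e2 / dl ^+ 2 * P <= e / 2.
  have : e2 <= e * dl ^+ 2 / (12 * P) by rewrite ge_min lexx orbT.
  rewrite ler_pdivlMr// => h1; rewrite mulrAC ler_pdivrMr//.
  by move: (dl ^+ 2) h1 => *; lra.
have [psi Cpsi psiv] := C2_approximation
  (compact_closure (st_bounded H)) (@subset_closure _ Omega) cv e20.
pose tau w := dl ^- 2 * enorm (w - x) ^+ 2.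
pose th w := 1 + -1 * pcube (1 + -1 * tau w).
have tau0 w : 0 <= tau w by rewrite mulr_ge0 ?sqr_ge0// invr_ge0 ltW.
have thE w : th w = 1 - pcube (1 - tau w) by rewrite /th !mulN1r.
pose ph w := phi w + th w * (psi w + (e2 + -1 * phi w)).
have Cth : C2d Omega th.
  apply: C2d_add; first exact: C2d_cst.
  apply: C2d_mul; first exact: C2d_cst.
  apply: C2d_pcube; apply: C2d_add; first exact: C2d_cst.
  apply: C2d_mul; first exact: C2d_cst.
  by apply: C2d_mul; [exact: C2d_cst|exact: C2d_sqr_enorm].
have Cph : C2_on Omega ph.
  apply: (C2d_C2 oO); apply: C2d_add => //; apply: C2d_mul => //.
  apply: C2d_add => //; apply: C2d_add; first exact: C2d_cst.
  by apply: C2d_mul => //; exact: C2d_cst.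
have phE w : ph w = (1 - th w) * phi w + th w * (psi w + e2) by rewrite /ph; ring.
have phx : ph x = v x.
  by rewrite phE thE /tau subrr enorm0 expr0n mulr0 subr0 /pcube max_r// expr1n; rewrite subrr subr0 mul1r mul0r addr0.
have psie w : Omega w -> v w <= psi w + e2 <= v w + 2 * e2.
  by move=> /psiv; rewrite ler_norml => /andP[? ?]; apply/andP; split; lra.
have lower w : Omega w -> v w <= ph w.
  move=> Ow; have /andP[h1 _] := psie w Ow; have h2 := vphi w Ow.
  have [t0 t1 _ _] := cutoff_bounds (tau0 w); rewrite -thE in t0 t1.
  rewrite phE [leLHS](_ : _ = (1 - th w) * v w + th w * v w); last by ring.
  by apply: lerD; apply: ler_wpM2l => //; rewrite subr_ge0.
have upper w : Omega w -> ph w <= v w + (e1 + 2 * e2).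
  move=> Ow; have /andP[_ h1] := psie w Ow; have h2 := vphi w Ow.
  have [t0 t1 _ t3] := cutoff_bounds (tau0 w); rewrite -thE in t0 t1 t3.
  have h3 : (1 - th w) * phi w <= (1 - th w) * (v w + e1).
    have [wd|wd] := ltP (enorm (w - x)) dl.
      rewrite ler_wpM2l ?subr_ge0//; have := near_x w wd.
      by rewrite ltr_norml => /andP[_ ?]; lra.
    rewrite t3 ?subrr ?mul0r// /tau mulrC ler_pdivlMr// mul1r.
    by rewrite lerXn2r ?nnegrE ?enorm_ge0// ltW.
  have h4 : th w * (psi w + e2) <= th w * (v w + 2 * e2) by rewrite ler_wpM2l.
  rewrite phE; apply: (le_trans (lerD h3 h4)).
  have : (1 - th w) * e1 <= e1 by rewrite ger_pMl//; lra.
  have : th w * (2 * e2) <= 2 * e2 by rewrite ger_pMl// mulr_gt0.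
  have -> : (1 - th w) * (v w + e1) + th w * (v w + 2 * e2) =
      v w + ((1 - th w) * e1 + th w * (2 * e2)) by ring.
  by rewrite lerD2l => g1 g2; exact: lerD.
have close w : Omega w -> `|ph w - v w| <= e1 + 2 * e2.
  move=> Ow; have := lower w Ow; have := upper w Ow => h1 h2.
  by rewrite ger0_norm ?subr_ge0// lerBlDl.
have bph : bmfun Omega ph.
  have cph : {in Omega, continuous ph}.
    by have [[]] := Cph; rewrite continuous_open_subspace.
  apply: (@continuous_bounded_bmfun _ _ _ _ _ _ _ _ _ _ _ _ H ph (M + (e1 + 2 * e2)) cph).
  move=> w Ow; rewrite -(subrK (v w) (ph w)) addrC (le_trans (ler_normD _ _))//.
  by apply: lerD; [exact: bv|exact: close].
pose c' := c + 6 * e2 / dl ^+ 2.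
have c'0 : 0 <= c' by rewrite addr_ge0// divr_ge0// ?(ltW d20)// mulr_ge0// ltW.
have ph_phi z : Omega (x + z) -> ph (x + z) <= phi (x + z) + 6 * e2 / dl ^+ 2 * enorm z ^+ 2.
  move=> Oz; rewrite /ph lerD2l.
  have [t0 t1 t2 _] := cutoff_bounds (tau0 (x + z)); rewrite -thE in t0 t1 t2.
  have /andP[_ h1] := psie _ Oz; have h2 := vphi _ Oz.
  apply: (@le_trans _ _ (th (x + z) * (2 * e2))); first by rewrite ler_wpM2l//; lra.
  apply: (@le_trans _ _ (3 * tau (x + z) * (2 * e2))).
    by rewrite ler_wpM2r// mulr_ge0// ltW.
  by rewrite /tau addrAC subrr add0r le_eqVlt; apply/orP; left; apply/eqP; ring.
have sd z : Omega (x - z) -> Omega (x + z) -> enorm z < r ->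
    - (2 * c' * enorm z ^+ 2) <= (ph x - ph (x - z)) + (ph x - ph (x + z)).
  move=> O1 O2 _; have h1 := ph_phi _ O1; have h2 := ph_phi _ O2; rewrite enormN in h1.
  rewrite phx /c'; move: h1 h2; rewrite /phi.
  have par := enorm_parallelogram (x - y0) z.
  have -> : x - z - y0 = x - y0 - z by rewrite addrAC.
  have -> : x + z - y0 = x - y0 + z by rewrite addrAC.
  have -> : enorm (x - y0 + z) ^+ 2 =
    2 * enorm (x - y0) ^+ 2 + 2 * enorm z ^+ 2 - enorm (x - y0 - z) ^+ 2 by rewrite -par; ring.
  move: (6 * e2 / _) (enorm z ^+ 2) (enorm (x - y0 - z) ^+ 2) (enorm (x - y0) ^+ 2) => q Z A1 A2.
  move: (ph _) (ph _) (v x) => p1 p2 vx h1 h2.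
  rewrite [leLHS](_ : _ = - (2 * c * Z) - 2 * (q * Z)); last by ring.
  have e3 : c * (A1 + - A2) + c * (2 * A2 + 2 * Z - A1 + - A2) = 2 * c * Z by ring.
  by move: h1 h2 e3; move: (c * (A1 + _)) (c * (2 * A2 + _ - _ + _)) (2 * c * Z) (q * Z) => *; lra.
have La : (Ls s (Om x) ph x <= (g x - h x * v x)%:E)%E.
  by have := test Ox Cph (esym phx) lower; rewrite phx EFinB leeBrDl.
have sc := test_scale Cph Ox bph r0 rx c'0 sd La.
have st := nonlocal_stable H r0 Ox bph bmv (le_trans (normr_ge0 _) (close x Ox)) close.
rewrite -/B in st.
have e12 : 2 * (e1 + 2 * e2) * B <= e / 2.
  by apply: le_trans e1B; rewrite ler_wpM2r//; lra.
rewrite -mulrA -/P /c' mulrDl in sc.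
move: sc st e12 e2P; move: (L _ _ _) (L _ _ _) (h x * v x) (c * P) (_ * P) (_ * B) => *.
lra.
Qed.

End viscosity_quadratic.

(** * From subsolutions to supersolutions *)

Section negation.
Context {R : realType} {n : nat}.
Notation V := 'rV[R]_n.+1.
Notation T := (caratheodory_type (@leb_om R n)).
Variables (s : R) (Omega Sigma : set V) (Om : V -> set V) (h f : V -> R).
Variables (alpha zeta etaf Cf : R).
Hypothesis H : setting s Omega Sigma Om h f alpha zeta etaf Cf.
Implicit Types (x y z w : V) (A : set V) (r rho c l M : R) (g u v phi : V -> R).

Local Notation k := (ker (@kexp R n s)).
Local Notation p := (@kexp R n s).

Let p0 : 0 < p. Proof. exact: kexp_gt0 (st_s H). Qed.

Variable C0 : R.
Hypothesis C0_gt0 : 0 < C0.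
Hypothesis C0_moment : forall rho x r, 0 < rho -> 0 < r ->
  lint (eball x r) (fun w => enorm (x - w) `^ 2 * k rho (x - w)) <= C0 * r `^ (2 - 2 * s).

Lemma C2_onN phi : C2_on Omega phi -> C2_on Omega (fun y => - phi y).
Proof.
move=> Cphi; have oO := st_open H.
have C1N g : C1_on Omega g -> C1d Omega g (fun i => partial i g).
  move=> [cg dg] x Ox; rewrite continuous_open_subspace// in cg.
  split; first by apply: cg; rewrite inE.
  move=> i; have [di ci] := dg i; rewrite continuous_open_subspace// in ci.
  split; last by apply: ci; rewrite inE.
  by apply: DeriveDef => //; exact: di.
have Cd : C2d Omega phi.
  case: Cphi => C1 C2; exists (fun i => partial i phi); split; first exact: C1N.
  by move=> i; exists (fun j => partial j (partial i phi)); exact: C1N.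
have -> : (fun y => - phi y) = fun y => -1 * phi y by apply/funext => y; rewrite mulN1r.
by apply: (C2d_C2 oO); apply: C2d_mul => //; exact: C2d_cst.
Qed.

(** The change of sign is legitimate although the integral may be infinite: phi is bounded above, so
    the negative part of the integrand is integrable. *)
Lemma truncatedN rho phi x M : 0 < rho -> Omega x -> (forall y, Omega y -> phi y <= M) ->
  measurable_fun (Omega : set T) (phi : T -> R) ->
  truncated s Om rho (fun y => - phi y) x = (- truncated s Om rho phi x)%E.
Proof.
move=> rho0 Ox phiM mphi; rewrite !truncatedE; set A := Om x `\` eball x rho.
have mA : leb_measurable A := leb_measurable_ring H rho Ox.
have AO : A `<=` Omega by move=> y [Oy _]; exact: st_sub H _ Ox _ Oy.
pose F (y : T) : \bar R := ((phi x - phi y) * k rho (x - y))%:E.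
have mF : measurable_fun (A : set T) F.
  apply/measurable_EFinP; apply: measurable_funM; last exact: (measurable_ker H x rho0 mA).
  apply: measurable_funB; first exact: measurable_cst.
  by apply: measurable_funS mphi => //; exact: open_leb_measurable (st_open H).
transitivity (\int[leb R n]_(y in A) (- F y))%E.
  by apply: eq_integral => y _; rewrite /F -EFinN; congr _%:E; ring.
apply: integralN; apply: fin_num_adde_defl; rewrite fin_numN.
have F0 : (0 <= \int[leb R n]_(y in A) (F^\-)%E y)%E.
  by apply: integral_ge0 => y _; exact: funeneg_ge0.
rewrite ge0_fin_numE//.
have [_ fA] : finmeas A := finmeasD (finmeas_Om H Ox) (leb_measurable_eball _ _).
pose K := `|M - phi x| * rho `^ (- p); have K0 : 0 <= K by rewrite mulr_ge0 ?powR_ge0.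
apply: (@le_lt_trans _ _ (\int[leb R n]_(y in A) (cst K%:E y))%E).
  apply: ge0_le_integral; first exact: mA.
  - by move=> y _; exact: funeneg_ge0.
  - exact: measurable_funeneg.
  - exact: measurable_cst.
  - move=> y Ay; rewrite /= funenegE ge_max [X in _ && X]lee_fin K0 andbT /F -EFinN lee_fin.
    have hk := ker_ge0 p rho (x - y).
    apply: (@le_trans _ _ (`|M - phi x| * k rho (x - y))).
      rewrite -mulNr opprB ler_wpM2r// (le_trans _ (ler_norm _))// lerD2r.
      exact/phiM/AO.
    by rewrite ler_wpM2l//; exact: (ker_le p0).
rewrite integral_cst; last exact: mA.
by rewrite lte_mul_pinfty// lee_fin.
Qed.

Lemma LsN phi x M : Omega x -> (forall y, Omega y -> phi y <= M) -> C2_on Omega phi ->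
  Ls s (Om x) (fun y => - phi y) x = (- Ls s (Om x) phi x)%E.
Proof.
move=> Ox phiM Cphi; have oO := st_open H.
have mphi : measurable_fun (Omega : set T) (phi : T -> R).
  apply: (continuous_leb_measurable_fun oO).
  by case: Cphi => -[+ _] _; rewrite continuous_open_subspace.
have cv := truncated_cvg H C0_gt0 C0_moment Cphi Ox.
have ne : \forall rho \near (0 : R)^'+,
    (- truncated s Om rho phi x)%E = truncated s Om rho (fun y => - phi y) x.
  near=> rho; have rho0 : 0 < rho by near: rho; exact: nbhs_right_gt.
  by rewrite (truncatedN rho0 Ox phiM mphi).
rewrite !LsE; apply/cvg_lim => //; apply: cvg_trans (near_eq_cvg ne) _.
exact: cvgeN cv.
Unshelve. all: by end_near. Qed.

Definition sub_test g u := forall x phi, Omega x -> C2_on Omega phi -> u x = phi x ->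
  (forall y, Omega y -> u y <= phi y) -> ((h x * phi x)%:E + Ls s (Om x) phi x <= (g x)%:E)%E.

Definition super_test g u := forall x phi, Omega x -> C2_on Omega phi -> u x = phi x ->
  (forall y, Omega y -> phi y <= u y) -> ((g x)%:E <= (h x * phi x)%:E + Ls s (Om x) phi x)%E.

Lemma super_testN g u M : (forall x, Omega x -> u x <= M) ->
  sub_test (fun x => - g x) (fun x => - u x) -> super_test g u.
Proof.
move=> uM sub x phi Ox Cphi ux phiu.
have phiM y : Omega y -> phi y <= M by move=> Oy; exact: le_trans (phiu y Oy) (uM y Oy).
have := sub x _ Ox (C2_onN Cphi) (congr1 -%R ux).
rewrite (LsN Ox phiM Cphi) mulrN EFinN -oppeD ?fin_num_adde_defr// EFinN leeN2; apply.
by move=> y Oy; rewrite lerN2; exact: phiu.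
Qed.

Lemma sub_testN g u M : (forall x, Omega x -> u x <= M) ->
  super_test g u -> sub_test (fun x => - g x) (fun x => - u x).
Proof.
move=> uM sup x phi Ox Cphi ux uphi.
have phiM y : Omega y -> - phi y <= M.
  by move=> Oy; apply: le_trans (uM y Oy); rewrite lerNl; exact: uphi.
have ux' : u x = - phi x by rewrite -ux opprK.
have := sup x _ Ox (C2_onN Cphi) ux'.
have phiK : phi = (fun y => - (fun y => - phi y) y) by apply/funext => y; rewrite opprK.
rewrite [in X in _ -> X]phiK (LsN Ox phiM (C2_onN Cphi)) => h1.
rewrite mulrN EFinN -oppeD ?fin_num_adde_defr// EFinN leeN2; apply: h1.
by move=> y Oy; rewrite lerNl; exact: uphi.
Qed.

End negation.

(** * Boundary values, existence and uniqueness *)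

Section boundary.
Context {R : realType} {n : nat}.
Notation V := 'rV[R]_n.+1.
Variable Omega : set V.
Hypothesis Omega_open : open Omega.
Hypothesis Omega_bounded : bounded_set Omega.
Implicit Types (x y z : V) (u v : V -> R).

Local Notation d := (dist_bdry Omega).

Lemma continuous_inN u : {in Omega, continuous u} -> {in Omega, continuous (fun x => - u x)}.
Proof. by move=> cu x xO; exact: (@cvgN _ _ _ _ _ u (u x) (cu x xO)). Qed.

Lemma continuous_withinN (A : set V) u : {within A, continuous u} ->
  {within A, continuous (fun x => - u x)}.
Proof. by move=> cu x; exact: (@cvgN _ _ _ _ _ u (u x) (cu x)). Qed.

Lemma continuous_LSCb u M : {in Omega, continuous u} -> (forall x, Omega x -> `|u x| <= M) ->
  LSCb Omega u.
Proof.
move=> cu uM; split; last by exists M.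
have cw : {within Omega, continuous u} by rewrite continuous_open_subspace.
move=> x a; rewrite lte_fin => ax.
exists [set y | a < u y]; last by move=> y; rewrite lte_fin.
exact: (cw x _ (lt_nbhsr ax)).
Qed.

(** At a boundary point, d y is at most the distance from y to that point. *)
Lemma dist_pow_continuous u (K eta : R) : 0 < K -> 0 < eta -> {in Omega, continuous u} ->
  (forall x, Omega x -> `|u x| <= K * d x `^ eta) -> (forall x, ~ Omega x -> u x = 0) ->
  {within closure Omega, continuous u}.
Proof.
move=> K0 eta0 cu uK u0; apply/subspace_continuousP => x /(closureE_bdry Omega_open)[Ox|bx].
  by apply: cvg_within_filter; apply: cu; rewrite inE.
apply: cvg_within_filter; apply/continuousP_enorm => e e0.
have [t t0 Ht] := small_power eta0 (divr_gt0 (divr_gt0 e0 (ltr0n R 2)) K0).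
exists t => // y yx; change (`|u y - u x| < e).
rewrite (u0 x) ?subr0; last by move=> /(not_bdry Omega_open).
have [Oy|nOy] := pselect (Omega y); last by rewrite u0// normr0.
apply: (le_lt_trans (uK y Oy)).
apply: (@le_lt_trans _ _ (K * enorm (y - x) `^ eta)).
  rewrite ler_wpM2l ?(ltW K0)//; apply: (ge0_ler_powR (ltW eta0)); rewrite ?nnegrE ?dist_ge0 ?enorm_ge0//.
  exact: dist_le.
have [->|yx0] := eqVneq (enorm (y - x)) 0; first by rewrite powR0 ?lt0r_neq0// mulr0.
have yx1 : 0 < enorm (y - x) by rewrite lt_neqAle eq_sym yx0 enorm_ge0.
have := Ht _ yx1 (ltW yx); rewrite ler_pdivlMr// mulrC => h1.
by apply: (le_lt_trans h1); rewrite ltr_pdivrMr// ltr_pMr// ltr1n.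
Qed.

Lemma small_near_bdry v : {within closure Omega, continuous v} ->
  (forall x, bdry Omega x -> v x = 0) -> (forall x, Omega x -> 0 < d x) ->
  forall e, 0 < e -> exists2 del : R, 0 < del & forall x, Omega x -> d x < 2 * del -> `|v x| <= e.
Proof.
move=> cv v0 d0 e e0.
have [t t0 Ht] := uniform_continuity (compact_closure Omega_bounded) cv e0.
exists (t / 2); first exact: divr_gt0.
move=> x Ox; rewrite mulrC divfK// => dx.
have [b bb xb] := dist_nearest Omega_bounded x (dist_gt0_bdry_nonempty (d0 x Ox)).
have := Ht x b (subset_closure Ox) bb.1; rewrite -xb => /(_ dx).
by rewrite (v0 b bb) subr0 => /ltW.
Qed.

End boundary.

Theorem theorem2p2 (R : realType) (n : nat) (s : R)
    (Omega Sigma : set 'rV[R]_n.+1) (Om : 'rV[R]_n.+1 -> set 'rV[R]_n.+1)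
    (h f : 'rV[R]_n.+1 -> R) (alpha beta : R)
    (hs : 0 < s < 1)
    (Omega_open : open Omega) (Omega_bounded : bounded_set Omega)
    (Om_sub : forall x, Omega x -> Om x `<=` Omega)
    (Om_meas : forall x, Omega x -> leb_measurable (Om x))
    (Sigma_open : open Sigma)
    (h_cont : {within Omega, continuous h})
    (hab : 0 < alpha <= beta)
    (h_bounds : forall x, Omega x ->
       [/\ 0 < alpha / dist_bdry Omega x `^ (2 * s),
           alpha / dist_bdry Omega x `^ (2 * s) <= h x &
           h x <= beta / dist_bdry Omega x `^ (2 * s)])
    (cond_i : forall x, Omega x ->
       leb R n (Om y `+` Om x) @[y --> within Omega (nbhs x)] --> 0%E)
    (cond_ii : exists zeta : R, 0 < zeta < 2^-1 /\
       forall x, Omega x -> forall r : R, r <= zeta * dist_bdry Omega x ->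
         [set z | Om x (x - z)] `&` eball 0 r = Sigma `&` eball 0 r)
    (cond_iii_sym : Sigma = [set - z | z in Sigma])
    (cond_iii_dens : exists q : R, 0 < q < 1 /\ forall r : R, 0 < r ->
         (q%:E * leb R n (eball 0%R (2 * r)%R `\` eball 0%R r) <=
          leb R n (Sigma `&` (eball 0%R (2 * r)%R `\` eball 0%R r)))%E)
    (f_cont : {within Omega, continuous f})
    (f_growth : exists eta_f C_f : R, [/\ 0 < eta_f < 2 * s, 0 < C_f &
       forall x, Omega x ->
         `|f x| * dist_bdry Omega x `^ (2 * s - eta_f) <= C_f]) :
  exists u : 'rV[R]_n.+1 -> R,
    [/\ visc_solution s Omega Om h f u,
        (forall v, visc_solution s Omega Om h f v ->
           forall x, closure Omega x -> v x = u x) &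
        exists eta C : R, [/\ 0 < eta, 0 < C &
          forall x, Omega x -> `|u x| <= C * dist_bdry Omega x `^ eta]].
Proof.
have [zeta [/andP[zeta0 _] Hzeta]] := cond_ii.
have [etaf [Cf [/andP[etaf0 _] Cf0 Hf]]] := f_growth.
have /andP[alpha0 _] := hab; have /andP[s0 _] := hs.
have s2 : 2 * s != 0 by rewrite mulf_neq0 ?lt0r_neq0.
have H : setting s Omega Sigma Om h f alpha zeta etaf Cf.
  split => //.
  - by rewrite -continuous_open_subspace.
  - move=> x Ox; have [h1 _ _] := h_bounds x Ox.
    rewrite lt_neqAle dist_ge0 andbT eq_sym; apply: contraTneq h1 => ->.
    by rewrite powR0// invr0 mulr0 ltxx.
  - by move=> x Ox; have [_ h1 _] := h_bounds x Ox; rewrite powRN.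
  - by move=> z Sz; rewrite cond_iii_sym; exists z.
  - by rewrite -continuous_open_subspace.
have [C0 C00 C0m] := @near_moment R n s hs; have [C1 C10 C1m] := @far_moment R n s hs.
have [U [eta [K [eta0 K0 UP]]]] := approx_family_ex H C00 C0m C10 C1m.
have [u [cu uK u0 ulim]] := limit_ex H C00 C0m eta0 K0 UP.
have [M M0 HM] := dist_pow_bound H K0 eta0.
have uM x : Omega x -> `|u x| <= M by move=> Ox; exact: le_trans (uK x Ox) (HM x Ox).
have cU rho : 0 < rho -> {in Omega, continuous (U rho)} by move=> /UP[].
have bU rho : 0 < rho -> forall x, Omega x -> `|U rho x| <= M.
  by move=> /UP[_ h1 _] x Ox; exact: le_trans (h1 x Ox) (HM x Ox).
have eqU rho : 0 < rho -> forall x, Omega x -> h x * U rho x + nonlocal s Om rho (U rho) x = f x.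
  by move=> /UP[].
have neg_in := @continuous_inN R n Omega.
have subu : sub_test s Omega Om h f u.
  by move=> x phi; exact: (limit_visc_sub H C00 C0m (st_f H) cU bU eqU cu uM ulim).
have supu : super_test s Omega Om h f u.
  apply: (super_testN H C00 C0m (M := M)).
    by move=> x Ox; exact: le_trans (ler_norm _) (uM x Ox).
  move=> x phi; apply: (limit_visc_sub H C00 C0m (neg_in _ (st_f H))
     (U := fun rho x => - U rho x) (M := M)).
  - by move=> rho rho0; exact: neg_in (cU rho rho0).
  - by move=> rho rho0 y Oy; rewrite normrN; exact: bU.
  - move=> rho rho0 y Oy; have bm := continuous_bounded_bmfun H (cU rho rho0) (bU rho rho0).
    by rewrite (nonlocalN H rho0 Oy bm) -(eqU rho rho0 y Oy); ring.
  - exact: neg_in cu.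
  - by move=> y Oy; rewrite normrN; exact: uM.
  - move=> kap kap0; have [r r0 Hr] := ulim kap kap0; exists r => // rho rho0 rr y Oy.
    by rewrite -opprD normrN; exact: Hr.
have bdry_out x : bdry Omega x -> ~ Omega x by move=> bx /(not_bdry Omega_open).
exists u; split; last by exists eta, K.
- split.
  + exact: (dist_pow_continuous Omega_open K0 eta0 cu uK u0).
  + split=> //; apply: (continuous_LSCb Omega_open (M := M) (neg_in _ cu)).
    by move=> x Ox; rewrite normrN; exact: uM.
  + by split=> //; exact: (continuous_LSCb Omega_open cu uM).
  + by move=> x /bdry_out; exact: u0.
- move=> v [cv [[_ [Mv vM']] subv] [_ supv] v0] x /(closureE_bdry Omega_open)[Ox|bx]; last first.
    by rewrite v0// u0//; exact: bdry_out.
  have vM y : Omega y -> `|v y| <= Num.max Mv 1.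
    by move=> /vM'; rewrite normrN le_max => ->.
  have Mv0 : 0 < Num.max Mv 1 by rewrite lt_max ltr01 orbT.
  have cvN := continuous_withinN cv.
  have subv' : sub_test s Omega Om h (fun y => - f y) (fun y => - v y).
    apply: (sub_testN H C00 C0m (M := Num.max Mv 1)) => //.
    by move=> y Oy; exact: le_trans (ler_norm _) (vM y Oy).
  have vMN y : Omega y -> `|- v y| <= Num.max Mv 1 by rewrite normrN; exact: vM.
  apply/eqP; rewrite -subr_eq0 -normr_le0; apply/ler_addgt0Pr => e e0; rewrite add0r.
  have e2 : 0 < e / 2 by exact: divr_gt0.
  have [r1 r10 H1] := approx_family_compare H C00 C0m eta0 K0 UP (within_closure_in H cv)
    (small_near_bdry Omega_bounded cv v0 (st_dist H)) Mv0 vM e2.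
  have [r2 r20 H2] := ulim _ e2.
  pose r := Num.min r1 r2; have r0 : 0 < r by rewrite lt_min r10.
  have h1 : `|v x - U r x| <= e / 2.
    apply: H1 => //; first by rewrite ge_min lexx.
      exact: (visc_quadratic_sub H C00 C0m cv vM subv r10).
    exact: (visc_quadratic_sub H C00 C0m cvN vMN subv' r10).
  have h2 : `|U r x - u x| <= e / 2 by apply: H2 => //; rewrite ge_min lexx orbT.
  rewrite -(subrKA (U r x)) (le_trans (ler_normD _ _))// (le_trans (lerD h1 h2))//.
  by rewrite -splitr.
Qed.
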